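(* Let $g:[0,1]\times E\to\mathbb R$ be bounded and measurable and assume: (i) there is $L>0$ such that $\sup_{x\in E}\|\delta_xQ_u-\delta_xQ_v\|_{\mathrm{TV}}\le L|u-v|$ for all $u,v\in[0,1]$; (ii) there are an integer $m\ge 1$ and $r\in(0,1)$ such that $\sup_{u\in[0,1]}\sup_{x,y\in E}\|\delta_xQ_u^m-\delta_yQ_u^m\|_{\mathrm{TV}}\le r$; (iii) there is $K<\infty$ such that $\sup_{u\in[0,1]}\|g(u,\cdot)\|_\infty\le K$; (iv) there is $C_g\ge 0$ such that $|g(u,x)-g(v,x)|\le C_g|u-v|$ for all $u,v\in[0,1]$, $x\in E$. Assume also that $a>0$. Then there exists a constant $C>0$ such that for all $n\ge1$, $$\sup_{t\in\mathbb R}\left|\mathbb P(S_n-bn\le a\sqrt n\,t)-\Phi(t)\right|\le \frac{C}{\sqrt n},\qquad \Phi(t)=\frac1{\sqrt{2\pi}}\int_{-\infty}^te^{-x^2/2}\,dx.$$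
   Context: $(E,d)$ is a metric space with Borel $\sigma$-algebra $\mathcal B(E)$ and $\{Q_u:u\in[0,1]\}$ is a family of Markov transition kernels on $(E,\mathcal B(E))$. For probability measures, $\|\mu-\nu\|_{\mathrm{TV}}=\sup_{\|f\|_\infty\le1}|\int f\,d\mu-\int f\,d\nu|=2\sup_{A\in\mathcal B(E)}|\mu(A)-\nu(A)|$; $\delta_x$ is the Dirac mass at $x$. Under (i)-(ii) each $Q_u$ has a unique invariant probability measure, denoted $\pi_u$. For each $n\ge1$, $X_{n,0},X_{n,1},\dots,X_{n,n}$ is an inhomogeneous Markov chain on $E$ with $X_{n,0}\sim\pi_0$ (the measure $\pi_u$ at $u=0$) and $\mathbb P(X_{n,k}\in A\mid X_{n,k-1}=x)=Q_{k/n}(x,A)$ for $1\le k\le n$. Set $S_n=\sum_{k=1}^n g(k/n,X_{n,k})$. Constants: $b=\int_0^1\int_E g(u,x)\,d\pi_u(x)\,du$; $a\ge0$ is given by $a^2=\int_0^1a_u^2\,du$, where $a_u^2=\lim_{n\to\infty}\frac1n\operatorname{Var}(\sum_{j=1}^ng(u,Y_{j,u}))$ and $(Y_{j,u})_{j\ge0}$ is the stationary Markov chain with transition operator $Q_u$ (initial law $\pi_u$). *)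

(* Defs.v *)
From HB Require Import structures.
From mathcomp Require Import all_boot all_order all_algebra.
From mathcomp Require Import all_classical all_reals all_analysis.

Set Implicit Arguments.
Unset Strict Implicit.
Unset Printing Implicit Defensive.

Import Order.TTheory GRing.Theory Num.Theory.
Import numFieldNormedType.Exports.

Local Open Scope classical_set_scope.
Local Open Scope ring_scope.

(* Every [measurableType] is pointed, so a metric space must come with a
   distinguished point before its Borel sigma-algebra can be formed. *)
#[short(type="pointedMetricType")]
HB.structure Definition PointedMetric (K : numDomainType) :=
  { M of Metric K M & isPointed M }.

Notation borel E := (g_sigma_algebraType (@open E)).

(* With test functions |f| <= 1, this is 2 * sup_A |mu A - nu A| when mu and nu
   are probability measures, hence takes values in [0, 2]. *)
Definition tv_dist d (T : measurableType d) (R : realType)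
    (mu nu : {measure set T -> \bar R}) : \bar R :=
  ereal_sup [set `| \int[mu]_x f x - \int[nu]_x f x |%:E |
    f in [set f : T -> R |
      measurable_fun [set: T] f /\ forall x, `|f x| <= 1]].

Section kernels.
Context d (T : measurableType d) (R : realType).

(* [kpow Q m x] is the law after m steps of [Q] from x; [mkcomp_noparam] gives
   [kpow Q m.+1 x A = \int[kpow Q m x]_y Q y A]. *)
Fixpoint kpow (Q : R.-pker T ~> T) (m : nat) : R.-spker T ~> T :=
  if m is m'.+1 then mkcomp_noparam (kpow Q m') Q
  else kdirac (@measurable_id _ T [set: T]).

Definition invariant_measure (Q : R.-pker T ~> T) (mu : probability T R) :=
  forall A, measurable A -> (\int[mu]_x Q x A = mu A)%E.

End kernels.

Section markov_chain.
Context d d' (Omega : measurableType d) (T : measurableType d') (R : realType).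
Variable P : probability Omega R.

Definition past (X : nat -> {RV P >-> T}) (k : nat) : set (set Omega) :=
  <<s [set B | exists2 j, (j <= k)%N &
        exists2 A, measurable A & B = X j @^-1` A] >>.

(* X_0, ..., X_N is a Markov chain with initial law [mu], [Q k] being the
   kernel of the step from time k-1 to time k.  The second clause says that
   [Q k.+1 (X k _) A] is a version of P(X_{k+1} \in A | X_0, ..., X_k).
   The values X_j with j > N are irrelevant. *)
Definition markov_chain (N : nat) (mu : probability T R)
    (Q : nat -> R.-pker T ~> T) (X : nat -> {RV P >-> T}) : Prop :=
  (forall A, measurable A -> distribution P (X 0%N) A = mu A) /\
  (forall k A B, (k < N)%N -> measurable A -> past X k B ->
    (P (B `&` X k.+1 @^-1` A) = \int[P]_(w in B) Q k.+1 (X k w) A)%E).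

End markov_chain.

Definition asymptotic_variance d d' (Omega : measurableType d)
    (T : measurableType d') (R : realType) (P : probability Omega R)
    (f : T -> R) (Y : nat -> {RV P >-> T}) : R :=
  limn (fun n : nat =>
    n%:R^-1 * fine 'V_P[fun w => \sum_(1 <= j < n.+1) f (Y j w)]).

Definition gauss_cdf (R : realType) (t : R) : R :=
  (Num.sqrt (2 * pi))^-1 *
  \int[lebesgue_measure]_(x in `]-oo, t]) expR (- (x ^+ 2) / 2).

(* Main.v *)
(* Fourier method. Let xi_k be the centred k-th summand and phi_k(x) the
   expectation of exp(i t (xi_{k+1} + ... + xi_n)) given X_k = x. Contraction
   over m steps keeps the oscillation of phi_k of order |t| relative to its
   modulus when |t| <= delta, so c_k = E phi_k(X_k) does not vanish, and each
   ratio c_{k-1} / c_k is 1 - t^2 tau_k / 2 + O(|t|^3) with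
   tau_k = E xi_k^2 + 2 E xi_k (xi_{k+1} + ... + xi_n). Multiplying the ratios
   gives the characteristic function of the centred sum up to
   O(n |t|^3) exp(- c n t^2), without any comparison of the chain with
   independent variables.

   Kernels, invariant laws and g being Lipschitz in u, the law of X_k is within
   O(1/n) of pi_{k/n}, and tau_k is within O(1/n) plus a term geometric in n - k
   of a_{k/n}^2. As u |-> a_u^2 and u |-> pi_u g_u are Lipschitz, Riemann sums
   give sum_k tau_k = n a^2 + O(1) and E S_n = b n + O(1). Esseen's smoothing
   inequality, with a Fejer kernel of bandwidth delta, concludes. *)

Require Import Defs.
From HB Require Import structures.
From mathcomp Require Import all_boot all_order all_algebra.
From mathcomp Require Import all_classical all_reals all_analysis.
From mathcomp Require Import measurable_realfun complex ring lra zify.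

Set Implicit Arguments.
Unset Strict Implicit.
Unset Printing Implicit Defensive.

Import Order.TTheory GRing.Theory Num.Theory.
Import numFieldNormedType.Exports.

Local Open Scope classical_set_scope.
Local Open Scope ring_scope.

(** * Bounded measurable functions, total variation and complex integrals *)

(** The functions [phi k] may be exponentially small in (n - k) t^2, so absolute error bounds are
    useless for them: every error is measured against a nearby value of [phi]. This is possible
    because only oscillations have to be controlled. Each auxiliary function ([corr], [psi], [res],
    [pcorr]) is determined up to a constant by a backward recursion, and where its size matters the
    constant is fixed by the value of its mean. Hence one principle, [osc_rec], serves throughout: a
    backward family that solves its recursion up to one-step errors of oscillation e, and is
    constant at time n, has oscillation at most e m / (1 - q), uniformly in n. It gives the
    expansion of [psi] in t as well as the Lipschitz dependence of the correctors on u. Its dual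
    [mclose_chain] does the same for laws.

    Since r may be close to 1, contraction estimates for complex functions must lose no constant
    factor; this excludes splitting into real and imaginary parts. Small n need no argument: both
    distribution functions lie in [0, 1], so enlarging C is enough. *)

Notation Re := complex.Re.
Notation Im := complex.Im.

Section bounded_measurable.
Context d (T : measurableType d) (R : realType).
Implicit Types f g : T -> R.

Definition bmeas f := measurable_fun setT f /\ exists M, forall x, `|f x| <= M.

Lemma bmeas_cst c : bmeas (fun=> c).
Proof. by split; [exact: measurable_cst|exists `|c|]. Qed.

Lemma bmeasD f g : bmeas f -> bmeas g -> bmeas (fun x => f x + g x).
Proof.
move=> [mf [M fM]] [mg [N gN]]; split; first exact: measurable_funD.
by exists (M + N) => x; rewrite (le_trans (ler_normD _ _))// lerD.
Qed.

Lemma bmeasM f g : bmeas f -> bmeas g -> bmeas (fun x => f x * g x).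
Proof.
move=> [mf [M fM]] [mg [N gN]]; split; first exact: measurable_funM.
by exists (M * N) => x; rewrite normrM ler_pM.
Qed.

Lemma bmeasZ c f : bmeas f -> bmeas (fun x => c * f x).
Proof. by move=> bf; apply: bmeasM => //; exact: bmeas_cst. Qed.

Lemma bmeasN f : bmeas f -> bmeas (fun x => - f x).
Proof.
move=> bf; rewrite (_ : (fun x => - f x) = (fun x => -1 * f x)).
  exact: bmeasZ.
by apply/funext => x; rewrite mulN1r.
Qed.

Lemma bmeasB f g : bmeas f -> bmeas g -> bmeas (fun x => f x - g x).
Proof. by move=> bf bg; apply: bmeasD => //; exact: bmeasN. Qed.

Section integral.
Variable mu : {measure set T -> \bar R}.
Hypothesis mu1 : mu setT = 1%E.

Lemma bmeas_integrable f : bmeas f -> mu.-integrable setT (EFin \o f).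
Proof.
move=> [mf [M fM]]; apply: measurable_bounded_integrable => //.
  by rewrite mu1 ltry.
exists M; split; first exact: num_real.
by move=> x Mx y _ /=; apply: le_trans (fM y) (ltW Mx).
Qed.

Lemma Rintegral1_cst c : \int[mu]_x c = c.
Proof. by rewrite Rintegral_cst// mu1/= mulr1. Qed.

Lemma bmeas_RintegralD f g : bmeas f -> bmeas g ->
  \int[mu]_x (f x + g x) = \int[mu]_x f x + \int[mu]_x g x.
Proof. by move=> bf bg; rewrite RintegralD//; exact: bmeas_integrable. Qed.

Lemma bmeas_RintegralB f g : bmeas f -> bmeas g ->
  \int[mu]_x (f x - g x) = \int[mu]_x f x - \int[mu]_x g x.
Proof. by move=> bf bg; rewrite RintegralB//; exact: bmeas_integrable. Qed.

Lemma bmeas_RintegralZ c f : bmeas f ->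
  \int[mu]_x (c * f x) = c * \int[mu]_x f x.
Proof. by move=> bf; rewrite RintegralZl//; exact: bmeas_integrable. Qed.

Lemma bmeas_Rintegral_le f M : bmeas f -> (forall x, f x <= M) ->
  \int[mu]_x f x <= M.
Proof.
move=> bf fM; rewrite -[leRHS]Rintegral1_cst; apply: le_Rintegral => //.
  exact: bmeas_integrable.
exact/bmeas_integrable/bmeas_cst.
Qed.

Lemma bmeas_Rintegral_norm_le f M : bmeas f -> (forall x, `|f x| <= M) ->
  `|\int[mu]_x f x| <= M.
Proof.
move=> bf fM; rewrite ler_norml; apply/andP; split.
  rewrite lerNl -mulN1r -bmeas_RintegralZ//; apply: bmeas_Rintegral_le.
    exact: bmeasZ.
  by move=> x; rewrite mulN1r lerNl; have := fM x; rewrite ler_norml => /andP[].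
apply: bmeas_Rintegral_le => // x.
by have := fM x; rewrite ler_norml => /andP[].
Qed.

End integral.
End bounded_measurable.

Section tv.
Context d (T : measurableType d) (R : realType).
Variables (mu nu : {measure set T -> \bar R}).
Hypotheses (mu1 : mu setT = 1%E) (nu1 : nu setT = 1%E).

(** Both measures have mass one, so [f] may be recentred at [f x0] for free; divided by [c] it
    becomes a test function of [tv_dist]. Total variation thus acts on functions modulo constants,
    which is why oscillation is the natural seminorm. *)
Lemma tv_dist_Rintegral (e c : R) (f : T -> R) (x0 : T) :
  (tv_dist mu nu <= e%:E)%E -> bmeas f -> (forall x, `|f x - f x0| <= c) ->
  `|\int[mu]_x f x - \int[nu]_x f x| <= e * c.
Proof.
move=> tv_le bf fc.
have c0 : 0 <= c by rewrite (le_trans _ (fc x0)).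
have e1 (h : T -> R) : measurable_fun setT h -> (forall x, `|h x| <= 1) ->
    `|\int[mu]_x h x - \int[nu]_x h x| <= e.
  move=> mh h1; rewrite -lee_fin; apply: le_trans tv_le.
  by apply: ereal_sup_ubound; exists h.
have bc := bmeas_cst T (f x0).
have -> : \int[mu]_x f x - \int[nu]_x f x =
    \int[mu]_x (f x - f x0) - \int[nu]_x (f x - f x0).
  by rewrite !bmeas_RintegralB// !Rintegral1_cst//; ring.
(* For [c = 0] the rescaling is impossible, but then [f] is constant. *)
have [c_eq0|c_neq0] := eqVneq c 0.
  have f0 x : f x - f x0 = 0.
    by have := fc x; rewrite c_eq0 normr_le0 => /eqP.
  under eq_Rintegral do rewrite f0.
  under [X in _ - X]eq_Rintegral do rewrite f0.
  by rewrite !Rintegral1_cst// subrr normr0 c_eq0 mulr0.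
have c_gt0 : 0 < c by rewrite lt_neqAle eq_sym c_neq0.
have bh : bmeas (fun x => c^-1 * (f x - f x0)).
  by apply: bmeasZ; exact: bmeasB.
have := e1 _ bh.1; rewrite !bmeas_RintegralZ//; [|exact: bmeasB..].
rewrite -mulrBr normrM gtr0_norm ?invr_gt0// -ler_pdivlMl ?invr_gt0// invrK.
rewrite [e * c]mulrC; apply => x; rewrite normrM gtr0_norm ?invr_gt0//.
by rewrite mulrC ler_pdivrMr// mul1r.
Qed.

End tv.

(** * The complex modulus as a real number *)

Section complex_norm.
Variable R : realType.
Implicit Types (z w : R[i]).
Local Open Scope complex_scope.

(** The modulus with values in [R], so that bounds live in an ordered field; the norm of [R[i]] is
    itself complex-valued. *)
Definition cn z : R := Normc.normc z.

Lemma cnE z : cn z = Num.sqrt (Re z ^+ 2 + Im z ^+ 2).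
Proof. by case: z. Qed.
Lemma cn_ge0 z : 0 <= cn z.
Proof. by rewrite cnE sqrtr_ge0. Qed.
Lemma cn0 : cn 0 = 0. Proof. exact: Normc.normc0. Qed.
Lemma cn1 : cn 1 = 1. Proof. exact: Normc.normc1. Qed.
Lemma cnM z w : cn (z * w) = cn z * cn w. Proof. exact: Normc.normcM. Qed.
Lemma cnV z : cn z^-1 = (cn z)^-1. Proof. exact: Normc.normcV. Qed.
Lemma cnD z w : cn (z + w) <= cn z + cn w. Proof. exact: le_normcD. Qed.
Lemma cnN z : cn (- z) = cn z. Proof. exact: normcN. Qed.
Lemma cnB z w : cn (z - w) <= cn z + cn w.
Proof. by rewrite (le_trans (cnD _ _))// cnN. Qed.
Lemma cnC z w : cn (z - w) = cn (w - z).
Proof. by rewrite -cnN opprB. Qed.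
Lemma cnBl z w : cn z - cn w <= cn (z - w).
Proof. by rewrite lerBlDr (le_trans _ (cnD _ _))// subrK. Qed.
Lemma cn_eq0 z : (cn z == 0) = (z == 0).
Proof.
apply/eqP/eqP => [|->]; [exact: Normc.eq0_normc|exact: cn0].
Qed.
Lemma cn_real (a : R) : cn a%:C = `|a|.
Proof. by rewrite cnE/= expr0n/= addr0 sqrtr_sqr. Qed.
Lemma cn_i : cn ('i : R[i]) = 1.
Proof. by rewrite cnE/= expr0n/= add0r expr1n sqrtr1. Qed.
Lemma cn_sqr z : cn z ^+ 2 = Re z ^+ 2 + Im z ^+ 2.
Proof. by rewrite cnE sqr_sqrtr// addr_ge0// sqr_ge0. Qed.
Lemma cn_Re z : `|Re z| <= cn z.
Proof. by rewrite cnE -sqrtr_sqr ler_wsqrtr// lerDl sqr_ge0. Qed.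
Lemma cn_Im z : `|Im z| <= cn z.
Proof. by rewrite cnE -sqrtr_sqr ler_wsqrtr// lerDr sqr_ge0. Qed.
Lemma cn_le_ReIm z : cn z <= `|Re z| + `|Im z|.
Proof.
rewrite -[leRHS]ger0_norm ?addr_ge0// -sqrtr_sqr cnE ler_wsqrtr//.
rewrite sqrrD !real_normK ?num_real// lerD2r lerDl mulrn_wge0// mulr_ge0//.
Qed.
Lemma ReM z w : Re (z * w) = Re z * Re w - Im z * Im w.
Proof. by case: z; case: w. Qed.
Lemma ImM z w : Im (z * w) = Re z * Im w + Im z * Re w.
Proof. by case: z; case: w. Qed.
Lemma ReD z w : Re (z + w) = Re z + Re w.
Proof. by case: z; case: w. Qed.
Lemma ImD z w : Im (z + w) = Im z + Im w.
Proof. by case: z; case: w. Qed.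
Lemma ReB z w : Re (z - w) = Re z - Re w.
Proof. by case: z; case: w. Qed.
Lemma complex_eta z : z = Re z +i* Im z.
Proof. by case: z. Qed.

Definition expi (x : R) : R[i] := cos x +i* sin x.

Lemma expi0 : expi 0 = 1.
Proof. by rewrite /expi cos0 sin0. Qed.

Lemma expiD x y : expi (x + y) = expi x * expi y.
Proof.
rewrite /expi cosD sinD; apply/eqP; rewrite eq_complex/=.
by rewrite eqxx/= addrC (mulrC (cos x)).
Qed.

End complex_norm.

Section complex_integral.
Context d (T : measurableType d) (R : realType).
Implicit Types f g : T -> R[i].
Local Open Scope complex_scope.

Definition cbm f := bmeas (fun x => Re (f x)) /\ bmeas (fun x => Im (f x)).

Lemma cbm_real (f : T -> R) : bmeas f -> cbm (fun x => (f x)%:C).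
Proof. by move=> bf; split => //=; exact: bmeas_cst. Qed.

Lemma cbm_cst c : cbm (fun=> c).
Proof. by split; exact: bmeas_cst. Qed.

Lemma cbmD f g : cbm f -> cbm g -> cbm (fun x => f x + g x).
Proof.
move=> [f1 f2] [g1 g2]; split.
  by under eq_fun do rewrite ReD; exact: bmeasD.
by under eq_fun do rewrite ImD; exact: bmeasD.
Qed.

Lemma cbmM f g : cbm f -> cbm g -> cbm (fun x => f x * g x).
Proof.
move=> [f1 f2] [g1 g2]; split.
  by under eq_fun do rewrite ReM; apply: bmeasB; exact: bmeasM.
by under eq_fun do rewrite ImM; apply: bmeasD; exact: bmeasM.
Qed.

Lemma cbmZ c f : cbm f -> cbm (fun x => c * f x).
Proof. by move=> bf; apply: cbmM => //; exact: cbm_cst. Qed.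

Lemma cbmB f g : cbm f -> cbm g -> cbm (fun x => f x - g x).
Proof.
move=> bf bg; apply: cbmD => //; rewrite (_ : (fun x => - g x) = (fun x => -1 * g x)).
  exact: cbmZ.
by apply/funext => x; rewrite mulN1r.
Qed.

Lemma cbm_expi (f : T -> R) : measurable_fun setT f -> cbm (fun x => expi (f x)).
Proof.
move=> mf; split; split=> /=.
- by apply: measurableT_comp => //; apply: continuous_measurable_fun; exact: continuous_cos.
- by exists 1 => x; rewrite ler_norml cos_geN1 cos_le1.
- by apply: measurableT_comp => //; apply: continuous_measurable_fun; exact: continuous_sin.
- by exists 1 => x; rewrite ler_norml sin_geN1 sin_le1.
Qed.

Definition cint (mu : {measure set T -> \bar R}) f : R[i] :=
  (\int[mu]_x Re (f x)) +i* (\int[mu]_x Im (f x)).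

Lemma eq_cint mu f g : f =1 g -> cint mu f = cint mu g.
Proof. by move=> /funext ->. Qed.

Section theory.
Variable mu : {measure set T -> \bar R}.
Hypothesis mu1 : mu setT = 1%E.

Lemma cint_cst c : cint mu (fun=> c) = c.
Proof. by rewrite /cint !Rintegral1_cst//; case: c. Qed.

Lemma cintD f g : cbm f -> cbm g ->
  cint mu (fun x => f x + g x) = cint mu f + cint mu g.
Proof.
move=> [f1 f2] [g1 g2]; rewrite /cint.
under eq_Rintegral do rewrite ReD.
under [X in _ +i* X]eq_Rintegral do rewrite ImD.
by rewrite !bmeas_RintegralD.
Qed.

Lemma cintZ c f : cbm f -> cint mu (fun x => c * f x) = c * cint mu f.
Proof.
move=> [f1 f2]; rewrite /cint.
under eq_Rintegral do rewrite ReM.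
under [X in _ +i* X]eq_Rintegral do rewrite ImM.
rewrite bmeas_RintegralB//; [|exact: bmeasZ..].
rewrite bmeas_RintegralD//; [|exact: bmeasZ..].
by rewrite !bmeas_RintegralZ//; case: c.
Qed.

Lemma cintB f g : cbm f -> cbm g ->
  cint mu (fun x => f x - g x) = cint mu f - cint mu g.
Proof.
move=> bf bg; rewrite -mulN1r -cintZ// -cintD//; last exact: cbmZ.
by apply: eq_cint => x; rewrite mulN1r.
Qed.

Lemma cint_real (f : T -> R) : cint mu (fun x => (f x)%:C) = (\int[mu]_x f x)%:C.
Proof. by rewrite /cint/= Rintegral1_cst. Qed.

End theory.

(* Rotating by the conjugate of [w] reduces a bound on a complex number to a
   bound on real parts, which real integrals preserve without any loss. *)
Lemma cn_le_rotate (w : R[i]) (c : R) : 0 <= c ->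
  Re (w^* * w) <= cn w * c -> cn w <= c.
Proof.
move=> c0.
have -> : Re (w^* * w) = cn w ^+ 2.
  by rewrite cn_sqr; case: w => a b /=; ring.
have [->|w0] := eqVneq (cn w) 0; first by rewrite mul0r.
have w_gt0 : 0 < cn w by rewrite lt_neqAle eq_sym w0 cn_ge0.
by rewrite expr2 ler_pM2l.
Qed.

Lemma Re_conj_le (w z : R[i]) : `|Re (w^* * z)| <= cn w * cn z.
Proof.
rewrite (le_trans (cn_Re _))// cnM ler_wpM2r ?cn_ge0//.
by rewrite !cnE; case: w => a b/=; rewrite sqrrN.
Qed.

Lemma cint_Re_rotate (mu : {measure set T -> \bar R}) (w : R[i]) f :
  mu setT = 1%E -> cbm f ->
  Re (w * cint mu f) = \int[mu]_x Re (w * f x).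
Proof. by move=> mu1 bf; rewrite -cintZ. Qed.

Lemma cn_cint (mu : {measure set T -> \bar R}) f M :
  mu setT = 1%E -> cbm f -> (forall x, cn (f x) <= M) ->
  cn (cint mu f) <= M.
Proof.
move=> mu1 bf fM; have M0 : 0 <= M by rewrite (le_trans _ (fM point))// cn_ge0.
apply: cn_le_rotate => //; rewrite cint_Re_rotate//.
apply: bmeas_Rintegral_le => //; first exact: (cbmZ _ bf).1.
move=> x; rewrite (le_trans (ler_norm _))// (le_trans (Re_conj_le _ _))//.
by rewrite ler_wpM2l ?cn_ge0.
Qed.

(** The factor is exactly [e], as for real functions: this is what keeps a contraction rate below 1
    for complex functions too. *)
Lemma cn_cint_tv (mu nu : {measure set T -> \bar R}) f (e c : R) :
  mu setT = 1%E -> nu setT = 1%E -> (tv_dist mu nu <= e%:E)%E ->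
  cbm f -> (forall x y, cn (f x - f y) <= c) ->
  cn (cint mu f - cint nu f) <= e * c.
Proof.
move=> mu1 nu1 tv_le bf fc.
have e0 : 0 <= e.
  rewrite -lee_fin; apply: le_trans tv_le; apply: ereal_sup_ubound.
  exists (fun=> 0); first by split => //= x; rewrite normr0.
  by rewrite !Rintegral1_cst// subrr normr0.
have c0 : 0 <= c by rewrite (le_trans _ (fc point point))// cn_ge0.
set w := _ - _; apply: cn_le_rotate; first by rewrite mulr_ge0.
rewrite {2}/w mulrBr ReB !cint_Re_rotate//.
rewrite (le_trans (ler_norm _))//.
rewrite [leRHS]mulrCA; apply: (@tv_dist_Rintegral _ _ _ _ _ _ _ _ _ _ point) => //.
  exact: (cbmZ _ bf).1.
move=> x; rewrite -ReB -mulrBr (le_trans (Re_conj_le _ _))//.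
by rewrite ler_wpM2l ?cn_ge0.
Qed.

End complex_integral.

Section kernel_operator.
Context d d' (T : measurableType d) (T' : measurableType d') (R : realType).
Implicit Type P : R.-pker T ~> T'.

Definition rop P (f : T' -> R) (x : T) : R := \int[P x]_y f y.
Definition cop P (f : T' -> R[i]) (x : T) : R[i] := cint (P x) f.

Lemma bmeas_rop P f : bmeas f -> bmeas (rop P f).
Proof.
move=> bf; have [mf [M fM]] := bf; split; last first.
  by exists M => x; apply: bmeas_Rintegral_norm_le => //; exact: prob_kernel.
(* Measurability of a kernel integral is available for nonnegative integrands, hence the shift by
   [M], subtracted again afterwards. *)
pose g y := f y + M.
have bg : bmeas g by apply: bmeasD => //; exact: bmeas_cst.
have g0 y : 0 <= g y by have := fM y; rewrite ler_norml /g => /andP[? ?]; lra.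
have mg : measurable_fun setT (fun x => (\int[P x]_y (g y)%:E)%E).
  apply: (@measurable_fun_integral_kernel _ _ _ _ _ P).
  - by move=> U mU; exact: measurable_kernel.
  - by move=> z; rewrite lee_fin.
  - by apply/measurable_EFinP; exact: bg.1.
have -> : rop P f = (fun x => fine (\int[P x]_y (g y)%:E)%E - M).
  apply/funext => x; have := @bmeas_RintegralD _ _ _ (P x) (prob_kernel x) _ _ bf (bmeas_cst _ M).
  rewrite Rintegral1_cst; last exact: prob_kernel.
  by rewrite /rop /g /Rintegral => ->; rewrite addrK.
by apply: measurable_funB => //; exact: measurableT_comp.
Qed.

Lemma cbm_cop P f : cbm f -> cbm (cop P f).
Proof. by move=> [f1 f2]; split; exact: bmeas_rop. Qed.

Lemma eq_cop P f g : f =1 g -> cop P f =1 cop P g.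
Proof. by move=> /funext ->. Qed.

Lemma cop_cst P c x : cop P (fun=> c) x = c.
Proof. by rewrite /cop cint_cst//; exact: prob_kernel. Qed.

Lemma copD P f g x : cbm f -> cbm g ->
  cop P (fun y => f y + g y) x = cop P f x + cop P g x.
Proof. by move=> *; apply: cintD => //; exact: prob_kernel. Qed.

Lemma copB P f g x : cbm f -> cbm g ->
  cop P (fun y => f y - g y) x = cop P f x - cop P g x.
Proof. by move=> *; apply: cintB => //; exact: prob_kernel. Qed.

Lemma copZ P c f x : cbm f -> cop P (fun y => c * f y) x = c * cop P f x.
Proof. by move=> *; apply: cintZ => //; exact: prob_kernel. Qed.

Lemma cn_cop P f M x : cbm f -> (forall y, cn (f y) <= M) -> cn (cop P f x) <= M.
Proof. by move=> *; apply: cn_cint => //; exact: prob_kernel. Qed.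

Lemma cop_real P (f : T' -> R) x :
  cop P (fun y => (f y)%:C%C) x = (rop P f x)%:C%C.
Proof. by rewrite /cop cint_real//; exact: prob_kernel. Qed.

End kernel_operator.

(** * Taylor bounds for exponentials and products of factors close to 1 *)

Section elementary_bounds.
Variable R : realType.
Implicit Types x y t : R.
Local Open Scope complex_scope.

Lemma normr_sin_le x : `|sin x| <= `|x|.
Proof.
wlog x0 : x / 0 < x.
  move=> H; have [x0|x0|->] := ltgtP x 0; last by rewrite sin0 !normr0.
    by rewrite -normrN -sinN -(normrN x) H// oppr_gt0.
  exact: H.
have dsin z : z \in `]0, x[ -> is_derive z 1 (@sin R) (cos z).
  by move=> _; exact: is_derive_sin.
have csin : {within `[0, x], continuous (@sin R)}.
  by apply: continuous_subspaceT => z; exact: continuous_sin.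
have [c _] := MVT x0 dsin csin.
rewrite sin0 !subr0 => ->; rewrite normrM ler_piMl// ler_norml.
by rewrite cos_geN1 cos_le1.
Qed.

Lemma cosE_half x : cos x = 1 - 2 * sin (x / 2) ^+ 2.
Proof.
have {1}-> : x = x / 2 + x / 2 by field.
by rewrite cosD -!expr2 cos2sin2; ring.
Qed.

Lemma one_sub_cos_bound x : 0 <= 1 - cos x <= x ^+ 2 / 2.
Proof.
rewrite cosE_half; have := normr_sin_le (x / 2).
rewrite -ler_sqr ?nnegrE// !real_normK ?num_real// => h.
have := sqr_ge0 (sin (x / 2)); have : (x / 2) ^+ 2 = x ^+ 2 / 4 by field.
by move=> e; rewrite e in h => ?; apply/andP; split; lra.
Qed.

(** Mean value theorem for sin y - y, whose derivative cos y - 1 is at most x^2 / 2 in modulus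
    between 0 and x; hence 1/2 rather than the sharp 1/6. *)
Lemma sin_sub_bound x : `|sin x - x| <= `|x| ^+ 3 / 2.
Proof.
wlog x0 : x / 0 < x.
  move=> H; have [x0|x0|->] := ltgtP x 0.
  - by have := H (- x); rewrite oppr_gt0 => /(_ x0); rewrite sinN normrN -opprD normrN.
  - exact: H.
  - by rewrite sin0 subr0 normr0 expr0n/= mul0r.
have df z : z \in `]0, x[ -> is_derive z 1 (fun y : R => sin y - y) (cos z - 1).
  by move=> _; apply: is_deriveB.
have cf : {within `[0, x], continuous (fun y : R => sin y - y)}.
  apply: continuous_subspaceT => z; apply: cvgB; first exact: continuous_sin.
  exact: cvg_id.
have [c] := MVT x0 df cf; rewrite in_itv/= => /andP[c0 cx].
rewrite sin0 !subr0 => ->; rewrite normrM exprSr mulrAC ler_wpM2r//.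
have /andP[h1 h2] := one_sub_cos_bound c.
rewrite distrC ger0_norm// (le_trans h2)// ler_pM2r ?invr_gt0//.
by rewrite gtr0_norm// lerXn2r ?nnegrE ?ltW.
Qed.

(** The left side is 2 ((x/2)^2 - sin(x/2)^2), a difference of squares, to which the cubic bound on
    the sine applies. *)
Lemma cos_sub_bound x : `|cos x - 1 + x ^+ 2 / 2| <= `|x| ^+ 4 / 8.
Proof.
have -> : cos x - 1 + x ^+ 2 / 2 =
    2 * ((x / 2 - sin (x / 2)) * (x / 2 + sin (x / 2))).
  by rewrite cosE_half; field.
rewrite normrM gtr0_norm// normrM.
have h1 := sin_sub_bound (x / 2); rewrite distrC in h1.
have h2 : `|x / 2 + sin (x / 2)| <= `|x|.
  rewrite (le_trans (ler_normD _ _))//.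
  have := normr_sin_le (x / 2); rewrite normrM [ `|2^-1|]gtr0_norm ?invr_gt0// => ?; lra.
rewrite normrM [ `|2^-1|]gtr0_norm ?invr_gt0// in h1.
rewrite (@le_trans _ _ (2 * ((`|x| / 2) ^+ 3 / 2 * `|x|)))//.
  by rewrite ler_pM2l// ler_pM.
by rewrite le_eqVlt; apply/orP; left; apply/eqP; field.
Qed.

Lemma cn_expi_sub1 x : cn (expi x - 1) <= `|x|.
Proof.
rewrite -ler_sqr ?nnegrE ?cn_ge0// cn_sqr/= oppr0 addr0.
rewrite real_normK ?num_real//.
have -> : (cos x - 1) ^+ 2 + sin x ^+ 2 = 2 * (1 - cos x).
  by have := cos2Dsin2 x; lra.
by have /andP[_ h] := one_sub_cos_bound x; lra.
Qed.

Lemma cn_expi_sub2 x : `|x| <= 1 -> cn (expi x - 1 - 'i * x%:C) <= `|x| ^+ 2.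
Proof.
move=> x1; rewrite (le_trans (cn_le_ReIm _))//=.
rewrite ?(mul0r, mul1r, mulr0, subr0, oppr0, addr0, add0r).
have /andP[h1 h2] := one_sub_cos_bound x.
have h3 := sin_sub_bound x.
rewrite distrC (ger0_norm h1).
rewrite -(real_normK (num_real x)) in h2.
have h0 := normr_ge0 x.
have h4 : `|x| ^+ 3 <= `|x| ^+ 2 by rewrite exprS ler_piMl// sqr_ge0.
by lra.
Qed.

Lemma cn_expi_sub3 x : `|x| <= 1 ->
  cn (expi x - 1 - 'i * x%:C + (x ^+ 2 / 2)%:C) <= `|x| ^+ 3.
Proof.
move=> x1; rewrite (le_trans (cn_le_ReIm _))//=.
rewrite ?(mul0r, mul1r, mulr0, subr0, oppr0, addr0, add0r).
have h1 := cos_sub_bound x; have h3 := sin_sub_bound x.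
have h0 := normr_ge0 x.
have h4 : `|x| ^+ 4 <= `|x| ^+ 3 by rewrite exprS ler_piMl// exprn_ge0.
have h5 : 0 <= `|x| ^+ 3 by rewrite exprn_ge0.
by lra.
Qed.

(** From exp(-x) >= 1 - x one gets (exp x - 1 - x) (1 - x) <= x^2, and 1 - x >= 1/2. *)
Lemma expR_sub2 x : `|x| <= 1 / 2 -> `|expR x - 1 - x| <= 2 * x ^+ 2.
Proof.
rewrite ler_norml => /andP[x1 x2].
have h1 := expR_ge1Dx x; have h2 := expR_ge1Dx (- x).
have h0 := expR_gt0 x.
rewrite expRN in h2.
have h3 : expR x * (1 - x) <= 1.
  rewrite mulrC -ler_pdivlMr// div1r //.
rewrite ger0_norm; last lra.
suff : (expR x - 1 - x) * (1 - x) <= 2 * x ^+ 2 * (1 - x).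
  by rewrite ler_pM2r//; lra.
have := sqr_ge0 x; nra.
Qed.

(** The product is compared with (1 + delta)^n; then (1 + delta)^n - 1 <= exp y - 1 <= y exp y for y
    = n delta, the last step being 1 - y <= exp(-y). *)
Lemma prod_perturbation (u : nat -> R[i]) (n : nat) (delta : R) : 0 <= delta ->
  (forall k, (k < n)%N -> cn (u k - 1) <= delta) ->
  cn (\prod_(k < n) u k - 1) <= n%:R * delta * expR (n%:R * delta).
Proof.
move=> d0 ud.
suff h : cn (\prod_(k < n) u k - 1) <= (1 + delta) ^+ n - 1.
  apply: (le_trans h); rewrite (@le_trans _ _ (expR (n%:R * delta) - 1))//.
    rewrite lerD2r mulrC expRM_natr lerXn2r ?nnegrE ?expR_ge0//.
      by rewrite addr_ge0.
    exact: expR_ge1Dx.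
  have := expR_ge1Dx (- (n%:R * delta)); rewrite expRN.
  have := expR_gt0 (n%:R * delta); set E := expR _ => E0 h2.
  suff : (1 - n%:R * delta) * E <= 1 by lra.
  by rewrite -ler_pdivlMr// div1r.
elim: n ud => [|n IH] ud; first by rewrite big_ord0 subrr cn0 expr0 subrr.
rewrite big_ord_recr/=.
have -> : \prod_(i < n) u i * u n - 1 =
    (\prod_(i < n) u i - 1) * (u n - 1) + (\prod_(i < n) u i - 1) + (u n - 1).
  by ring.
have {}IH := IH (fun k kn => ud k (ltnW kn)).
have un := ud n (ltnSn n).
rewrite (le_trans (cnD _ _))// (le_trans (lerD (cnD _ _) (lexx _)))// cnM.
have := cn_ge0 (\prod_(i < n) u i - 1); have := cn_ge0 (u n - 1).
rewrite exprSr; set a := cn _ in IH *; set b := cn _ in un *.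
set p := _ ^+ n in IH *; nra.
Qed.

End elementary_bounds.

(** * Oscillation and contraction *)

Section backward_sequence.
Variable X : Type.

(** Recursion downwards in time: [x0] is the terminal value at time [n], and [step k] passes from
    time [k.+1] to time [k]. *)
Definition backseq (n : nat) (step : nat -> X -> X) (x0 : X) (k : nat) : X :=
  foldr step x0 (iota k (n - k)).

Lemma backseq_last n step x0 : backseq n step x0 n = x0.
Proof. by rewrite /backseq subnn. Qed.

Lemma backseqE n step x0 k : (k < n)%N ->
  backseq n step x0 k = step k (backseq n step x0 k.+1).
Proof. by move=> kn; rewrite /backseq subnS -(prednK (_ : 0 < n - k)%N) ?subn_gt0. Qed.

End backward_sequence.

Lemma downward_ind n (B : nat -> Prop) :
  B n -> (forall k, (k < n)%N -> B k.+1 -> B k) ->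
  forall k, (k <= n)%N -> B k.
Proof.
move=> Bn BS k kn; rewrite -(subKn kn).
elim: (n - k)%N (leq_subr k n) => [|j IH] jn; first by rewrite subn0.
apply: BS; first by rewrite ltn_subrL (leq_trans _ jn).
by rewrite subnSK//; apply: IH; exact: ltnW.
Qed.

Section oscillation.
Context d (T : measurableType d) (R : realType).
Implicit Types (f g : T -> R[i]).

Definition osc_le f (c : R) := forall x y, cn (f x - f y) <= c.

Lemma osc_le_norm f c : (forall x, cn (f x) <= c) -> osc_le f (2 * c).
Proof.
move=> fc x y; rewrite (le_trans (cnB _ _))//.
by have := fc x; have := fc y; lra.
Qed.

Lemma osc_leD f g c c' : osc_le f c -> osc_le g c' ->
  osc_le (fun x => f x + g x) (c + c').
Proof.
move=> fc gc x y; have -> : f x + g x - (f y + g y) = f x - f y + (g x - g y).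
  by ring.
by rewrite (le_trans (cnD _ _))// lerD.
Qed.

Lemma cn_sub_cint (mu : {measure set T -> \bar R}) f c w :
  mu setT = 1%E -> cbm f -> (forall x, cn (f x - w) <= c) ->
  cn (cint mu f - w) <= c.
Proof.
move=> mu1 bf fw; rewrite -[X in _ - X](cint_cst mu1) -cintB//; last exact: cbm_cst.
by apply: cn_cint => //; apply: cbmB => //; exact: cbm_cst.
Qed.

Lemma osc_cint (mu : {measure set T -> \bar R}) f c x :
  mu setT = 1%E -> cbm f -> osc_le f c -> cn (f x - cint mu f) <= c.
Proof.
by move=> mu1 bf fc; rewrite cnC; apply: cn_sub_cint => // y; exact: fc.
Qed.

(** Both values compared are averages of [f], so their distance is at most the largest distance
    between values of [f]. *)
Lemma osc_cop (P : R.-pker T ~> T) f c : cbm f -> osc_le f c ->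
  osc_le (cop P f) c.
Proof.
move=> bf fc x y; rewrite cnC.
apply: cn_sub_cint => //; first exact: prob_kernel.
move=> z; apply: osc_cint => //; exact: prob_kernel.
Qed.

End oscillation.

Section contraction.
Context d (T : measurableType d) (R : realType).
Variables (P : nat -> R.-pker T ~> T).
Implicit Types (f g : T -> R[i]).

(* [evol k i] is the transition operator from time [k] to time [k + i]. *)
Fixpoint evol (k i : nat) f : T -> R[i] :=
  if i is i'.+1 then cop (P k.+1) (evol k.+1 i' f) else f.

Lemma cbm_evol k i f : cbm f -> cbm (evol k i f).
Proof. by elim: i k => //= i IH k bf; apply: cbm_cop; exact: IH. Qed.

Lemma evol_cst k i c x : evol k i (fun=> c) x = c.
Proof.
elim: i k x => //= i IH k x.
by rewrite (eq_cop (P k.+1) (IH k.+1)) cop_cst.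
Qed.

(** Only windows inside [0, n] are concerned: later times would correspond to parameters k / n > 1,
    for which nothing is assumed of the kernels. *)
Definition contracts (n m : nat) (q : R) := forall k f c, (k + m <= n)%N ->
  cbm f -> osc_le f c -> osc_le (evol k m f) (q * c).

(** Telescoping: each one-step error is transported by Markov operators, which do not increase its
    oscillation. *)
Lemma osc_evol_rec n (f : nat -> T -> R[i]) (e : R) :
  (forall k, (k <= n)%N -> cbm (f k)) ->
  (forall k, (k < n)%N ->
    osc_le (fun x => f k x - cop (P k.+1) (f k.+1) x) e) ->
  forall i k, (k + i <= n)%N ->
    osc_le (fun x => f k x - evol k i (f (k + i)%N) x) (i%:R * e).
Proof.
move=> bf fe; elim=> [|i IH] k kin.
  by move=> x y /=; rewrite addn0 !subrr cn0 mul0r.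
have kn : (k < n)%N by rewrite (leq_trans _ kin)// addnS ltnS leq_addr.
have bk1 : cbm (f k.+1) by exact: bf.
have be : cbm (evol k.+1 i (f (k.+1 + i)%N)).
  by apply/cbm_evol/bf; rewrite addSnnS.
rewrite -natr1 mulrDl mul1r addrC addnS -addSn /=.
rewrite (_ : (fun x => _) = (fun x => f k x - cop (P k.+1) (f k.+1) x +
   cop (P k.+1) (fun y => f k.+1 y - evol k.+1 i (f (k.+1 + i)%N) y) x)); last first.
  by apply/funext => x; rewrite copB//; ring.
apply: osc_leD; first exact: fe.
apply: osc_cop; first exact: cbmB.
by apply: IH; rewrite addSnnS.
Qed.

(** The bound B = e m / (1 - q) is the fixed point of B = m e + q B: over a window of [m] steps the
    errors add up to m e, while the old oscillation is multiplied by [q]. Hence it does not grow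
    with [n]. *)
Lemma osc_rec n m q (f : nat -> T -> R[i]) (e : R) :
  0 <= q < 1 -> contracts n m q -> (0 < m)%N ->
  (forall k, (k <= n)%N -> cbm (f k)) ->
  (forall x y, f n x = f n y) -> 0 <= e ->
  (forall k, (k < n)%N ->
    osc_le (fun x => f k x - cop (P k.+1) (f k.+1) x) e) ->
  forall k, (k <= n)%N -> osc_le (f k) (m%:R / (1 - q) * e).
Proof.
move=> /andP[q0 q1] Pmq m_gt0 bf fn e0 fe k.
have [j] := ubnP (n - k); elim: j k => // j IH k; rewrite ltnS => nkj kn.
have rec := osc_evol_rec bf fe.
have q1' : 0 < 1 - q by lra.
(* Fewer than [m] steps before time [n] there is no contraction, but the terminal function is
   constant and stays so under [evol]. *)
have [kmn|nkm] := leqP (k + m) n; last first.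
  have kin : (k + (n - k) = n)%N by rewrite subnKC.
  move=> x y; have := rec (n - k)%N k; rewrite kin leqnn => /(_ isT x y).
  have -> : evol k (n - k) (f n) x = evol k (n - k) (f n) y.
    have fnE : f n = (fun=> f n point) by apply/funext => z; exact: fn.
    by rewrite fnE !evol_cst.
  rewrite opprB addrA subrK => /le_trans; apply.
  rewrite mulrAC ler_pdivlMr// (@le_trans _ _ ((n - k)%:R * e))//.
    by rewrite ler_piMr ?mulr_ge0//; lra.
  by rewrite ler_wpM2r// ler_nat leq_subLR ltnW.
have oscm : osc_le (f (k + m)%N) (m%:R / (1 - q) * e).
  apply: IH => //; apply: leq_trans nkj.
  move: m_gt0 kmn; clear; lia.
have -> : m%:R / (1 - q) * e = m%:R * e + q * (m%:R / (1 - q) * e).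
  by field; rewrite gt_eqF.
have -> : f k = (fun x => f k x - evol k m (f (k + m)%N) x + evol k m (f (k + m)%N) x).
  by apply/funext => x; rewrite subrK.
apply: osc_leD; first exact: rec.
by apply: Pmq => //; exact: bf.
Qed.

End contraction.

(** * Expansion of the characteristic function *)

Section charfun.
Context d (T : measurableType d) (R : realType).
Local Open Scope complex_scope.
Variables (n m : nat) (q kappa : R).
Variables (P : nat -> R.-pker T ~> T) (nu : nat -> probability T R).
Variable (xi : nat -> T -> R).
Hypothesis q01 : 0 <= q < 1.
Hypothesis m_gt0 : (0 < m)%N.
Hypothesis contr : contracts P n m q.
Hypothesis bxi : forall k, (k < n)%N -> bmeas (xi k.+1).
Hypothesis xi_le : forall k x, (k < n)%N -> `|xi k.+1 x| <= kappa.
Hypothesis nuP : forall k f, (k < n)%N -> bmeas f ->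
  \int[nu k.+1]_x f x = \int[nu k]_x rop (P k.+1) f x.
Hypothesis nu_xi : forall k, (k < n)%N -> \int[nu k.+1]_x xi k.+1 x = 0.

Lemma cint_nuP k f : (k < n)%N -> cbm f ->
  cint (nu k.+1) f = cint (nu k) (cop (P k.+1) f).
Proof. by move=> kn [f1 f2]; rewrite /cint !nuP. Qed.

(* [corr k x] is the expectation of xi_{k+1} + ... + xi_n given X_k = x. *)
Definition corr : nat -> T -> R :=
  backseq n (fun k f => rop (P k.+1) (fun y => xi k.+1 y + f y)) (fun=> 0).

Lemma corrE k : (k < n)%N ->
  corr k = rop (P k.+1) (fun y => xi k.+1 y + corr k.+1 y).
Proof. by move=> kn; rewrite /corr backseqE. Qed.

Lemma bmeas_corr k : (k <= n)%N -> bmeas (corr k).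
Proof.
move: k; apply: downward_ind => [|k kn IH].
  by rewrite /corr backseq_last; exact: bmeas_cst.
by rewrite corrE//; apply: bmeas_rop; apply: bmeasD => //; exact: bxi.
Qed.

Lemma nu_corr k : (k <= n)%N -> \int[nu k]_x corr k x = 0.
Proof.
move: k; apply: downward_ind => [|k kn IH].
  by rewrite /corr backseq_last Rintegral1_cst//; exact: probability_setT.
rewrite corrE// -nuP//; last by apply: bmeasD; [exact: bxi|exact: bmeas_corr].
rewrite bmeas_RintegralD ?IH ?nu_xi ?addr0//.
- exact: probability_setT.
- exact: bxi.
- exact: bmeas_corr.
Qed.

Definition tau k : R :=
  \int[nu k]_x (xi k x ^+ 2) + 2 * \int[nu k]_x (xi k x * corr k x).

Variable t : R.
Let x := kappa * `|t|.
Hypothesis x_small : 64 * m%:R * x <= (1 - q) ^+ 2.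

(** A mixing time: it bounds the sum of the decay factors [q ^+ (i %/ m)]. The hypothesis [x_small]
    reads 64 G x <= 1 - q. *)
Let G := m%:R / (1 - q).

Let q1 : 0 < 1 - q. Proof. by move: q01 => /andP[]; lra. Qed.
Let m1 : 1 <= m%:R :> R. Proof. by rewrite ler1n. Qed.
Let mE : m%:R = G * (1 - q). Proof. by rewrite /G; field; rewrite gt_eqF. Qed.
Let G1 : 1 <= G.
Proof. by rewrite ler_pdivlMr// mul1r (le_trans _ m1)//; move: q01 => /andP[]; lra. Qed.

Hypothesis n_gt0 : (0 < n)%N.
Let kappa0 : 0 <= kappa.
Proof. by rewrite (le_trans _ (xi_le point n_gt0)). Qed.
Let x0 : 0 <= x. Proof. by rewrite mulr_ge0. Qed.
Let Gx : 64 * (G * x) <= 1 - q.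
Proof.
rewrite -(ler_pM2r q1) -expr2 (le_trans _ x_small)//.
by rewrite mE le_eqVlt; apply/orP; left; apply/eqP; ring.
Qed.
Let Gx1 : 64 * (G * x) <= 1.
Proof. by rewrite (le_trans Gx)//; move: q01 => /andP[]; lra. Qed.
Let x_Gx : x <= G * x. Proof. by rewrite ler_peMl. Qed.

Let txi k y : (k < n)%N -> `|t * xi k.+1 y| <= x.
Proof. by move=> kn; rewrite normrM mulrC /x ler_wpM2r// xi_le. Qed.

Let btxi k : (k < n)%N -> bmeas (fun y => t * xi k.+1 y).
Proof. by move=> kn; apply/bmeasZ/bxi. Qed.

Let bexpi k : (k < n)%N -> cbm (fun y => expi (t * xi k.+1 y)).
Proof. by move=> kn; apply: cbm_expi; exact: (btxi kn).1. Qed.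

(* [phi k x] is the expectation of exp(i t (xi_{k+1} + ... + xi_n))
   given X_k = x. *)
Definition phi : nat -> T -> R[i] :=
  backseq n (fun k f => cop (P k.+1) (fun y => expi (t * xi k.+1 y) * f y))
    (fun=> 1).

Lemma phiE k : (k < n)%N ->
  phi k = cop (P k.+1) (fun y => expi (t * xi k.+1 y) * phi k.+1 y).
Proof. by move=> kn; rewrite /phi backseqE. Qed.

Lemma phi_last y : phi n y = 1.
Proof. by rewrite /phi backseq_last. Qed.

Lemma cbm_phi k : (k <= n)%N -> cbm (phi k).
Proof.
move: k; apply: downward_ind => [|k kn IH].
  by rewrite /phi backseq_last; exact: cbm_cst.
by rewrite phiE//; apply/cbm_cop/cbmM => //; exact: bexpi.
Qed.

(** Here [w] is a reference value. As e <= 1, [phi k.+1] has modulus at most 2 |w|, and replacing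
    the exponential by 1 costs a factor [x]. *)
Lemma phi_step k w e : (k < n)%N -> (forall y, cn (phi k.+1 y - w) <= e * cn w) ->
  e <= 1 -> forall y, cn (phi k y - cop (P k.+1) (phi k.+1) y) <= 2 * x * cn w.
Proof.
move=> kn hw e1 y; rewrite phiE// -copB//; last 2 first.
- by apply: cbmM; [exact: bexpi|exact: cbm_phi].
- exact: cbm_phi.
apply: cn_cop.
  by apply: cbmB; [apply: cbmM; [exact: bexpi|exact: cbm_phi]|exact: cbm_phi].
move=> z.
have -> : expi (t * xi k.+1 z) * phi k.+1 z - phi k.+1 z =
  (expi (t * xi k.+1 z) - 1) * phi k.+1 z by ring.
rewrite cnM (mulrC 2) -mulrA ler_pM ?cn_ge0//.
  by rewrite (le_trans (cn_expi_sub1 _))// txi.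
have -> : phi k.+1 z = (phi k.+1 z - w) + w by ring.
rewrite (le_trans (cnD _ _))//.
have := hw z; have := cn_ge0 w => w0 h.
have : e * cn w <= cn w by rewrite ler_piMl.
by lra.
Qed.

(** Averaging does not increase the distance to [w], and each of the [i] steps adds 2 x |w|. The
    last hypothesis keeps the relative distance below 1, as [phi_step] demands. *)
Lemma phi_close i k w e : (k + i <= n)%N ->
  (forall y, cn (phi (k + i)%N y - w) <= e * cn w) -> 0 <= e ->
  e + 2 * i%:R * x <= 1 ->
  (forall y, cn (phi k y - w) <= (e + 2 * i%:R * x) * cn w).
Proof.
move=> + + e0; elim: i k => [|i IH] k kin hw hi y.
  by rewrite mulr0 mul0r addr0; have := hw y; rewrite addn0.
have kn : (k < n)%N by rewrite (leq_trans _ kin)// addnS ltnS leq_addr.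
have i0 : 0 <= i%:R * x by rewrite mulr_ge0.
have x_ge0 := x0.
rewrite -natr1 in hi *.
have hk1 z : cn (phi k.+1 z - w) <= (e + 2 * i%:R * x) * cn w.
  apply: IH; [by rewrite addSnnS|by move=> u; rewrite addSnnS|lra].
have -> : phi k y - w = (phi k y - cop (P k.+1) (phi k.+1) y) +
   (cop (P k.+1) (phi k.+1) y - w) by ring.
rewrite (le_trans (cnD _ _))//.
have h1 : cn (phi k y - cop (P k.+1) (phi k.+1) y) <= 2 * x * cn w.
  by apply: phi_step hk1 _ _ => //; lra.
have h2 : cn (cop (P k.+1) (phi k.+1) y - w) <= (e + 2 * i%:R * x) * cn w.
  by apply: cn_sub_cint => //; [exact: prob_kernel|exact: cbm_phi].
by lra.
Qed.

Lemma phi_evol i k w e : (k + i <= n)%N ->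
  (forall y, cn (phi (k + i)%N y - w) <= e * cn w) -> 0 <= e ->
  e + 2 * i%:R * x <= 1 ->
  osc_le (fun y => phi k y - evol P k i (phi (k + i)%N) y) (4 * i%:R * x * cn w).
Proof.
move=> kin hw e0 hi.
suff : forall y, cn (phi k y - evol P k i (phi (k + i)%N) y) <= 2 * i%:R * x * cn w.
  by move=> /osc_le_norm h u v; apply: (le_trans (h u v)); lra.
elim: i k kin hw hi => [|i IH] k kin hw hi y.
  by rewrite /= addn0 subrr cn0 mulr0 !mul0r.
have kn : (k < n)%N by rewrite (leq_trans _ kin)// addnS ltnS leq_addr.
have i0 : 0 <= i%:R * x by rewrite mulr_ge0.
have x_ge0 := x0.
rewrite -natr1 in hi *.
have hi' : e + 2 * i%:R * x <= 1 by lra.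
have hw' z : cn (phi (k.+1 + i)%N z - w) <= e * cn w by rewrite addSnnS.
have kin' : (k.+1 + i <= n)%N by rewrite addSnnS.
have bk : cbm (phi k.+1) by exact: cbm_phi.
have be : cbm (evol P k.+1 i (phi (k.+1 + i)%N)) by apply/cbm_evol/cbm_phi.
have -> : phi k y - evol P k i.+1 (phi (k + i.+1)) y =
    (phi k y - cop (P k.+1) (phi k.+1) y) +
    cop (P k.+1) (fun z => phi k.+1 z - evol P k.+1 i (phi (k.+1 + i)%N) z) y.
  by rewrite copB//= addSnnS; ring.
rewrite (le_trans (cnD _ _))//.
have h1 : cn (phi k y - cop (P k.+1) (phi k.+1) y) <= 2 * x * cn w.
  by apply: (phi_step kn (phi_close kin' hw' e0 hi')).
have h2 := cn_cop (P k.+1) y (cbmB bk be) (IH _ kin' hw' hi').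
by lra.
Qed.

Let eta := 8 * (G * x).
Let eta0 : 0 <= eta. Proof. by rewrite mulr_ge0// mulr_ge0// (le_trans ler01 G1). Qed.
Let eta_le : 8 * eta <= 1 - q. Proof. by have := Gx; rewrite /eta; lra. Qed.
Let mx : m%:R * x = eta * (1 - q) / 8. Proof. by rewrite mE /eta; field. Qed.
Let mx_le : 64 * (m%:R * x) <= 1 - q.
Proof.
rewrite mulrA (le_trans x_small)// expr2; move: q01 => /andP[? ?].
by rewrite ler_piMl//; lra.
Qed.

(* Over m steps the contraction turns a relative oscillation eta into q * eta,
   up to errors of order m * x, so the bound eta = 8 G x reproduces itself. *)
Lemma phi_ratio k : (k <= n)%N -> forall y z,
  0 < cn (phi k z) /\ cn (phi k y - phi k z) <= eta * cn (phi k z).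
Proof.
have [j] := ubnP (n - k); elim: j k => // j IH k; rewrite ltnS => nkj kn y z.
move: (q01) => /andP[q0' q1'].
have x_ge0 := x0; have e_ge0 := eta0; have e_le := eta_le; have mx_le' := mx_le.
have [kmn|nkm] := leqP (k + m) n.
  have {}IH := IH (k + m)%N _ kmn.
  have {}IH u v : 0 < cn (phi (k + m) v) /\
      cn (phi (k + m) u - phi (k + m) v) <= eta * cn (phi (k + m) v).
    by apply: IH; move: nkj kmn m_gt0; clear; lia.
  (* One reference value for the whole window, so that moduli at times [k] and [k + m] can be
     compared. *)
  set w := phi (k + m)%N point in IH.
  have [w0 _] := IH point point; rewrite -/w in w0.
  have hw u : cn (phi (k + m)%N u - w) <= eta * cn w by exact: (IH u point).2.
  have h1 : eta + 2 * m%:R * x <= 1 by lra.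
  have close := phi_close kmn hw eta0 h1.
  have hosc : osc_le (phi (k + m)%N) (eta * (1 + eta) * cn w).
    move=> u v; rewrite (le_trans (IH u v).2)// -mulrA ler_wpM2l//.
    have -> : phi (k + m)%N v = phi (k + m)%N v - w + w by ring.
    by rewrite (le_trans (cnD _ _))//; have := hw v; lra.
  have hev := contr kmn (cbm_phi kmn) hosc.
  have := osc_leD (phi_evol kmn hw eta0 h1) hev => /(_ y z).
  rewrite !subrK => h2.
  have h3 : (1 - eta - 2 * m%:R * x) * cn w <= cn (phi k z).
    have := close z; rewrite cnC => h; have := cnBl w (phi k z); lra.
  split; first by rewrite (lt_le_trans _ h3)// mulr_gt0//; lra.
  rewrite (le_trans h2)// (@le_trans _ _ (eta * ((1 - eta - 2 * m%:R * x) * cn w)))//.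
    (* By [mx], 4 m x = eta (1 - q) / 2: half of the gain eta (1 - q) of the contraction pays for
       the perturbation. The other half absorbs the quadratic terms because eta <= (1 - q) / 8 and
       64 m x <= 1 - q. *)
    have key : 4 * (m%:R * x) + q * (eta * (1 + eta)) <=
        eta * (1 - eta - 2 * (m%:R * x)).
      suff : 0 <= eta * ((1 - q) / 2 - eta * (1 + q) - 2 * (m%:R * x)).
        by have := mx; lra.
      rewrite mulr_ge0//; have : eta * (1 + q) <= eta * 2 by rewrite ler_wpM2l//; lra.
      by lra.
    by have := ler_wpM2r (ltW w0) key; lra.
  by rewrite ler_wpM2l.
(* Within [m] steps of the end, [phi n = 1] serves as reference value, with initial error 0. *)
have kin : (k + (n - k) = n)%N by rewrite subnKC.
have nkm' : (n - k)%:R <= m%:R :> R by rewrite ler_nat leq_subLR ltnW.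
have nkx : (n - k)%:R * x <= m%:R * x by rewrite ler_wpM2r.
have h1 : 0 + 2 * (n - k)%:R * x <= 1 by lra.
have hw u : cn (phi (k + (n - k))%N u - 1) <= 0 * cn (1 : R[i]).
  by rewrite kin phi_last subrr cn0 mul0r.
have kin' : (k + (n - k) <= n)%N by rewrite kin.
have close := phi_close kin' hw (lexx _) h1.
rewrite cn1 mulr1 add0r in close.
have h3 : 1 - 2 * (m%:R * x) <= cn (phi k z).
  by have := close z; rewrite cnC => h; have := cnBl 1 (phi k z); rewrite cn1; lra.
split; first by rewrite (lt_le_trans _ h3)//; lra.
have -> : phi k y - phi k z = phi k y - 1 - (phi k z - 1) by ring.
rewrite (le_trans (cnB _ _))//.
have c1 := close y; have c2 := close z.
rewrite (@le_trans _ _ (4 * (m%:R * x)))//; first by lra.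
rewrite (@le_trans _ _ (eta * (1 - 2 * (m%:R * x))))//; last by rewrite ler_wpM2l.
have : eta * (1 - q) <= eta by rewrite ler_piMr//; lra.
have : eta * (2 * (m%:R * x)) <= eta * (1/32) by rewrite ler_wpM2l//; lra.
by rewrite mx; lra.
Qed.

(* As c_n = 1, the characteristic function c_0 is the product of the ratios z_k;
   psi_k has mean one, which makes z_k the mean of a single factor. *)
Let c k := cint (nu k) (phi k).
Let psi k y := phi k y / c k.
Let z k := c k / c k.+1.

(** The mean inherits the relative closeness; the factor 2 comes from passing from |phi| to |c| as
    the reference. *)
Let cphi k y : (k <= n)%N -> 0 < cn (c k) /\ cn (phi k y - c k) <= 2 * eta * cn (c k).
Proof.
move=> kn; have e_ge0 := eta0; have e_le := eta_le; move: (q01) => /andP[q0' _].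
have [p0 _] := phi_ratio kn y y.
have h : cn (phi k y - c k) <= eta * cn (phi k y).
  rewrite cnC; apply: cn_sub_cint => //; first exact: probability_setT.
    exact: cbm_phi.
  by move=> u; have [] := phi_ratio kn u y.
have h1 := cnBl (phi k y) (c k).
have h2 : eta * cn (phi k y) <= 1/8 * cn (phi k y) by rewrite ler_wpM2r ?cn_ge0//; lra.
have c0 : 0 < cn (c k) by lra.
have h3 : cn (phi k y) <= 2 * cn (c k) by lra.
by split=> //; have := ler_wpM2l e_ge0 h3; lra.
Qed.

Let c_neq0 k : (k <= n)%N -> c k != 0.
Proof. by move=> kn; rewrite -cn_eq0 gt_eqF//; have [] := cphi point kn. Qed.

Let cbm_psi k : (k <= n)%N -> cbm (psi k).
Proof.
by move=> kn; apply: cbmM; [exact: cbm_phi|exact: cbm_cst].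
Qed.

Let psi_sub1 k y : (k <= n)%N -> cn (psi k y - 1) <= 16 * (G * x).
Proof.
move=> kn; have [c0 h] := cphi y kn.
have -> : psi k y - 1 = (phi k y - c k) / c k.
  by rewrite /psi mulrBl divff// c_neq0.
by rewrite cnM cnV ler_pdivrMr// (le_trans h)// /eta; lra.
Qed.

Let nu_psi k : (k <= n)%N -> cint (nu k) (psi k) = 1.
Proof.
move=> kn; rewrite /psi.
under eq_cint do rewrite mulrC.
rewrite cintZ//; [|exact: probability_setT|exact: cbm_phi].
by rewrite -/(c k) mulVf// c_neq0.
Qed.

Let bepsi k : (k < n)%N -> cbm (fun y => expi (t * xi k.+1 y) * psi k.+1 y).
Proof. by move=> kn; apply: cbmM; [exact: bexpi|exact: cbm_psi]. Qed.

Let psi_z k y : (k < n)%N ->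
  psi k y * z k = cop (P k.+1) (fun u => expi (t * xi k.+1 u) * psi k.+1 u) y.
Proof.
move=> kn; rewrite /psi /z.
have -> : phi k y / c k * (c k / c k.+1) = (c k.+1)^-1 * phi k y.
  by field; rewrite !c_neq0// ltnW.
rewrite {1}phiE// -copZ//; last by apply: cbmM; [exact: bexpi|exact: cbm_phi].
by apply: eq_cop => u; ring.
Qed.

Let zE k : (k < n)%N ->
  z k = cint (nu k.+1) (fun u => expi (t * xi k.+1 u) * psi k.+1 u).
Proof.
move=> kn; rewrite cint_nuP//; last exact: bepsi.
rewrite -[LHS]mul1r -(nu_psi (ltnW kn)) mulrC -cintZ//; last 2 first.
- exact: probability_setT.
- exact/cbm_psi/ltnW.
by apply: eq_cint => y; rewrite mulrC psi_z.
Qed.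

(** What is left of exp(i t xi) psi after [itxi + psi]: a second order Taylor error and a product of
    two first order terms, hence of size G x^2. *)
Let rem k y : R[i] := (expi (t * xi k.+1 y) - 1 - 'i * (t * xi k.+1 y)%:C) * psi k.+1 y
  + 'i * (t * xi k.+1 y)%:C * (psi k.+1 y - 1).

Let itxi k y := 'i * (t * xi k.+1 y)%:C.

Let bitxi k : (k < n)%N -> cbm (itxi k).
Proof. by move=> kn; apply/cbmZ/cbm_real/btxi. Qed.

Let bsub1 (f : T -> R[i]) : cbm f -> cbm (fun y : T => f y - 1).
Proof. by move=> bf; apply: cbmB => //; exact: cbm_cst. Qed.

Let brem k : (k < n)%N -> cbm (rem k).
Proof.
move=> kn; have bp := cbm_psi kn.
apply: cbmD; apply: cbmM => //; last 2 first.
- exact: bitxi.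
- exact: bsub1.
by apply: cbmB; [apply/bsub1/bexpi|exact: bitxi].
Qed.

Let x1 : x <= 1 / 64.
Proof. by have := Gx1; have := x_Gx; lra. Qed.

Let cn_itxi k y : (k < n)%N -> cn (itxi k y) <= x.
Proof. by move=> kn; rewrite cnM cn_i mul1r cn_real txi. Qed.

Let e2 k y : (k < n)%N -> cn (expi (t * xi k.+1 y) - 1 - itxi k y) <= x ^+ 2.
Proof.
move=> kn; have h := txi y kn; have := x1 => ?.
rewrite (le_trans (cn_expi_sub2 _))//; first by lra.
by rewrite lerXn2r ?nnegrE.
Qed.

Let cn_rem k y : (k < n)%N -> cn (rem k y) <= 18 * (G * x ^+ 2).
Proof.
move=> kn; have p1 := psi_sub1 y kn; have := Gx1 => gx.
have p2 : cn (psi k.+1 y) <= 5 / 4.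
  by have := cnBl (psi k.+1 y) 1; rewrite cn1; lra.
have h1 := ler_pM (cn_ge0 _) (cn_ge0 _) (e2 y kn) p2.
have h2 := ler_pM (cn_ge0 _) (cn_ge0 _) (cn_itxi y kn) p1.
rewrite -!cnM in h1 h2.
rewrite (le_trans (cnD _ _))// (le_trans (lerD h1 h2))//.
have h3 : x ^+ 2 <= G * x ^+ 2 by rewrite ler_peMl// sqr_ge0.
by have := sqr_ge0 x; lra.
Qed.

Let epsiE k y : expi (t * xi k.+1 y) * psi k.+1 y = rem k y + (itxi k y + psi k.+1 y).
Proof. by rewrite /rem /itxi; ring. Qed.

(** There is no first order term: [xi] is centred and [psi] has mean one, so only the mean of [rem]
    remains. *)
Let cn_z k : (k < n)%N -> cn (z k - 1) <= 18 * (G * x ^+ 2).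
Proof.
move=> kn; rewrite zE//; under eq_cint do rewrite epsiE.
have pT := @probability_setT _ _ _ (nu k.+1).
have bp := cbm_psi kn; have bi := bitxi kn; have br := brem kn.
rewrite cintD//; last exact: cbmD.
rewrite (cintD pT bi bp) nu_psi//.
have -> : cint (nu k.+1) (itxi k) = 0.
  rewrite /itxi cintZ//; last exact/cbm_real/btxi.
  rewrite cint_real// bmeas_RintegralZ//; last exact: bxi.
  by rewrite nu_xi// mulr0 mulr0.
rewrite add0r addrK; apply: cn_cint => // y; exact: cn_rem.
Qed.

(** [psi] is expanded to first order in t, with the conditional mean [corr] as coefficient. *)
Let res k y := psi k y - 1 - 'i * t%:C * (corr k y)%:C.

Let bres k : (k <= n)%N -> cbm (res k).
Proof.
move=> kn; apply: cbmB; first exact/bsub1/cbm_psi.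
exact/cbmZ/cbm_real/bmeas_corr.
Qed.

(** The recursions of [psi] and [i t corr] agree up to [rem] and [z - 1], both quadratic in t. The
    one-step error is at most (18 * 5/4 + 18) G x^2 <= 41 G x^2, doubled when turned into an
    oscillation. *)
Let osc_res k : (k <= n)%N -> osc_le (res k) (82 * (G * x) ^+ 2).
Proof.
have -> : 82 * (G * x) ^+ 2 = m%:R / (1 - q) * (82 * (G * x ^+ 2)).
  by rewrite -/G; ring.
move: k; apply: (osc_rec q01 contr m_gt0 bres).
- move=> y u; rewrite /res /psi !phi_last /corr backseq_last//.
- by rewrite mulr_ge0// mulr_ge0 ?sqr_ge0// (le_trans ler01 G1).
move=> k kn.
suff h y : cn (res k y - cop (P k.+1) (res k.+1) y) <= 41 * (G * x ^+ 2).
  by move=> u v; apply: (le_trans (osc_le_norm h u v)); lra.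
have bp := cbm_psi kn; have bi := bitxi kn; have br := brem kn.
have bc : bmeas (corr k.+1) by exact: bmeas_corr.
have -> : res k y - cop (P k.+1) (res k.+1) y =
    psi k y * (1 - z k) + cop (P k.+1) (rem k) y.
  rewrite mulrBr mulr1 psi_z//.
  rewrite (eq_cop _ (epsiE k)) copD//; last exact: cbmD.
  rewrite (copD _ _ bi bp).
  rewrite (copB _ _ (bsub1 bp) (cbmZ ('i * t%:C) (cbm_real bc))).
  rewrite (copB _ _ bp (cbm_cst _ _)).
  rewrite cop_cst (copZ _ _ _ (cbm_real bc)) /res corrE//.
  rewrite /itxi copZ//; last exact/cbm_real/btxi.
  rewrite !cop_real /rop.
  rewrite bmeas_RintegralD//; [|exact: prob_kernel|exact: bxi].
  rewrite bmeas_RintegralZ//; [|exact: prob_kernel|exact: bxi].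
  by rewrite !(rmorphM, rmorphD)/=; ring.
rewrite (le_trans (cnD _ _))// cnM.
have h1 : cn (psi k y) <= 5 / 4.
  have := cnBl (psi k y) 1; have := psi_sub1 y (ltnW kn); have := Gx1.
  by rewrite cn1; lra.
have h2 := cn_z kn; rewrite cnC in h2.
have h3 := ler_pM (cn_ge0 _) (cn_ge0 _) h1 h2.
have h4 := cn_cop (P k.+1) y br (fun u => cn_rem u kn).
have h5 : 0 <= G * x ^+ 2 by rewrite mulr_ge0 ?sqr_ge0// (le_trans ler01 G1).
by lra.
Qed.

(** [psi] has mean 1 and [corr] mean 0, so [res] has mean 0 and its oscillation bounds its size. *)
Let cn_res k y : (k <= n)%N -> cn (res k y) <= 82 * (G * x) ^+ 2.
Proof.
move=> kn; have pT := @probability_setT _ _ _ (nu k).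
have bp := cbm_psi kn; have bc := bmeas_corr kn.
have <- : res k y - cint (nu k) (res k) = res k y.
  rewrite /res cintB//; [|exact: bsub1|exact/cbmZ/cbm_real].
  rewrite cintB//; last exact: cbm_cst.
  rewrite cintZ//; last exact: cbm_real.
  by rewrite nu_psi// cint_cst// subrr cint_real// nu_corr// mulr0 subrr subr0.
by apply: osc_cint => //; [exact: bres|exact: osc_res].
Qed.

Lemma osc_corr k y u : (k <= n)%N -> `|corr k y - corr k u| <= 2 * kappa * G.
Proof.
move=> kn; rewrite -cn_real rmorphB/=.
have -> : 2 * kappa * G = m%:R / (1 - q) * (2 * kappa) by rewrite /G; ring.
apply: (osc_rec q01 contr m_gt0 (f := fun k y => (corr k y)%:C)) => //.
- by move=> k' k'n; apply/cbm_real/bmeas_corr.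
- by move=> *; rewrite /corr backseq_last.
- by rewrite mulr_ge0.
move=> k' k'n; apply: osc_le_norm => v; rewrite cop_real -[X in cn X]rmorphB cn_real corrE//.
have bc : bmeas (corr k'.+1) by exact: bmeas_corr.
rewrite {1}/rop bmeas_RintegralD//; [|exact: prob_kernel|exact: bxi].
rewrite addrK; apply: bmeas_Rintegral_norm_le; first exact: prob_kernel.
  exact: bxi.
by move=> w; exact: xi_le.
Qed.

Lemma corr_le k y : (k <= n)%N -> `|corr k y| <= 2 * kappa * G.
Proof.
move=> kn; have pT := @probability_setT _ _ _ (nu k).
rewrite -cn_real -[_%:C]subr0.
have <- : cint (nu k) (fun y => (corr k y)%:C) = 0 by rewrite cint_real// nu_corr.
apply: (osc_cint (f := fun y => (corr k y)%:C)) => //.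
  exact/cbm_real/bmeas_corr.
by move=> u v; rewrite -[X in cn X]rmorphB cn_real osc_corr.
Qed.

Lemma tau_le k : (k < n)%N -> `|tau k.+1| <= 5 * G * kappa ^+ 2.
Proof.
move=> kn; rewrite (le_trans (ler_normD _ _))// normrM gtr0_norm//.
have pT := @probability_setT _ _ _ (nu k.+1).
have bx := bxi kn; have bc : bmeas (corr k.+1) by exact: bmeas_corr.
have h1 : `|\int[nu k.+1]_y (xi k.+1 y ^+ 2)| <= kappa ^+ 2.
  apply: bmeas_Rintegral_norm_le => //.
    by under eq_fun do rewrite expr2; exact: bmeasM.
  by move=> y; rewrite normrX lerXn2r ?nnegrE// xi_le.
have h2 : `|\int[nu k.+1]_y (xi k.+1 y * corr k.+1 y)| <= kappa * (2 * kappa * G).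
  apply: bmeas_Rintegral_norm_le => //; first exact: bmeasM.
  by move=> y; rewrite normrM ler_pM ?xi_le ?corr_le.
have h3 : kappa ^+ 2 <= G * kappa ^+ 2 by rewrite ler_peMl// sqr_ge0.
by lra.
Qed.

Let z_expansion k : (k < n)%N ->
  cn (z k - (1 - t ^+ 2 * tau k.+1 / 2)%:C) <= 100 * (G ^+ 2 * x ^+ 3).
Proof.
move=> kn; have pT := @probability_setT _ _ _ (nu k.+1).
have bp := cbm_psi kn; have bi := bitxi kn; have br := brem kn.
have bx := bxi kn; have bc : bmeas (corr k.+1) by exact: bmeas_corr.
have bx2 : bmeas (fun y => xi k.+1 y ^+ 2).
  by under eq_fun do rewrite expr2; exact: bmeasM.
have bxc : bmeas (fun y => xi k.+1 y * corr k.+1 y) by exact: bmeasM.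
have bre := bres kn.
(* The three cubic errors, bounded by 16 G x^3, x^3 and 82 G^2 x^3. In [l] below are the quadratic
   terms, with mean t^2 tau / 2; its cross term is the product of [i t xi] with the first order part
   of [psi]. *)
pose h y := (expi (t * xi k.+1 y) - 1 - itxi k y) * (psi k.+1 y - 1)
  + (expi (t * xi k.+1 y) - 1 - itxi k y + ((t * xi k.+1 y) ^+ 2 / 2)%:C)
  + itxi k y * res k.+1 y.
pose l y := t ^+ 2 / 2 * (xi k.+1 y ^+ 2) + t ^+ 2 * (xi k.+1 y * corr k.+1 y).
have bl : bmeas l by apply: bmeasD; exact: bmeasZ.
have hE y : expi (t * xi k.+1 y) * psi k.+1 y =
    h y + ((itxi k y + psi k.+1 y) - (l y)%:C).
  rewrite /h /res /itxi /l.
  rewrite !(rmorphM, rmorphD, rmorphXn)/=.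
  have i2 : 'i * 'i = -1 :> R[i] by rewrite -expr2 sqr_i.
  by ring: i2.
have be2 : cbm (fun y => expi (t * xi k.+1 y) - 1 - itxi k y).
  by apply: cbmB => //; apply/bsub1/bexpi.
have bh : cbm h.
  apply: cbmD; last exact: cbmM.
  apply: cbmD; first by apply: cbmM => //; exact: bsub1.
  apply: cbmD => //; apply: cbm_real.
  have -> : (fun y => (t * xi k.+1 y) ^+ 2 / 2) = (fun y => t ^+ 2 / 2 * xi k.+1 y ^+ 2).
    by apply/funext => y; rewrite exprMn; ring.
  exact: bmeasZ.
rewrite zE//; under eq_cint do rewrite hE.
rewrite cintD//; last by apply: cbmB; [exact: cbmD|exact: cbm_real].
rewrite cintB//; [|exact: cbmD|exact: cbm_real].
rewrite (cintD pT bi bp) nu_psi//.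
have -> : cint (nu k.+1) (itxi k) = 0.
  rewrite /itxi cintZ//; last exact/cbm_real/btxi.
  rewrite cint_real// bmeas_RintegralZ//.
  by rewrite nu_xi// mulr0 mulr0.
rewrite cint_real// /l bmeas_RintegralD//; [|exact: bmeasZ..].
rewrite !bmeas_RintegralZ// /tau.
set I1 := \int[_]_y _; set I2 := \int[_]_y _.
have -> : cint (nu k.+1) h + (0 + 1 - (t ^+ 2 / 2 * I1 + t ^+ 2 * I2)%:C) -
  (1 - t ^+ 2 * (I1 + 2 * I2) / 2)%:C = cint (nu k.+1) h.
  have -> : t ^+ 2 * (I1 + 2 * I2) / 2 = t ^+ 2 / 2 * I1 + t ^+ 2 * I2 by field.
  by rewrite rmorphB/=; ring.
apply: cn_cint => // y.
have h1 := ler_pM (cn_ge0 _) (cn_ge0 _) (e2 y kn) (psi_sub1 y kn).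
have h2 := ler_pM (cn_ge0 _) (cn_ge0 _) (cn_itxi y kn) (cn_res y kn).
have h3 : cn (expi (t * xi k.+1 y) - 1 - itxi k y + ((t * xi k.+1 y) ^+ 2 / 2)%:C)
    <= x ^+ 3.
  have ht := txi y kn; have := x1 => ?.
  rewrite (le_trans (cn_expi_sub3 _))//; first by lra.
  by rewrite lerXn2r ?nnegrE.
rewrite -!cnM in h1 h2.
rewrite (le_trans (cnD _ _))// (le_trans (lerD (cnD _ _) (lexx _)))//.
have x3 : 0 <= x ^+ 3 by rewrite exprn_ge0.
have g1 : G * x ^+ 3 <= G ^+ 2 * x ^+ 3 by rewrite ler_wpM2r// ler_eXnr.
have g2 : x ^+ 3 <= G * x ^+ 3 by rewrite ler_peMl.
by lra.
Qed.

Let c_prod : c 0 = \prod_(k < n) z k.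
Proof.
have h j : (j <= n)%N -> c 0 = (\prod_(k < j) z k) * c j.
  elim: j => [|j IH] jn; first by rewrite big_ord0 mul1r.
  rewrite big_ord_recr/= IH; last exact: ltnW.
  by rewrite /z -mulrA divfK// c_neq0.
rewrite (h n (leqnn _)) /c.
rewrite (_ : cint _ _ = 1) ?mulr1//.
rewrite (@eq_cint _ _ _ _ _ (fun=> 1)) ?cint_cst//; first exact: probability_setT.
exact: phi_last.
Qed.

Definition total_var : R := \sum_(k < n) tau k.+1.

(** Each ratio is divided by exp(-t^2 tau / 2) before multiplying, so that the Gaussian factor comes
    out in front of the error. The individual [tau] may have any sign; only their sum occurs in the
    exponent. *)
Lemma charfun_expansion delta : delta = 202 * (G ^+ 2 * x ^+ 3) ->
  cn (cint (nu 0%N) (phi 0) - (expR (- (t ^+ 2 * total_var / 2)))%:C) <=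
  expR (- (t ^+ 2 * total_var / 2)) * (n%:R * delta * expR (n%:R * delta)).
Proof.
move=> deltaE; pose w k := expR (- (t ^+ 2 * tau k.+1 / 2)).
have wE : expR (- (t ^+ 2 * total_var / 2)) = \prod_(k < n) w k.
  rewrite -expR_sum; congr expR; rewrite /total_var mulr_sumr mulr_suml.
  by rewrite -sumrN.
have w0 k : w k != 0 by rewrite gt_eqF// expR_gt0.
have -> : cint (nu 0%N) (phi 0) - (expR (- (t ^+ 2 * total_var / 2)))%:C =
    (expR (- (t ^+ 2 * total_var / 2)))%:C * (\prod_(k < n) (z k / (w k)%:C) - 1).
  rewrite prodf_div -[cint _ _]/(c 0) c_prod wE rmorph_prod mulrBr mulr1 mulrCA divff ?mulr1//.
  by apply/prodf_neq0 => k _; rewrite fmorph_eq0.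
rewrite cnM cn_real gtr0_norm ?expR_gt0// ler_wpM2l ?expR_ge0//.
apply: (prod_perturbation (u := fun k => z k / (w k)%:C)).
  by rewrite deltaE mulr_ge0// mulr_ge0 ?sqr_ge0 ?exprn_ge0.
move=> k kn.
have tx : t ^+ 2 * kappa ^+ 2 = x ^+ 2 by rewrite /x exprMn real_normK ?num_real// mulrC.
have ty : `|- (t ^+ 2 * tau k.+1 / 2)| <= 5 / 2 * (G * x ^+ 2).
  rewrite normrN normrM [ `|2^-1|]gtr0_norm ?invr_gt0// normrM (ger0_norm (sqr_ge0 t)).
  have := ler_wpM2l (sqr_ge0 t) (tau_le kn); rewrite -tx; lra.
have x_ge0 := x0; have gx := Gx1; have xx := x1; have g1 := G1.
have gx2 : G * x ^+ 2 <= 1 / 64 * x.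
  by rewrite expr2 mulrA ler_wpM2r//; lra.
have ey : `|expR (- (t ^+ 2 * tau k.+1 / 2)) - 1 - - (t ^+ 2 * tau k.+1 / 2)| <=
   2 * (- (t ^+ 2 * tau k.+1 / 2)) ^+ 2.
  by apply: expR_sub2; lra.
rewrite opprK -/(w k) in ey.
have y2 : (- (t ^+ 2 * tau k.+1 / 2)) ^+ 2 <= 7 * (G ^+ 2 * x ^+ 4).
  rewrite -[leLHS]real_normK ?num_real//.
  rewrite (@le_trans _ _ ((5 / 2 * (G * x ^+ 2)) ^+ 2))//.
    by rewrite lerXn2r ?nnegrE// (le_trans _ ty).
  have := mulr_ge0 (sqr_ge0 G) (exprn_ge0 4 x0); lra.
have x4 : G ^+ 2 * x ^+ 4 <= 1 / 64 * (G ^+ 2 * x ^+ 3).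
  rewrite [x ^+ 4]exprS mulrCA ler_wpM2r//.
  by rewrite mulr_ge0 ?sqr_ge0 ?exprn_ge0.
(* Division by [w k] doubles 101 to 202; the 101 is 100 from [z_expansion] plus the quadratic Taylor
   error of [w k], as 2 * 7 / 64 <= 1. *)
have w12 : 1 / 2 <= w k.
  by have := expR_ge1Dx (- (t ^+ 2 * tau k.+1 / 2)); rewrite -/(w k); move: ty;
     rewrite ler_norml => /andP[]; lra.
have wp : 0 < w k by exact: expR_gt0.
have -> : z k / (w k)%:C - 1 = (z k - (w k)%:C) / (w k)%:C.
  by rewrite mulrBl divff// fmorph_eq0.
rewrite cnM cnV cn_real (gtr0_norm wp) ler_pdivrMr//.
have zw : cn (z k - (w k)%:C) <= 101 * (G ^+ 2 * x ^+ 3).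
  have -> : z k - (w k)%:C = (z k - (1 - t ^+ 2 * tau k.+1 / 2)%:C) -
      (w k - 1 + t ^+ 2 * tau k.+1 / 2)%:C.
    by rewrite !(rmorphB, rmorphD)/= !rmorph1; ring.
  rewrite (le_trans (cnB _ _))// cn_real.
  have := z_expansion kn.
  by have := mulr_ge0 (sqr_ge0 G) (exprn_ge0 3 x0); lra.
rewrite (le_trans zw)// deltaE.
have := ler_wpM2l (mulr_ge0 (sqr_ge0 G) (exprn_ge0 3 x0)) w12.
by lra.
Qed.

End charfun.

(** * The Markov property for bounded functions of the past *)

Section bounded_functional.
Context d (S : measurableType d) (R : realType).

(** The sum counts the thresholds 1, ..., n not above [u]: it is the integer part of [u]. *)
Lemma sum_le_indicator_bounds (n : nat) (u : R) : 0 <= u <= n%:R ->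
  u - 1 <= \sum_(i < n) (i.+1%:R <= u)%R%:R <= u.
Proof.
elim: n u => [|n IH] u /andP[u0 un]; first by rewrite big_ord0; apply/andP; split; lra.
rewrite big_ord_recr/=.
have [un'|nu'] := leP u n%:R.
  have /IH/andP[h1 h2] : 0 <= u <= n%:R by rewrite u0.
  have -> : (n.+1%:R <= u) = false by apply/negbTE; rewrite -ltNge -natr1; lra.
  by rewrite addr0 h1 h2.
have -> : \sum_(i < n) (i.+1%:R <= u)%R%:R = n%:R :> R.
  rewrite (eq_bigr (fun=> 1)) ?sumr_const ?card_ord// => i _.
  by rewrite (le_trans _ (ltW nu'))// ler_nat.
rewrite -natr1 in un *.
by have [h|h] /= := leP (n%:R + 1) u; apply/andP; split; lra.
Qed.

Lemma bmeas_indic (A : set S) : measurable A -> bmeas (\1_A : S -> R).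
Proof.
move=> mA; split; first exact: measurable_indic.
by exists 1 => x; rewrite indicE; case: (_ \in _); rewrite ?normr1 ?normr0.
Qed.

Variable L : (S -> R) -> R.
Hypothesis LD : forall f g, bmeas f -> bmeas g ->
  L (fun x => f x + g x) = L f + L g.
Hypothesis LZ : forall c f, bmeas f -> L (fun x => c * f x) = c * L f.
Variable M : R.
Hypothesis L_le : forall f e, bmeas f -> (forall x, `|f x| <= e) -> `|L f| <= M * e.
Hypothesis L_indic : forall A, measurable A -> L \1_A = 0.

(* A bounded f is uniformly close to an affine combination of the indicators of
   its superlevel sets. *)
Lemma bounded_functional_eq0 f : bmeas f -> L f = 0.
Proof.
move=> bf; have [mf [K0 fK0]] := bf.
pose K := K0 + 1.
have K0_ge0 : 0 <= K0 by rewrite (le_trans _ (fK0 point)).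
have K_gt0 : 0 < K by rewrite /K; lra.
have fK x : `|f x| <= K by rewrite (le_trans (fK0 x))// /K; lra.
have M0 : 0 <= M.
  have h1 (x : S) : `|(1 : R)| <= 1 by rewrite normr1.
  by have := L_le (bmeas_cst S 1) h1; rewrite mulr1; apply: le_trans.
pose A (n i : nat) := [set x | - K + 2 * K / n%:R * i.+1%:R <= f x].
have mA n i : measurable (A n i).
  rewrite (_ : A n i = setT `&` f @^-1` `[- K + 2 * K / n%:R * i.+1%:R, +oo[).
    by apply: mf => //; exact: measurable_itv.
  by rewrite setTI; apply/seteqP; split => x /=; rewrite in_itv/= andbT.
pose fn (n j : nat) x := \sum_(i < j) (\1_(A n i) x : R).
have bfn n j : bmeas (fn n j) /\ L (fn n j) = 0.
  elim: j => [|j [IH1 IH2]].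
    have -> : fn n 0%N = (fun=> 0) by apply/funext => x; rewrite /fn big_ord0.
    split; first exact: bmeas_cst.
    have -> : (fun=> 0 : R) = (fun x : S => 0 * (fun=> 0) x) :> (S -> R) by apply/funext => x; rewrite mul0r.
    by rewrite LZ ?mul0r//; exact: bmeas_cst.
  have -> : fn n j.+1 = (fun x => fn n j x + \1_(A n j) x).
    by apply/funext => x; rewrite /fn big_ord_recr.
  split; first by apply: bmeasD => //; exact: bmeas_indic.
  by rewrite LD//; [rewrite IH2 L_indic ?addr0|exact: bmeas_indic].
have L1 : L (fun=> 1) = 0.
  by rewrite -(L_indic measurableT); congr L; apply/funext => x; rewrite indicT.
have key n : (0 < n)%N -> `|L f| <= M * (2 * K / n%:R).
  move=> n0; have n0' : 0 < n%:R :> R by rewrite ltr0n.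
  (* [h] differs from [f] only by functions that [L] kills, and is bounded by 2 K / n. *)
  pose h x := f x + ((- (2 * K / n%:R)) * fn n n x + K * 1).
  have bc : bmeas (fun=> 1 : R) := bmeas_cst S 1.
  have [b1 b2] := bfn n n.
  have b3 : bmeas (fun x => - (2 * K / n%:R) * fn n n x + K * 1).
    by apply: bmeasD; [exact: bmeasZ|exact: bmeas_cst].
  have -> : L f = L h.
    by rewrite LD// LD ?LZ ?b2 ?L1 ?mulr0 ?addr0//; exact: bmeasZ.
  apply: L_le; first exact: bmeasD.
  move=> x; pose u := (f x + K) / (2 * K / n%:R).
  have w0 : 0 < 2 * K / n%:R by rewrite divr_gt0// mulr_gt0.
  have uE : f x + K = 2 * K / n%:R * u by rewrite /u; field; lra.
  have /sum_le_indicator_bounds : 0 <= u <= n%:R.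
    have := fK x; rewrite ler_norml => /andP[f1 f2].
    rewrite divr_ge0/=; [|lra|exact: ltW].
    rewrite ler_pdivrMr// mulrC divfK ?gt_eqF//; lra.
  have -> : \sum_(i < n) (i.+1%:R <= u)%R%:R = fn n n x.
    apply: eq_bigr => i _; rewrite indicE; congr (nat_of_bool _)%:R.
    rewrite /A; apply/idP/idP.
      by rewrite -(ler_pM2l w0) -uE inE/= => iu; lra.
    by rewrite inE/= => iu; rewrite -(ler_pM2l w0) -uE; lra.
  rewrite /h => /andP[s1 s2].
  have -> : f x + (- (2 * K / n%:R) * fn n n x + K * 1) = 2 * K / n%:R * (u - fn n n x).
    by rewrite mulrBr -uE; ring.
  rewrite normrM (gtr0_norm w0) ger_pMr// ler_norml; apply/andP; split; lra.
apply/eqP; rewrite -normr_le0 leNgt; apply/negP => Lf.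
have [n hn] : exists n : nat, M * (2 * K) / `|L f| < n%:R.
  by exists (Num.truncn (M * (2 * K) / `|L f|)).+1; exact: truncnS_gt.
have n0 : (0 < n)%N.
  rewrite -(ltr0n R); apply: le_lt_trans hn.
  by rewrite divr_ge0// mulr_ge0// mulr_ge0// ltW.
have := key n n0; rewrite leNgt => /negP; apply.
by rewrite mulrA ltr_pdivrMr ?ltr0n// [ltRHS]mulrC -ltr_pdivrMr.
Qed.

End bounded_functional.

Section markov.
Context d d' (Omega : measurableType d) (T : measurableType d') (R : realType).
Variable P : probability Omega R.
Variables (N : nat) (mu : probability T R) (Q : nat -> R.-pker T ~> T).
Variable X : nat -> {RV P >-> T}.
Hypothesis chainX : markov_chain N mu Q X.

Definition past_gen (k : nat) : set (set Omega) :=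
  [set B | exists2 j, (j <= k)%N & exists2 A, measurable A & B = X j @^-1` A].

(** [Omega] with the sigma-algebra of the past, so that dependence on X_0, ..., X_k becomes plain
    measurability and [bounded_functional_eq0] applies on this space. *)
Definition past_type (k : nat) := g_sigma_algebraType (past_gen k).

(* [pmeas k Z]: Z is bounded and depends measurably on X_0, ..., X_k. *)
Definition pmeas k (Z : Omega -> R) := @bmeas _ (past_type k) R Z.

Lemma past_measurable k B : past X k B -> measurable B.
Proof.
apply: smallest_sub; first exact: sigma_algebra_measurable.
by move=> _ [j _ [A mA ->]]; exact: measurable_funPTI.
Qed.

Lemma pmeas_bmeas k Z : pmeas k Z -> bmeas Z.
Proof.
move=> [mZ ZM]; split => // _ U mU; apply: past_measurable.
exact: (mZ measurableT U mU).
Qed.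

Lemma pmeas_comp k j (f : T -> R) : (j <= k)%N -> bmeas f ->
  pmeas k (f \o X j).
Proof.
move=> jk [mf [M fM]]; split; last by exists M => w /=; exact: fM.
move=> _ U mU; apply: sub_sigma_algebra; exists j => //.
exists (f @^-1` U); last by rewrite setTI.
by rewrite -[X in measurable X]setTI; exact: mf.
Qed.

Lemma bmeas_comp (f : T -> R) j : bmeas f -> bmeas (f \o X j).
Proof. by move=> bf; apply: (@pmeas_bmeas j); exact: pmeas_comp. Qed.

Let PT : P setT = 1%E. Proof. exact: probability_setT. Qed.

Let markov_indic k A B : (k < N)%N -> measurable A -> past X k B ->
  \int[P]_w (\1_B w * \1_A (X k.+1 w)) =
  \int[P]_w (\1_B w * rop (Q k.+1) \1_A (X k w)).
Proof.
move=> kN mA pB; have mB := past_measurable pB.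
have := chainX.2 k A B kN mA pB => /(congr1 fine).
have mXA : measurable (X k.+1 @^-1` A).
  exact: measurable_funPTI.
have -> : fine (P (B `&` X k.+1 @^-1` A)) = \int[P]_w (\1_B w * \1_A (X k.+1 w)).
  rewrite (_ : (fun w => _) = (\1_(B `&` X k.+1 @^-1` A) : Omega -> R)).
    rewrite /Rintegral integral_indic ?setIT//; exact: measurableI.
  by apply/funext => w; rewrite indicI/= !indicE.
move=> ->; rewrite integral_mkcond; congr fine; apply: eq_integral => w _.
rewrite patchE indicE; case: ifPn => wB; rewrite ?mul1r ?mul0r//.
rewrite /rop /Rintegral integral_indic ?setIT// fineK// ge0_fin_numE//.
apply: (@le_lt_trans _ _ (Q k.+1 (X k w) setT)).
  by apply: le_measure; rewrite ?inE.
by rewrite prob_kernel ltry.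
Qed.

(** First extension, from indicators of states to bounded [f]: the difference of the sides is linear
    in [f] and bounded by 2 sup |f|. *)
Let markov_fun k f B : (k < N)%N -> bmeas f -> past X k B ->
  \int[P]_w (\1_B w * f (X k.+1 w)) =
  \int[P]_w (\1_B w * rop (Q k.+1) f (X k w)).
Proof.
move=> kN bf pB; have mB := past_measurable pB.
have b1 : bmeas (\1_B : Omega -> R) by exact: bmeas_indic.
pose L (f : T -> R) := \int[P]_w (\1_B w * f (X k.+1 w)) -
  \int[P]_w (\1_B w * rop (Q k.+1) f (X k w)).
have bX (h : T -> R) j : bmeas h -> bmeas (fun w => \1_B w * h (X j w)).
  by move=> bh; apply: bmeasM => //; exact: (bmeas_comp j bh).
apply/subr0_eq; rewrite -/(L f).
apply: (@bounded_functional_eq0 _ _ _ L _ _ 2) => //.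
- move=> f1 f2 bf1 bf2; rewrite /L.
  have -> : (fun w => \1_B w * (f1 (X k.+1 w) + f2 (X k.+1 w))) =
    (fun w => \1_B w * f1 (X k.+1 w) + \1_B w * f2 (X k.+1 w)) :> (Omega -> R).
    by apply/funext => w; rewrite mulrDr.
  have -> : (fun w => \1_B w * rop (Q k.+1) (fun x => f1 x + f2 x) (X k w)) =
    (fun w => \1_B w * rop (Q k.+1) f1 (X k w) + \1_B w * rop (Q k.+1) f2 (X k w)) :> (Omega -> R).
    apply/funext => w; rewrite -mulrDr /rop bmeas_RintegralD//; exact: prob_kernel.
  rewrite !bmeas_RintegralD//; [ring|..]; apply: bX => //; exact: bmeas_rop.
- move=> c f1 bf1; rewrite /L.
  have -> : (fun w => \1_B w * (c * f1 (X k.+1 w))) =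
    (fun w => c * (\1_B w * f1 (X k.+1 w))) :> (Omega -> R).
    by apply/funext => w; rewrite mulrCA.
  have -> : (fun w => \1_B w * rop (Q k.+1) (fun x => c * f1 x) (X k w)) =
    (fun w => c * (\1_B w * rop (Q k.+1) f1 (X k w))) :> (Omega -> R).
    apply/funext => w; rewrite mulrCA; congr (_ * _).
    by rewrite /rop bmeas_RintegralZ//; exact: prob_kernel.
  rewrite !bmeas_RintegralZ//; [ring|..]; apply: bX => //; exact: bmeas_rop.
- move=> f1 e bf1 f1e; rewrite /L.
  have e0 : 0 <= e by rewrite (le_trans _ (f1e point)).
  have h1 (h : T -> R) j : bmeas h -> (forall x, `|h x| <= e) ->
      `|\int[P]_w (\1_B w * h (X j w))| <= e.
    move=> bh he; apply: bmeas_Rintegral_norm_le => //; first exact: bX.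
    move=> w; rewrite normrM -[leRHS]mul1r ler_pM// indicE.
    by case: (_ \in _); rewrite ?normr1 ?normr0.
  rewrite (le_trans (ler_normB _ _))// mulrDl mul1r lerD// h1//.
    exact: bmeas_rop.
  by move=> x; apply: bmeas_Rintegral_norm_le => //; exact: prob_kernel.
- by move=> A mA; apply/eqP; rewrite subr_eq0; apply/eqP; exact: markov_indic.
Qed.

(** Second extension, from events of the past to bounded weights [Z], with the functional now acting
    on functions on [past_type k]. *)
Lemma markov_property k f Z : (k < N)%N -> bmeas f -> pmeas k Z ->
  \int[P]_w (Z w * f (X k.+1 w)) = \int[P]_w (Z w * rop (Q k.+1) f (X k w)).
Proof.
move=> kN bf bZ.
have bX (h : T -> R) j : bmeas h -> bmeas (fun w => h (X j w)).
  by move=> bh; exact: (bmeas_comp j bh).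
pose D w := f (X k.+1 w) - rop (Q k.+1) f (X k w).
have bD : bmeas D by apply: bmeasB; apply: bX => //; exact: bmeas_rop.
have DE Z' : pmeas k Z' -> \int[P]_w (Z' w * D w) = \int[P]_w (Z' w * f (X k.+1 w))
    - \int[P]_w (Z' w * rop (Q k.+1) f (X k w)).
  move=> /pmeas_bmeas bZ'; rewrite -bmeas_RintegralB//.
  - by apply: eq_Rintegral => w _; rewrite mulrBr.
  - by apply: bmeasM => //; exact: bX.
  - by apply: bmeasM => //; apply: bX; exact: bmeas_rop.
apply/subr0_eq; rewrite -DE//.
have [_ [M DM]] := bD.
pose L (Z : past_type k -> R) := \int[P]_w (Z w * D w).
apply: (@bounded_functional_eq0 _ (past_type k) _ L _ _ M) => //.
- move=> f1 f2 /pmeas_bmeas bf1 /pmeas_bmeas bf2; rewrite /L.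
  rewrite -bmeas_RintegralD//; [|exact: bmeasM..].
  by apply: eq_Rintegral => w _; rewrite mulrDl.
- move=> c f1 /pmeas_bmeas bf1; rewrite /L.
  rewrite -bmeas_RintegralZ//; last exact: bmeasM.
  by apply: eq_Rintegral => w _; rewrite mulrA.
- move=> f1 e /pmeas_bmeas bf1 f1e; rewrite /L.
  apply: bmeas_Rintegral_norm_le => //; first exact: bmeasM.
  by move=> w; rewrite normrM mulrC ler_pM.
- move=> A mA; rewrite /L (DE \1_A).
    by rewrite (markov_fun kN bf mA) subrr.
  exact: bmeas_indic.
Qed.

Definition law k : probability T R := distribution P (X k).

Lemma law_Rintegral k f : bmeas f -> \int[law k]_x f x = \int[P]_w f (X k w).
Proof.
move=> bf; rewrite /Rintegral /law integral_distribution//.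
  by apply/measurable_EFinP; exact: bf.1.
exact: (bmeas_integrable PT (bmeas_comp k bf)).
Qed.

Lemma lawP k f : (k < N)%N -> bmeas f ->
  \int[law k.+1]_x f x = \int[law k]_x rop (Q k.+1) f x.
Proof.
move=> kN bf; rewrite !law_Rintegral//; last exact: bmeas_rop.
have := markov_property kN bf (bmeas_cst (past_type k) 1).
by under eq_Rintegral do rewrite mul1r; under [RHS]eq_Rintegral do rewrite mul1r.
Qed.

Lemma law0 f : bmeas f -> \int[law 0]_x f x = \int[mu]_x f x.
Proof.
move=> bf; rewrite /Rintegral; congr fine; apply: eq_measure_integral => A mA _.
exact: (chainX.1 A mA).
Qed.

Lemma cint_law k f : cbm f -> cint (law k) f = cint P (fun w => f (X k w)).
Proof. by move=> [f1 f2]; rewrite /cint !law_Rintegral. Qed.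

Definition cpmeas k (Z : Omega -> R[i]) := @cbm _ (past_type k) R Z.

Lemma cmarkov_property k f Z : (k < N)%N -> cbm f -> cpmeas k Z ->
  cint P (fun w => Z w * f (X k.+1 w)) =
  cint P (fun w => Z w * cop (Q k.+1) f (X k w)).
Proof.
move=> kN [f1 f2] [Z1 Z2]; rewrite /cint.
have bX (h : T -> R) j (Z' : Omega -> R) : bmeas h -> pmeas k Z' -> bmeas (fun w => Z' w * h (X j w)).
  by move=> bh /pmeas_bmeas bZ'; apply: bmeasM => //; exact: (bmeas_comp j bh).
have c1 : bmeas (fun x => Re (cop (Q k.+1) f x)) by exact: (bmeas_rop _ f1).
have c2 : bmeas (fun x => Im (cop (Q k.+1) f x)) by exact: (bmeas_rop _ f2).
congr Complex.
  under eq_Rintegral do rewrite ReM.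
  under [RHS]eq_Rintegral do rewrite ReM.
  rewrite bmeas_RintegralB//; [|exact: (bX _ _ _ f1)|exact: (bX _ _ _ f2)].
  rewrite bmeas_RintegralB//; [|exact: (bX _ _ _ c1)|exact: (bX _ _ _ c2)].
  by rewrite (markov_property kN f1 Z1) (markov_property kN f2 Z2).
under eq_Rintegral do rewrite ImM.
under [RHS]eq_Rintegral do rewrite ImM.
rewrite bmeas_RintegralD//; [|exact: (bX _ _ _ f2)|exact: (bX _ _ _ f1)].
rewrite bmeas_RintegralD//; [|exact: (bX _ _ _ c2)|exact: (bX _ _ _ c1)].
by rewrite (markov_property kN f2 Z1) (markov_property kN f1 Z2).
Qed.

Lemma charfun_chain (xi : nat -> T -> R) (t : R) :
  (forall k, (k < N)%N -> bmeas (xi k.+1)) ->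
  cint P (fun w => expi (t * \sum_(j < N) xi j.+1 (X j.+1 w))) =
  cint (law 0) (phi N Q xi t 0).
Proof.
move=> bxi; pose S k w := \sum_(j < k) xi j.+1 (X j.+1 w).
have mS k : (k <= N)%N -> pmeas k (S k).
  move=> kN.
  have h i : (i <= k)%N -> pmeas k (S i).
    elim: i => [|i IH] ik.
      rewrite (_ : S 0%N = fun=> 0); first exact: bmeas_cst.
      by apply/funext => w; rewrite /S big_ord0.
    rewrite (_ : S i.+1 = fun w => S i w + xi i.+1 (X i.+1 w)).
      apply: bmeasD; first by apply: IH; exact: ltnW.
      by apply: (pmeas_comp ik); apply: bxi; exact: leq_trans ik kN.
    by apply/funext => w; rewrite /S big_ord_recr.
  exact: h.
have bphi k : (k <= N)%N -> cbm (phi N Q xi t k) by exact: cbm_phi.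
(* The martingale E exp(i t S_k) phi_k(X_k) is constant in [k]; k = 0 and k = N are the two sides of
   the claim. *)
have key k : (k <= N)%N -> cint P (fun w => expi (t * S k w) * phi N Q xi t k (X k w)) =
    cint (law 0) (phi N Q xi t 0).
  elim: k => [|k IH] kN.
    rewrite cint_law; last exact: bphi.
    by apply: eq_cint => w; rewrite /S big_ord0 mulr0 expi0 mul1r.
  rewrite -(IH (ltnW kN)) (phiE Q xi t kN).
  rewrite -(@cmarkov_property k (fun y => expi (t * xi k.+1 y) * phi N Q xi t k.+1 y))//.
  - by apply: eq_cint => w; rewrite /S big_ord_recr/= mulrDr expiD mulrA.
  - apply: cbmM; last exact: bphi.
    by apply: cbm_expi; apply: (bmeasZ t (bxi k kN)).1.
  - by apply: cbm_expi; exact: (bmeasZ t (mS k (ltnW kN))).1.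
rewrite -(key N (leqnn N)); apply: eq_cint => w.
by rewrite phi_last mulr1.
Qed.

End markov.

(** * The Fejer kernel and Esseen's smoothing inequality *)

Section fejer.
Variable R : realType.
Implicit Types (x y z s t : R).
Notation leb := (@lebesgue_measure R).
Notation D01 := (`]0 : R, 1]%classic).

Lemma leb_D01 : leb D01 = 1%E.
Proof. by rewrite lebesgue_measure_itv/= lte_fin ltr01 oppr0 adde0. Qed.

Lemma bounded_integrable_D01 (f : R -> R) (M : R) : measurable_fun D01 f ->
  (forall s, D01 s -> `|f s| <= M) -> leb.-integrable D01 (EFin \o f).
Proof.
move=> mf fM; apply: measurable_bounded_integrable => //.
  by rewrite [ltLHS]leb_D01 ltry.
exists M; split; first exact: num_real.
by move=> x Mx s Ds /=; apply: le_trans (fM s Ds) (ltW Mx).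
Qed.

Lemma RintegralD01_le (f : R -> R) (M : R) : measurable_fun D01 f ->
  (forall s, D01 s -> `|f s| <= M) -> `|\int[leb]_(s in D01) f s| <= M.
Proof.
move=> mf fM; have fi := bounded_integrable_D01 mf fM.
rewrite (le_trans (le_normr_Rintegral _ _))//.
have -> : M = \int[leb]_(s in D01) M.
  by rewrite Rintegral_cst// [X in fine X]leb_D01 mulr1.
apply: le_Rintegral => //.
- apply: bounded_integrable_D01 (M) _ _; first exact: measurableT_comp.
  by move=> s Ds; rewrite normr_id fM.
- by apply: (@bounded_integrable_D01 _ `|M|) => // s _.
Qed.

Lemma cauchy_integralT (A : R) : 0 < A ->
  (\int[leb]_x ((A ^+ 2 + x ^+ 2)^-1)%:E)%E = (pi / A)%:E.
Proof.
move=> A0; have d0 x : A ^+ 2 + x ^+ 2 != 0.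
  by rewrite gt_eqF// ltr_wpDr ?sqr_ge0// exprn_gt0.
have cf : continuous (fun x : R => (A ^+ 2 + x ^+ 2)^-1).
  move=> x; apply: cvgV => //; apply: cvgD; first exact: cvg_cst.
  exact: exprn_continuous.
rewrite ge0_symfun_integralT//; last 2 first.
- by move=> x; rewrite invr_ge0 addr_ge0 ?sqr_ge0.
- by move=> x /=; rewrite sqrrN.
rewrite (_ : [set x | _] = `[0, +oo[%classic); last first.
  by apply/seteqP; split => x/=; rewrite in_itv/= andbT.
have dF x : is_derive x 1 (fun x : R => A^-1 * atan (x / A)) ((A ^+ 2 + x ^+ 2)^-1).
  have h1 : is_derive x 1 (fun x : R => x / A) A^-1.
    by apply: is_derive_eq; rewrite /GRing.scale/=; ring.
  have h2 : is_derive x 1 (fun x : R => atan (x / A)) ((1 + (x / A) ^+ 2)^-1 * A^-1).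
    exact: (@is_derive1_comp _ atan (fun x => x / A) x _ _ (is_derive1_atan (x / A)) h1).
  apply: is_derive_eq; rewrite /GRing.scale/=.
  have := d0 x; have Ane : A != 0 by rewrite gt_eqF.
  have h5 : 1 + (x / A) ^+ 2 != 0 by rewrite gt_eqF// ltr_wpDr ?sqr_ge0.
  by move=> h4; field; rewrite Ane h4.
have cF : continuous (fun x : R => A^-1 * atan (x / A)).
  by move=> x; apply/differentiable_continuous/derivable1_diffP/ex_derive.
rewrite (@ge0_continuous_FTC2y _ _ (fun x : R => A^-1 * atan (x / A)) _ (A^-1 * (pi / 2))).
- rewrite mul0r atan0 mulr0 sube0 -EFinM; congr EFin.
  by field; rewrite gt_eqF.
- by move=> x _; rewrite invr_ge0 addr_ge0 ?sqr_ge0.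
- exact: continuous_subspaceT.
- apply: cvgM; first exact: cvg_cst.
  apply: (cvg_comp _ _ _ (@cvgy_atan R)).
  by apply: gt0_cvgMly; [rewrite invr_gt0|exact: cvg_id].
- by move=> x _; exact: ex_derive.
- apply: cvg_at_right_filter.
  exact: cF.
- by move=> x _; rewrite derive1E; exact: derive_val.
Qed.

(** The function (1 - cos y) / y^2 given by its Fourier side, which shows that it only involves
    frequencies up to 1. It is left unnormalised: a lower bound near 0 and a tail bound are what
    smoothing uses. *)
Definition fejer y : R := \int[leb]_(s in D01) ((1 - s) * cos (s * y)).

Lemma measurable_cos_scale y : measurable_fun setT (fun s : R => cos (s * y)).
Proof.
apply: continuous_measurable_fun => s; apply: continuous_comp.
  exact: mulrr_continuous.
exact: continuous_cos.
Qed.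

Lemma measurable_fejer_integrand y :
  measurable_fun setT (fun s : R => (1 - s) * cos (s * y)).
Proof.
apply: measurable_funM; last exact: measurable_cos_scale.
by apply: measurable_funB.
Qed.

Lemma fejer_integrand_le y s : D01 s -> `|(1 - s) * cos (s * y)| <= 1.
Proof.
rewrite /= in_itv/= => /andP[s0 s1]; rewrite normrM -[leRHS]mul1r ler_pM//.
  by rewrite ler_norml; apply/andP; split; lra.
by rewrite ler_norml cos_geN1 cos_le1.
Qed.

Lemma fejer_integrable y :
  leb.-integrable D01 (EFin \o (fun s : R => (1 - s) * cos (s * y))).
Proof.
apply: (@bounded_integrable_D01 _ 1).
  by apply: measurable_funTS; exact: measurable_fejer_integrand.
exact: fejer_integrand_le.
Qed.

Lemma fejer_le1 y : `|fejer y| <= 1.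
Proof.
apply: RintegralD01_le; first by apply: measurable_funTS; exact: measurable_fejer_integrand.
exact: fejer_integrand_le.
Qed.

Lemma fejer_continuous : continuous fejer.
Proof.
move=> y.
have h := @continuity_under_integral R _ _ leb
  (fun y s => (1 - s) * cos (s * y)) D01 (measurable_itv _) (y - 1) (y + 1) _ _ (fun=> 1) _ _ y.
apply: h.
- by move=> u _; exact: fejer_integrable.
- apply: aeW => s _ u _; apply: cvgM; first exact: cvg_cst.
  by apply: continuous_comp; [exact: mulrl_continuous|exact: continuous_cos].
- by apply: (@bounded_integrable_D01 _ 1) => // s _; rewrite normr1.
- by move=> u _; apply: aeW => s Ds; exact: fejer_integrand_le.
- by rewrite inE/= in_itv/=; apply/andP; split; lra.
Qed.

Lemma fejerE y : y != 0 -> fejer y = (1 - cos y) / y ^+ 2.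
Proof.
move=> y0.
pose F s := (1 - s) * (sin (s * y) / y) - cos (s * y) / y ^+ 2.
have dm s : is_derive s 1 (fun s : R => s * y) y.
  by apply: is_derive_eq; rewrite /GRing.scale/=; ring.
have dF s : is_derive s 1 F ((1 - s) * cos (s * y)).
  have ds : is_derive s 1 (fun s : R => sin (s * y)) (cos (s * y) * y) := @is_derive1_comp _ sin (fun s => s * y) s _ _ (is_derive_sin (s * y)) (dm s).
  have dc : is_derive s 1 (fun s : R => cos (s * y)) (- sin (s * y) * y) := @is_derive1_comp _ cos (fun s => s * y) s _ _ (is_derive_cos (s * y)) (dm s).
  have d1 : is_derive s 1 (fun s : R => 1 - s) (-1).
    by apply: is_derive_eq; ring.
  rewrite /F; apply: is_derive_eq.
  rewrite /GRing.scale/=; field; exact: y0.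
rewrite /fejer /Rintegral integral_itv_obnd_cbnd; last first.
  by apply/measurable_EFinP; apply: measurable_funTS; exact: measurable_fejer_integrand.
have cF : continuous F.
  by move=> s; apply/differentiable_continuous/derivable1_diffP/ex_derive.
rewrite (@continuous_FTC2 _ _ F)//.
- rewrite /F -EFinB/= !mul0r !mul1r subrr mul0r sub0r sin0 cos0 mul0r mulr0 sub0r opprK.
  by rewrite mulrBl addrC.
- apply: continuous_subspaceT => s; apply: cvgM.
    by apply: cvgB; [exact: cvg_cst|exact: cvg_id].
  by apply: continuous_comp; [exact: mulrr_continuous|exact: continuous_cos].
- split.
  + by move=> s _; exact: ex_derive.
  + by apply: cvg_at_right_filter; exact: cF.
  + by apply: cvg_at_left_filter; exact: cF.
- by move=> s _; rewrite derive1E; exact: derive_val.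
Qed.

Lemma fejer0 : 0 <= fejer 0.
Proof.
apply: Rintegral_ge0 => s; rewrite /= in_itv/= => /andP[s0 s1].
by rewrite mulr0 cos0 mulr1; lra.
Qed.

Lemma fejer_ge0 y : 0 <= fejer y.
Proof.
have [->|y0] := eqVneq y 0; first exact: fejer0.
by rewrite fejerE// divr_ge0 ?sqr_ge0// subr_ge0 cos_le1.
Qed.

Lemma fejer_le_cauchy y : fejer y <= 3 * (1 + y ^+ 2)^-1.
Proof.
have h0 := sqr_ge0 y; rewrite ler_pdivlMr ?ltr_wpDr// mulrDr mulr1.
have h1 := le_trans (ler_norm _) (fejer_le1 y).
suff : fejer y * y ^+ 2 <= 2 by lra.
have [->|y0] := eqVneq y 0; first by rewrite expr0n/= mulr0.
by rewrite fejerE// divfK ?expf_neq0//; have := cos_geN1 y; lra.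
Qed.

(** For |y| >= A the sum A^2 + y^2 is at most 2 y^2. The Cauchy form of the bound has the explicit
    integral pi / A, small for large A. *)
Lemma fejer_tail (A y : R) : 0 < A -> A <= `|y| ->
  fejer y <= 4 * (A ^+ 2 + y ^+ 2)^-1.
Proof.
move=> A0 Ay; have y0 : y != 0.
  by rewrite -normr_eq0 gt_eqF// (lt_le_trans A0).
have yA : A ^+ 2 <= y ^+ 2.
  by rewrite -(real_normK (num_real y)) lerXn2r ?nnegrE// ltW.
have A2 : 0 < A ^+ 2 by rewrite exprn_gt0.
rewrite ler_pdivlMr; last by lra.
rewrite fejerE// mulrAC ler_pdivrMr; last by lra.
rewrite (@le_trans _ _ (2 * (A ^+ 2 + y ^+ 2)))//.
  by rewrite ler_wpM2r//; have := cos_geN1 y; lra.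
by lra.
Qed.

Lemma fejer_integrableT : leb.-integrable setT (EFin \o fejer).
Proof.
apply/integrableP; split.
  by apply/measurable_EFinP; apply: continuous_measurable_fun; exact: fejer_continuous.
have hc : (\int[leb]_x (3 * (1 + x ^+ 2)^-1)%:E)%E = (3 * pi)%:E.
  under eq_integral do rewrite EFinM.
  rewrite ge0_integralZl//.
  - have := cauchy_integralT (@ltr01 R); rewrite expr1n divr1 => ->; by rewrite EFinM.
  - apply/measurable_EFinP; apply: continuous_measurable_fun => x.
    exact: (@continuous_oneDsqrV R x).
  - by move=> x _; rewrite lee_fin invr_ge0 addr_ge0 ?sqr_ge0.
apply: (@le_lt_trans _ _ (\int[leb]_x (3 * (1 + x ^+ 2)^-1)%:E)%E); last by rewrite hc ltry.
apply: ge0_le_integral => //.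
- apply/measurableT_comp => //; apply/measurable_EFinP.
  by apply: continuous_measurable_fun; exact: fejer_continuous.
- apply/measurable_EFinP; apply: continuous_measurable_fun => x.
  by apply: cvgM; [exact: cvg_cst|exact: (@continuous_oneDsqrV R x)].
- by move=> x _; rewrite lee_fin/= ger0_norm ?fejer_ge0// fejer_le_cauchy.
Qed.

(** For s and y in ]0, 1], cos(s y) >= 1/2, and 1 - s has integral 1/2. *)
Lemma fejer_ge_quarter y : D01 y -> 1 / 4 <= fejer y.
Proof.
rewrite /= in_itv/= => /andP[y0 y1].
apply: (@le_trans _ _ (\int[leb]_(s in D01) ((1 - s) * (1 / 2)))).
  have -> : \int[leb]_(s in D01) ((1 - s) * (1 / 2)) = 1 / 4.
    have h := fejer_integrable 0.
    have dF s : is_derive s 1 (fun s : R => s / 2 - s ^+ 2 / 4) ((1 - s) * (1 / 2)).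
      by apply: is_derive_eq; rewrite /GRing.scale/=; field.
    have cF : continuous (fun s : R => s / 2 - s ^+ 2 / 4).
      by move=> s; apply/differentiable_continuous/derivable1_diffP/ex_derive.
    have cf : continuous (fun s : R => (1 - s) * (1 / 2)).
      move=> s; apply: cvgM; last exact: cvg_cst.
      by apply: cvgB; [exact: cvg_cst|exact: cvg_id].
    rewrite /Rintegral integral_itv_obnd_cbnd; last first.
      by apply/measurable_EFinP; apply: measurable_funTS; exact: continuous_measurable_fun.
    rewrite (@continuous_FTC2 _ _ (fun s : R => s / 2 - s ^+ 2 / 4))//=.
    - by rewrite expr1n expr0n/= !mul0r subr0 subr0; field.
    - exact: continuous_subspaceT.
    - split.
      + by move=> s _; exact: ex_derive.
      + by apply: cvg_at_right_filter; exact: cF.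
      + by apply: cvg_at_left_filter; exact: cF.
    - by move=> s _; rewrite derive1E; exact: derive_val.
  by [].
apply: le_Rintegral => //.
- apply: (@bounded_integrable_D01 _ 1).
    by apply: measurable_funTS; apply: measurable_funM => //; apply: measurable_funB.
  move=> s /=; rewrite in_itv/= => /andP[s0 s1].
  by rewrite ler_norml; apply/andP; split; lra.
- exact: fejer_integrable.
move=> s /=; rewrite in_itv/= => /andP[s0 s1].
rewrite ler_wpM2l//; first by lra.
have sy : 0 <= s * y <= 1.
  apply/andP; split; first by apply: mulr_ge0; exact: ltW.
  by rewrite -[leRHS]mulr1; apply: ler_pM => //; exact: ltW.
have /andP[sy0 sy1] := sy.
have : (s * y) ^+ 2 <= 1 by rewrite expr_le1.
by have /andP[_] := one_sub_cos_bound (s * y); lra.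
Qed.

End fejer.

Section fejer_primitive.
Variable R : realType.
Implicit Types (x y z s t : R).
Notation leb := (@lebesgue_measure R).
Notation D01 := (`]0 : R, 1]%classic).

(** The primitive of [fejer] vanishing at 0, with integrand integrated in y; this form brings in
    characteristic functions. *)
Definition fejer_prim y : R := \int[leb]_(s in D01) ((1 - s) * (sin (s * y) / s)).

Lemma measurable_inv01 : measurable_fun D01 (fun s : R => s^-1).
Proof.
have h : measurable_fun (`]0 : R, +oo[%classic) (fun s : R => s^-1).
  apply: open_continuous_measurable_fun; first exact: interval_open.
  move=> s; rewrite inE/= in_itv/= andbT => s0.
  by apply: inv_continuous; rewrite gt_eqF.
apply: measurable_funS h => // s /=.
by rewrite !in_itv/= => /andP[->].
Qed.

Lemma measurable_sin_scale y : measurable_fun setT (fun s : R => sin (s * y)).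
Proof.
apply: continuous_measurable_fun => s; apply: continuous_comp.
  exact: mulrr_continuous.
exact: continuous_sin.
Qed.

Lemma measurable_fejer_prim_integrand y :
  measurable_fun D01 (fun s : R => (1 - s) * (sin (s * y) / s)).
Proof.
apply: measurable_funM; first by apply: measurable_funTS; apply: measurable_funB.
apply: measurable_funM; last exact: measurable_inv01.
by apply: measurable_funTS; exact: measurable_sin_scale.
Qed.

Lemma fejer_prim_integrand_le y s : D01 s ->
  `|(1 - s) * (sin (s * y) / s)| <= `|y|.
Proof.
rewrite /= in_itv/= => /andP[s0 s1]; rewrite normrM -[leRHS]mul1r ler_pM//.
  by rewrite ler_norml; apply/andP; split; lra.
rewrite normrM normfV (gtr0_norm s0) ler_pdivrMr//.
by rewrite (le_trans (normr_sin_le _))// normrM (gtr0_norm s0) mulrC.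
Qed.

Lemma fejer_prim_integrable y :
  leb.-integrable D01 (EFin \o (fun s : R => (1 - s) * (sin (s * y) / s))).
Proof.
apply: (@bounded_integrable_D01 _ _ `|y|).
  exact: measurable_fejer_prim_integrand.
by move=> s; exact: fejer_prim_integrand_le.
Qed.

Lemma fejer_prim0 : fejer_prim 0 = 0.
Proof.
rewrite /fejer_prim (@eq_Rintegral _ _ _ leb _ (fun=> 0)).
  by rewrite Rintegral_cst// mul0r.
by move=> s _; rewrite mulr0 sin0 mul0r mulr0.
Qed.

Lemma is_derive_fejer_prim y : is_derive y 1 fejer_prim (fejer y).
Proof.
pose f (y s : R) := (1 - s) * (sin (s * y) / s).
have df (u s : R) : D01 s -> is_derive u (1 : R) (f ^~ s) ((1 - s) * cos (s * u)).
  rewrite /= in_itv/= => /andP[s0 s1].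
  have dm : is_derive u 1 (fun u : R => s * u) s.
    by apply: is_derive_eq; rewrite /GRing.scale/=; ring.
  have ds : is_derive u 1 (fun u : R => sin (s * u)) (cos (s * u) * s).
    exact: (@is_derive1_comp _ sin (fun u => s * u) u _ _ (is_derive_sin (s * u)) dm).
  rewrite /f; apply: is_derive_eq; rewrite /GRing.scale/=; field.
  by rewrite gt_eqF.
have h1 u : `]y - 1, y + 1[%classic u -> leb.-integrable D01 (EFin \o f u).
  by move=> _; exact: fejer_prim_integrable.
have h2 u s : `]y - 1, y + 1[%classic u -> D01 s -> derivable (f ^~ s) u 1.
  by move=> _ Ds; have := df u s Ds => ?; exact: ex_derive.
have d1E u s : D01 s -> partial1of2 f u s = (1 - s) * cos (s * u).
  by move=> Ds; rewrite partial1of2E; have := df u s Ds => ?; exact: derive_val.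
have h3 u s : `]y - 1, y + 1[%classic u -> D01 s -> `|partial1of2 f u s| <= 1.
  by move=> _ Ds; rewrite d1E//; exact: fejer_integrand_le.
have iy : `]y - 1, y + 1[%classic y by rewrite /= in_itv/=; apply/andP; split; lra.
have i1 : leb.-integrable D01 (EFin \o (fun=> 1 : R)).
  by apply: (@bounded_integrable_D01 _ _ 1) => // s _; rewrite normr1.
have mD : measurable D01 by exact: measurable_itv.
have e1 := @derivable_under_integral R _ _ leb f D01 mD y _ _ iy h1 h2 (fun=> 1) (fun=> ler01) i1 h3.
have e2 := @differentiation_under_integral R _ _ leb f D01 mD y _ _ iy h1 h2 (fun=> 1) (fun=> ler01) i1 h3.
split; first exact: e1.
rewrite -derive1E; rewrite /fejer_prim -/f [LHS]e2.
by apply: eq_Rintegral => s; rewrite inE => Ds; rewrite d1E.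
Qed.

Definition fejer_cdf y : R := \int[leb]_(z in `]-oo, y]) fejer z.

Lemma is_derive_fejer_cdf y : is_derive y 1 fejer_cdf (fejer y).
Proof.
have yy : y < y + 1 by lra.
have fi : leb.-integrable [set` Interval -oo%O (BRight (y + 1))] (EFin \o @fejer R).
  by apply: integrableS (fejer_integrableT R) => //; exact: measurable_itv.
case: (@continuous_FTC1 R (@fejer R) -oo%O y (y + 1) yy fi _ (@fejer_continuous R y)) => [|d1 d2].
  by rewrite ltNyr.
by split; [exact: d1|rewrite -derive1E].
Qed.

(** Equal derivatives. The constant [fejer_cdf 0] cancels when two laws are compared. *)
Lemma fejer_cdfE y : fejer_cdf y = fejer_cdf 0 + fejer_prim y.
Proof.
have d z : is_derive z 1 (fun z => fejer_cdf z - fejer_prim z) 0.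
  have h1 := is_derive_fejer_cdf z; have h2 := is_derive_fejer_prim z.
  by apply: is_derive_eq; rewrite subrr.
have := is_derive_0_is_cst y 0 d; rewrite fejer_prim0 subr0 => <-.
by rewrite subrK.
Qed.

Lemma fejer_cdf_continuous : continuous fejer_cdf.
Proof.
move=> y; have := is_derive_fejer_cdf y => h.
exact/differentiable_continuous/derivable1_diffP/ex_derive.
Qed.

Lemma fejer_cdf_bounds y : 0 <= fejer_cdf y <= \int[leb]_z fejer z.
Proof.
apply/andP; split; first by apply: Rintegral_ge0 => z _; exact: fejer_ge0.
have fi : leb.-integrable setT (EFin \o @fejer R) := fejer_integrableT R.
apply: fine_le.
- by apply: integrable_fin_num => //; apply: integrableS fi => //; exact: measurable_itv.
- exact: integrable_fin_num.
apply: ge0_subset_integral => //.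
  by case/integrableP : fi.
by move=> z _; rewrite lee_fin fejer_ge0.
Qed.

Lemma bmeas_fejer_cdf d (T : measurableType d) (f : T -> R) :
  measurable_fun setT f -> bmeas (fun w => fejer_cdf (f w)).
Proof.
move=> mf; split.
  apply: measurableT_comp => //; apply: continuous_measurable_fun.
  exact: fejer_cdf_continuous.
exists (\int[leb]_z fejer z) => w.
by have /andP[h1 h2] := fejer_cdf_bounds (f w); rewrite ger0_norm.
Qed.

Lemma bmeas_fejer_prim d (T : measurableType d) (f : T -> R) :
  measurable_fun setT f -> bmeas (fun w => fejer_prim (f w)).
Proof.
move=> mf; rewrite (_ : (fun w => _) = (fun w => fejer_cdf (f w) - fejer_cdf 0)).
  by apply: bmeasB; [exact: bmeas_fejer_cdf|exact: bmeas_cst].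
by apply/funext => w; rewrite (fejer_cdfE (f w)) addrAC subrr add0r.
Qed.

End fejer_primitive.

(** * Smoothed distribution functions as sine transforms *)

Section smoothing.
Variable R : realType.
Notation leb := (@lebesgue_measure R).
Notation D01 := (`]0 : R, 1]%classic).
Context d (Omega : measurableType d) (P : probability Omega R).
Variable W : Omega -> R.
Hypothesis mW : measurable_fun setT W.
Hypothesis iW : P.-integrable setT (EFin \o W).
Let PT : P setT = 1%E. Proof. exact: probability_setT. Qed.

Definition cdf_of (x : R) : R := fine (P [set w | W w <= x]).

Lemma measurable_le_set x : measurable [set w | W w <= x].
Proof.
rewrite (_ : [set w | _] = setT `&` W @^-1` `]-oo, x]).
  by apply: mW => //; exact: measurable_itv.
by rewrite setTI; apply/seteqP; split => w /=; rewrite in_itv.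
Qed.

Lemma cdf_of_fin x : (cdf_of x)%:E = P [set w | W w <= x].
Proof. by rewrite /cdf_of fineK//; apply: fin_num_measure; exact: measurable_le_set. Qed.

Let A (x : R) : set (Omega * measurableTypeR R) := [set p | W p.1 + p.2 <= x].

Let mA x : measurable (A x).
Proof.
have mf : measurable_fun setT (fun p : Omega * measurableTypeR R => W p.1 + (p.2 : R)).
  by apply: measurable_funD; [exact: measurableT_comp|exact: measurable_snd].
rewrite (_ : A x = setT `&` (fun p : Omega * measurableTypeR R => W p.1 + (p.2 : R)) @^-1` `]-oo, x]).
  by apply: mf => //; exact: measurable_itv.
by rewrite setTI; apply/seteqP; split => w /=; rewrite in_itv.
Qed.

Let indA x (p : Omega * measurableTypeR R) : \bar R := (\1_(A x) p * fejer p.2)%:E.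

Let mindA x : measurable_fun setT (indA x).
Proof.
apply/measurable_EFinP; apply: measurable_funM; first exact: measurable_indic.
apply: measurableT_comp; last exact: measurable_snd.
by apply: continuous_measurable_fun; exact: fejer_continuous.
Qed.

Let indA0 x p : (0 <= indA x p)%E.
Proof. by rewrite lee_fin mulr_ge0// ?fejer_ge0// indicE. Qed.

Let indAG x z : (\int[P]_w indA x (w, z) = (cdf_of (x - z) * fejer z)%:E)%E.
Proof.
rewrite EFinM cdf_of_fin; under eq_integral do rewrite /indA EFinM/=.
rewrite ge0_integralZr//; last 2 first.
- apply/measurable_EFinP.
  rewrite (_ : (fun w => _) = \1_[set w | W w <= x - z]).
    by apply: measurable_indic; exact: measurable_le_set.
  by apply/funext => w; rewrite !indicE; congr (nat_of_bool _)%:R;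
     apply/idP/idP; rewrite !inE /A/= lerBrDr.
- by rewrite lee_fin fejer_ge0.
congr (_ * _)%E; apply/esym.
rewrite -[in LHS](setIT [set w | W w <= x - z]) -integral_indic//; last exact: measurable_le_set.
apply: eq_integral => w _; rewrite !indicE; congr (nat_of_bool _)%:R%:E.
by apply/idP/idP; rewrite !inE /A/= lerBrDr.
Qed.

Lemma cdf_fejer_integrable x :
  leb.-integrable setT (EFin \o (fun z => cdf_of (x - z) * fejer z)).
Proof.
apply: le_integrable (fejer_integrableT R) => //.
  rewrite (_ : EFin \o _ = fubini_G P (indA x)); last first.
    by apply/funext => z; rewrite /fubini_G indAG.
  by apply: measurable_fun_fubini_tonelli_G => //; exact: indA0.
move=> z _; rewrite /= lee_fin normrM (ger0_norm (fejer_ge0 z)) ler_piMl ?fejer_ge0//.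
rewrite ger0_norm; last by rewrite /cdf_of fine_ge0.
by rewrite -lee_fin cdf_of_fin; apply: probability_le1; exact: measurable_le_set.
Qed.

(** Tonelli for the indicator of W + z <= x weighted by the kernel. *)
Lemma cdf_fejer_conv x :
  \int[leb]_z (cdf_of (x - z) * fejer z) = \int[P]_w fejer_cdf (x - W w).
Proof.
congr fine.
transitivity (\int[leb]_z \int[P]_w indA x (w, z))%E.
  by apply: eq_integral => z _; rewrite indAG.
rewrite -(@fubini_tonelli _ _ _ _ _ P leb (indA x) (mindA x) (indA0 x)).
apply: eq_integral => w _.
rewrite /fejer_cdf /Rintegral fineK; last first.
  apply: integrable_fin_num; first exact: measurable_itv.
  by apply: integrableS (fejer_integrableT R) => //; exact: measurable_itv.
rewrite integral_mkcond; apply: eq_integral => z _.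
rewrite /indA patchE indicE.
have -> : (z \in `]-oo, x - W w]%classic) = ((w, z) \in A x).
  by apply/idP/idP; rewrite !inE /A/= in_itv/= lerBrDl.
by case: ifP => _; rewrite ?mul1r ?mul0r.
Qed.

Lemma exp_fejer_cdf x :
  \int[P]_w fejer_cdf (x - W w) = fejer_cdf 0 + \int[P]_w fejer_prim (x - W w).
Proof.
under eq_Rintegral do rewrite fejer_cdfE.
rewrite bmeas_RintegralD//; [|exact: bmeas_cst|].
  by rewrite Rintegral1_cst.
by apply: bmeas_fejer_prim; apply: measurable_funB.
Qed.

Definition sin_kernel x (s : R) : R :=
  (1 - s) / s * \int[P]_w sin (s * (x - W w)).

(** Fubini; it needs [W] integrable, because near s = 0 the factor 1 / s is compensated only through
    |sin(s y) / s| <= |y|. *)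
Lemma exp_fejer_prim x :
  leb.-integrable D01 (EFin \o sin_kernel x) /\
  \int[P]_w fejer_prim (x - W w) = \int[leb]_(s in D01) sin_kernel x s.
Proof.
pose k (s : R) : R := ((fun s => (1 - s) / s) \_ D01) s.
have mk : measurable_fun setT k.
  apply/(measurable_restrictT _ (measurable_itv _)).
  apply: measurable_funM; last exact: measurable_inv01.
  by apply: measurable_funTS; apply: measurable_funB.
pose f (p : Omega * measurableTypeR R) : \bar R := (k p.2 * sin (p.2 * (x - W p.1)))%:E.
have mxW : measurable_fun setT (fun w => x - W w) by apply: measurable_funB.
have mf : measurable_fun setT f.
  apply/measurable_EFinP; apply: measurable_funM.
    by apply: measurableT_comp => //; exact: measurable_snd.
  apply: measurableT_comp.
    by apply: continuous_measurable_fun; exact: continuous_sin.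
  apply: measurable_funM; first exact: measurable_snd.
  by apply: (measurableT_comp mxW); exact: measurable_fst.
have fE w : (\int[leb]_s f (w, s) = \int[leb]_(s in D01) ((1 - s) * (sin (s * (x - W w)) / s))%:E)%E.
  rewrite [RHS]integral_mkcond; apply: eq_integral => s _.
  rewrite /f /k !patchE/=; case: ifPn => // _; last by rewrite mul0r.
  by congr EFin; ring.
have kf s w : `|k s * sin (s * (x - W w))| <= \1_D01 s * `|x - W w|.
  rewrite /k patchE indicE; case: ifPn; last by rewrite !mul0r normr0.
  rewrite inE mul1r => Ds; have := fejer_prim_integrand_le (x - W w) Ds.
  by apply: le_trans; rewrite le_eqVlt; apply/orP; left; apply/eqP; congr `| _ |; ring.
have ixW : P.-integrable setT (EFin \o (fun w => x - W w)).
  rewrite (_ : EFin \o _ = (fun w => x%:E - (EFin \o W) w)%E) ; last by apply/funext.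
  apply: integrableB => //; apply: (bmeas_integrable PT); exact: bmeas_cst.
have fi : (P \x leb)%E.-integrable setT f.
  apply: (@integrable12ltyP _ _ _ _ _ P leb f mf).2.
  apply: (@le_lt_trans _ _ (\int[P]_w `|(x - W w)%:E|)%E); last first.
    by case/integrableP : ixW.
  apply: ge0_le_integral => //.
  - by move=> w _; apply: integral_ge0 => s _; exact: abse_ge0.
  - by apply: (measurable_fun_fubini_tonelli_F (abse \o f)) => //=; exact: measurableT_comp.
  - by apply: measurableT_comp => //; exact/measurable_EFinP.
  - move=> w _.
    have mi : measurable_fun setT
        (fun s : measurableTypeR R => (\1_D01 s)%:E * `|(x - W w)%:E|)%E.
      apply: emeasurable_funM; last exact: measurable_cst.
      by apply/measurable_EFinP; apply: measurable_indic; exact: measurable_itv.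
    apply: (@le_trans _ _ (\int[leb]_s ((\1_D01 s)%:E * `|(x - W w)%:E|)%E)%E).
      apply: ge0_le_integral => //.
      + apply: measurableT_comp => //; apply/measurable_EFinP; apply: measurable_funM => //.
        exact: (measurable_sin_scale (x - W w)).
      + by move=> s _; rewrite /f/= lee_fin kf.
    rewrite ge0_integralZr//; last first.
      by apply/measurable_EFinP; apply: measurable_indic; exact: measurable_itv.
    rewrite integral_indic//.
    by rewrite setIT [X in (X * _)%E]leb_D01 mul1e.
have kE s : D01 s -> k s = (1 - s) / s by move=> Ds; rewrite /k patchE mem_set.
have bsin s : bmeas (fun w => sin (s * (x - W w))).
  split; last by exists 1 => w; rewrite ler_norml sin_geN1 sin_le1.
  apply: measurableT_comp.
    by apply: continuous_measurable_fun; exact: continuous_sin.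
  by apply: measurable_funM.
have GE s : (\int[P]_w f (w, s))%E = (k s * \int[P]_w sin (s * (x - W w)))%:E.
  rewrite -bmeas_RintegralZ// /Rintegral fineK//.
  exact: integrable_fin_num (bmeas_integrable PT (bmeasZ _ (bsin s))).
have mG : measurable_fun D01 (sin_kernel x).
  apply/measurable_EFinP.
  have := measurable_fubini_G fi => /(measurable_funS measurableT (@subsetT _ D01)).
  apply: eq_measurable_fun => s; rewrite inE => Ds.
  by rewrite /fubini_G GE kE.
have sk s : D01 s -> `|sin_kernel x s| <= \int[P]_w `|x - W w|.
  move=> Ds; rewrite /sin_kernel -kE// -bmeas_RintegralZ//.
  rewrite (le_trans (le_normr_Rintegral _ (bmeas_integrable PT (bmeasZ _ (bsin s)))))//.
  apply: le_Rintegral => //.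
  - have h := bmeas_integrable PT (bmeasZ (k s) (bsin s)).
    exact: integrable_norm h.
  - exact: integrable_norm ixW.
  - move=> w _; rewrite (le_trans (kf s w))//.
    by rewrite indicE mem_set// mul1r.
split; first exact: bounded_integrable_D01 mG sk.
rewrite /Rintegral; congr fine.
transitivity (\int[P]_w \int[leb]_s f (w, s))%E.
  apply: eq_integral => w _; rewrite fE /fejer_prim /Rintegral fineK//.
  apply: integrable_fin_num; first exact: measurable_itv.
  exact: fejer_prim_integrable.
rewrite (Fubini fi) [RHS]integral_mkcond; apply: eq_integral => s _.
rewrite GE patchE; case: ifPn => Ds; first by rewrite kE// -inE.
by rewrite /k patchE (negbTE Ds) mul0r.
Qed.

End smoothing.

Section real_integrable.
Context d (T : measurableType d) (R : realType).
Variables (mu : {measure set T -> \bar R}) (D : set T).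
Hypothesis mD : measurable D.

Lemma integrable_subr (f g : T -> R) : mu.-integrable D (EFin \o f) ->
  mu.-integrable D (EFin \o g) -> mu.-integrable D (EFin \o (fun x => f x - g x)).
Proof. by move=> fi gi; have := integrableB mD fi gi; apply. Qed.

Lemma integrable_scaler (c : R) (f : T -> R) : mu.-integrable D (EFin \o f) ->
  mu.-integrable D (EFin \o (fun x => c * f x)).
Proof. by move=> fi; have := integrableZl mD c fi; apply. Qed.

End real_integrable.

Section smoothing_core.
Variable R : realType.
Notation leb := (@lebesgue_measure R).
Notation D01 := (`]0 : R, 1]%classic).

Lemma cauchy_integrable (A : R) : 0 < A ->
  leb.-integrable setT (EFin \o (fun x : R => (A ^+ 2 + x ^+ 2)^-1)).
Proof.
move=> A0; apply/integrableP; split.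
  apply/measurable_EFinP; apply: continuous_measurable_fun => x.
  apply: cvgV; first by rewrite gt_eqF// ltr_wpDr ?sqr_ge0// exprn_gt0.
  by apply: cvgD; [exact: cvg_cst|exact: exprn_continuous].
under eq_integral.
  move=> x _; rewrite /= ger0_norm; last by rewrite invr_ge0 addr_ge0 ?sqr_ge0.
  over.
by rewrite cauchy_integralT// ltry.
Qed.

(* The bulk of the mass of the Fejer kernel, near 0, sees the large value [p];
   its tail is controlled by the a priori bound [eta], with a factor < 1. *)
Lemma smoothing_core (D : R -> R) (p eta B : R) :
  leb.-integrable setT (EFin \o (fun z => D z * fejer z)) ->
  0 <= p -> 0 <= eta -> (forall z, - eta <= D z) ->
  (forall z, `|z| <= 128 -> p <= D z) ->
  \int[leb]_z (D z * fejer z) <= B -> p <= 4 * B + eta / 2.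
Proof.
move=> Di p0 eta0 De Dp DB.
have A0 : 0 < 128 :> R by [].
pose c (z : R) := 4 * eta * ((128 : R) ^+ 2 + z ^+ 2)^-1.
have ic : leb.-integrable setT (EFin \o c).
  by apply: integrable_scaler => //; exact: cauchy_integrable.
have i1 : leb.-integrable setT (EFin \o (fun z => p / 4 * \1_D01 z)).
  have ii : leb.-integrable setT (EFin \o (\1_D01 : R -> R)).
    by have := integrable_indic_itv (0 : R) 1 false false; apply.
  exact: (integrable_scaler measurableT (p / 4) ii).
have h : \int[leb]_z (p / 4 * \1_D01 z) - \int[leb]_z c z <= B.
  apply: le_trans DB; rewrite -RintegralB//; apply: le_Rintegral => //.
    exact: integrable_subr.
  move=> z _.
  have c0 : 0 <= c z by rewrite mulr_ge0 ?mulr_ge0// invr_ge0 addr_ge0 ?sqr_ge0.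
  (* Near 0 the value [p] is seen, and on ]0, 1] the kernel is at least 1/4; in the tail only D >=
     -eta is known, and [c] dominates the loss. *)
  have [zA|Az] := leP `|z| 128.
    rewrite (@le_trans _ _ (p / 4 * \1_D01 z))//; first by lra.
    have pf : p * fejer z <= D z * fejer z by rewrite ler_wpM2r ?fejer_ge0 ?Dp.
    apply: le_trans pf; rewrite indicE; have [|_] := boolP (z \in D01).
      by rewrite inE => zD; rewrite mulr1 ler_wpM2l// -div1r fejer_ge_quarter.
    by rewrite mulr0 mulr_ge0 ?fejer_ge0.
  have -> : \1_D01 z = 0 :> R.
    rewrite indicE; have [|//] := boolP (z \in D01); rewrite inE/= in_itv/= => /andP[z0 z1].
    by move: Az; rewrite gtr0_norm//; lra.
  rewrite mulr0 sub0r (@le_trans _ _ (- eta * fejer z))//; last first.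
    by rewrite ler_wpM2r ?fejer_ge0.
  have := ler_wpM2l eta0 (fejer_tail A0 (ltW Az)).
  by rewrite /c; lra.
have e1 : \int[leb]_z (p / 4 * \1_D01 z) = p / 4.
  rewrite RintegralZl//; last first.
    by have := integrable_indic_itv (0 : R) 1 false false; apply.
  by rewrite /Rintegral integral_indic// setIT [X in fine X]leb_D01 mulr1.
have e2 : \int[leb]_z c z = 4 * eta * (pi / 128).
  rewrite /c RintegralZl//; last exact: cauchy_integrable.
  by rewrite /Rintegral cauchy_integralT.
rewrite e1 e2 in h.
(* The loss 4 eta pi / 128 is then at most eta / 8; multiplying p / 4 <= B + eta / 8 by 4 leaves eta
   / 2. *)
have pi4 : pi <= 4 :> R by have := @pihalf_02 R; lra.
have := ler_wpM2l eta0 pi4; lra.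
Qed.

End smoothing_core.

(** * Esseen's inequality with frequencies scaled to ]0, 1] *)

Section esseen.
Variable R : realType.
Notation leb := (@lebesgue_measure R).
Notation D01 := (`]0 : R, 1]%classic).
Context d1 (O1 : measurableType d1) (P1 : probability O1 R) (W1 : O1 -> R).
Context d2 (O2 : measurableType d2) (P2 : probability O2 R) (W2 : O2 -> R).
Hypotheses (mW1 : measurable_fun setT W1) (iW1 : P1.-integrable setT (EFin \o W1)).
Hypotheses (mW2 : measurable_fun setT W2) (iW2 : P2.-integrable setT (EFin \o W2)).
Variables (M B : R) (h : R -> R).
Hypothesis lip : forall x y, x <= y ->
  cdf_of P2 W2 y - cdf_of P2 W2 x <= M * (y - x).
Hypothesis char_le : forall s, D01 s ->
  `|\int[P1]_w cos (s * W1 w) - \int[P2]_w cos (s * W2 w)| +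
  `|\int[P1]_w sin (s * W1 w) - \int[P2]_w sin (s * W2 w)| <= s * h s.
Hypothesis ih : leb.-integrable D01 (EFin \o h).
Hypothesis hB : \int[leb]_(s in D01) h s <= B.

Let F1 := cdf_of P1 W1.
Let F2 := cdf_of P2 W2.

Lemma cdf_of_bounds d (O : measurableType d) (P : probability O R) (W : O -> R) x :
  measurable_fun setT W -> 0 <= cdf_of P W x <= 1.
Proof.
move=> mW; apply/andP; split; first by rewrite /cdf_of fine_ge0.
by rewrite -lee_fin cdf_of_fin//; apply: probability_le1; exact: measurable_le_set.
Qed.

Lemma cdf_of_nd d (O : measurableType d) (P : probability O R) (W : O -> R) x y :
  measurable_fun setT W -> x <= y -> cdf_of P W x <= cdf_of P W y.
Proof.
move=> mW xy; rewrite -lee_fin !cdf_of_fin//; apply: le_measure.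
- by rewrite inE; exact: measurable_le_set.
- by rewrite inE; exact: measurable_le_set.
- by move=> w /= /le_trans; apply.
Qed.

Lemma bmeas_trig d (O : measurableType d) (W : O -> R) s : measurable_fun setT W ->
  bmeas (fun w => cos (s * W w)) /\ bmeas (fun w => sin (s * W w)).
Proof.
move=> mW; have mm : measurable_fun setT (fun w => s * W w) by apply: measurable_funM.
have := cbm_expi mm; by case.
Qed.

Lemma exp_sin_shift d (O : measurableType d) (P : probability O R) (W : O -> R) s x :
  measurable_fun setT W ->
  \int[P]_w sin (s * (x - W w)) =
  sin (s * x) * \int[P]_w cos (s * W w) - cos (s * x) * \int[P]_w sin (s * W w).
Proof.
move=> mW; have [b1 b2] := bmeas_trig s mW.
have PT := @probability_setT _ _ _ P.
rewrite -!bmeas_RintegralZ// -bmeas_RintegralB//; [|exact: bmeasZ..].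
by apply: eq_Rintegral => w _; rewrite mulrBr sinB.
Qed.

(** The difference of the two sine transforms is at most s h(s), which removes the singular factor
    (1 - s) / s. *)
Let conv_bound x : `|\int[leb]_z ((F1 (x - z) - F2 (x - z)) * fejer z)| <= B.
Proof.
have i1 := cdf_fejer_integrable P1 mW1 x; have i2 := cdf_fejer_integrable P2 mW2 x.
have -> : \int[leb]_z ((F1 (x - z) - F2 (x - z)) * fejer z) =
    \int[leb]_z (F1 (x - z) * fejer z) - \int[leb]_z (F2 (x - z) * fejer z).
  by rewrite -RintegralB//; apply: eq_Rintegral => z _; rewrite mulrBl.
rewrite (cdf_fejer_conv P1 mW1 x) (cdf_fejer_conv P2 mW2 x).
rewrite (exp_fejer_cdf P1 mW1 x) (exp_fejer_cdf P2 mW2 x).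
rewrite [X in `|X|](_ : _ = \int[P1]_w fejer_prim (x - W1 w) -
  \int[P2]_w fejer_prim (x - W2 w)); last by ring.
have [k1 ->] := exp_fejer_prim mW1 iW1 x.
have [k2 ->] := exp_fejer_prim mW2 iW2 x.
rewrite -RintegralB//.
have k12 : leb.-integrable D01 (EFin \o (fun s => sin_kernel P1 W1 x s - sin_kernel P2 W2 x s)).
  exact: integrable_subr.
rewrite (le_trans (le_normr_Rintegral _ k12))//.
apply: le_trans hB; apply: le_Rintegral => //; first exact: integrable_norm k12.
move=> s Ds; have := Ds; rewrite /= in_itv/= => /andP[s0 s1].
rewrite /sin_kernel -mulrBr !exp_sin_shift//.
set c1 := \int[P1]_w cos _; set c2 := \int[P2]_w cos _.
set e1 := \int[P1]_w sin _; set e2 := \int[P2]_w sin _.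
rewrite [X in _ * X](_ : _ = sin (s * x) * (c1 - c2) - cos (s * x) * (e1 - e2)); last by ring.
have hs : `|sin (s * x) * (c1 - c2) - cos (s * x) * (e1 - e2)| <= s * h s.
  apply: le_trans (char_le Ds); rewrite (le_trans (ler_normB _ _))// !normrM.
  rewrite lerD// -[leRHS]mul1r ler_wpM2r//.
    by rewrite ler_norml sin_geN1 sin_le1.
  by rewrite ler_norml cos_geN1 cos_le1.
have hs0 : 0 <= s * h s by rewrite (le_trans _ hs).
rewrite normrM (@le_trans _ _ (s^-1 * (s * h s)))//; last by rewrite mulKf// gt_eqF.
rewrite ler_pM// normrM normfV (gtr0_norm s0) ler_piMl ?invr_ge0 ?ltW//.
by rewrite ger0_norm; lra.
Qed.

Let B0 : 0 <= B. Proof. exact: le_trans (conv_bound 0). Qed.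
Let M0 : 0 <= M.
Proof.
have := lip (@ler01 R); rewrite subr0 mulr1; apply: le_trans.
by rewrite subr_ge0; apply: cdf_of_nd.
Qed.

Let diff_integrable x : leb.-integrable setT
  (EFin \o (fun z => (F1 (x - z) - F2 (x - z)) * fejer z)).
Proof.
have := integrable_subr measurableT (cdf_fejer_integrable P1 mW1 x) (cdf_fejer_integrable P2 mW2 x).
by apply: eq_integrable => // z _ /=; rewrite -mulrBl.
Qed.

(* As F1 is nondecreasing and F2 is M-Lipschitz, F1 - F2 stays above
   F1 y - F2 y - 256 M on [y, y + 256], hence the smoothing at y + 128; the error
   half of the supremum of |F1 - F2| is absorbed in the left-hand side. *)
Lemma esseen_unit x : `|cdf_of P1 W1 x - cdf_of P2 W2 x| <= 512 * M + 8 * B.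
Proof.
pose S := [set `|F1 y - F2 y| | y in [set: R]].
have S1 : ubound S 1.
  move=> _ [y _ <-]; have /andP[a1 a2] := cdf_of_bounds P1 y mW1.
  have /andP[a3 a4] := cdf_of_bounds P2 y mW2.
  by rewrite ler_norml /F1 /F2; apply/andP; split; lra.
have hS : has_sup S by split; [exists `|F1 0 - F2 0|, 0|exists 1].
have leS y : `|F1 y - F2 y| <= sup S by apply: sup_upper_bound => //; exists y.
have b0 := B0; have m0 := M0.
have S0 : 0 <= sup S by rewrite (le_trans _ (leS 0)).
suff step y : `|F1 y - F2 y| <= 256 * M + 4 * B + sup S / 2.
  have : sup S <= 256 * M + 4 * B + sup S / 2.
    by apply: ge_sup; [exact: hS.1|move=> _ [y _ <-]].
  by move=> ?; have := leS x; rewrite /F1 /F2; lra.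
have Mz (z : R) : `|z| <= 128 -> M * (128 - z) <= 256 * M /\ M * (128 + z) <= 256 * M.
  by rewrite ler_norml => /andP[z1 z2]; split; rewrite (mulrC 256) ler_wpM2l//; lra.
have up : F1 y - F2 y <= 256 * M + 4 * B + sup S / 2.
  (* [smoothing_core] requires p >= 0; otherwise the bound is immediate. *)
  have [p0|] := leP 0 (F1 y - F2 y - 256 * M); last by lra.
  suff : F1 y - F2 y - 256 * M <= 4 * B + sup S / 2 by lra.
  apply: (smoothing_core (diff_integrable (y + 128)) p0 S0).
  - by move=> z; have := leS (y + 128 - z); rewrite ler_norml => /andP[].
  - move=> z z128; have [z1 z2] := Mz z z128.
    move: z128; rewrite ler_norml => /andP[za zb].
    have := cdf_of_nd P1 mW1 (_ : y <= y + 128 - z).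
    have -> : y <= y + 128 - z by lra.
    move=> /(_ isT) h1; have := lip (_ : y <= y + 128 - z).
    have -> : y <= y + 128 - z by lra.
    move=> /(_ isT); have -> : y + 128 - z - y = 128 - z by ring.
    by rewrite /F1 /F2; lra.
  - by rewrite (le_trans (ler_norm _))// conv_bound.
(* The mirror case: F2 - F1 persists to the left of [y], hence smoothing at y - 128. *)
have lo : - (F1 y - F2 y) <= 256 * M + 4 * B + sup S / 2.
  have [p0|] := leP 0 (- (F1 y - F2 y) - 256 * M); last by lra.
  suff : - (F1 y - F2 y) - 256 * M <= 4 * B + sup S / 2 by lra.
  apply: (@smoothing_core _ (fun z => - (F1 (y - 128 - z) - F2 (y - 128 - z))) _ (sup S) B) => //.
  - have := integrable_scaler measurableT (-1) (diff_integrable (y - 128)).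
    by apply: eq_integrable => // z _ /=; rewrite mulN1r mulNr.
  - by move=> z; rewrite lerN2; have := leS (y - 128 - z); rewrite ler_norml => /andP[].
  - move=> z z128; have [z1 z2] := Mz z z128.
    move: z128; rewrite ler_norml => /andP[za zb].
    have := cdf_of_nd P1 mW1 (_ : y - 128 - z <= y).
    have -> : y - 128 - z <= y by lra.
    move=> /(_ isT) h1; have := lip (_ : y - 128 - z <= y).
    have -> : y - 128 - z <= y by lra.
    move=> /(_ isT); have -> : y - (y - 128 - z) = 128 + z by ring.
    by rewrite /F1 /F2; lra.
  - under eq_Rintegral do rewrite mulNr -mulN1r.
    rewrite RintegralZl//.
    by rewrite mulN1r (le_trans (ler_norm _))// normrN conv_bound.
by rewrite ler_norml; apply/andP; split; lra.
Qed.

End esseen.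

(** * The standard Gaussian law *)

Import HBNNSimple.
Section gaussian.
Variable R : realType.
Notation leb := (@lebesgue_measure R).
Implicit Types (x y t c : R).
Notation N01 := (@normal_prob R 0 1).

Definition gpdf x : R := (Num.sqrt (2 * pi))^-1 * expR (- x ^+ 2 / 2).

Lemma normal_pdfE01 x : normal_pdf 0 1 x = gpdf x.
Proof.
rewrite normal_pdfE ?oner_neq0// /normal_peak /normal_fun /gpdf.
by rewrite !expr1n mul1r subr0 mulr_natl.
Qed.

Lemma sqrt2pi_ge1 : 1 <= Num.sqrt (2 * pi) :> R.
Proof.
rewrite -[leLHS]sqrtr1 ler_wsqrtr//; have := pi_ge2 R; lra.
Qed.

Lemma gpdf_ge0 x : 0 <= gpdf x.
Proof. by rewrite mulr_ge0 ?expR_ge0// invr_ge0 sqrtr_ge0. Qed.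

Lemma gpdf_le_exp x : gpdf x <= expR (- x ^+ 2 / 2).
Proof.
rewrite ler_piMl ?expR_ge0// invf_le1 ?sqrt2pi_ge1//.
exact: lt_le_trans sqrt2pi_ge1.
Qed.

Lemma gpdf_le1 x : gpdf x <= 1.
Proof.
rewrite (le_trans (gpdf_le_exp x))// -[leRHS]expR0 ler_expR.
by have := sqr_ge0 x; lra.
Qed.

(** With u = x^2 / 4, exp(-x^2 / 2) = exp(u)^(-2) <= (1 + u)^(-2). One Cauchy majorant serves both
    for integrability up to a factor |x| and for decay at infinity. *)
Lemma gpdf_decay x : (1 + `|x|) * gpdf x <= 32 * (1 ^+ 2 + x ^+ 2)^-1.
Proof.
have x2 := sqr_ge0 x; rewrite expr1n.
rewrite ler_pdivlMr; last by lra.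
pose u := x ^+ 2 / 4; have u0 : 0 <= u by rewrite divr_ge0.
have eE : expR (- x ^+ 2 / 2) = (expR u ^+ 2)^-1.
  by rewrite -expRM_natl -expRN; congr expR; rewrite /u; field.
have e1 : 1 + u <= expR u := expR_ge1Dx u.
have e2 : (1 + u) ^+ 2 <= expR u ^+ 2 by rewrite lerXn2r ?nnegrE ?expR_ge0// addr_ge0.
have y0 := normr_ge0 x; set y := `|x| in y0 *.
have yx : y ^+ 2 = x ^+ 2 by rewrite /y real_normK ?num_real.
have key : (1 + y) * (1 + x ^+ 2) <= 32 * (1 + u) ^+ 2.
  have -> : (1 + u) ^+ 2 = 1 + y ^+ 2 / 2 + y ^+ 4 / 16.
    by rewrite /u -yx; field.
  rewrite -yx; have := sqr_ge0 (y - 1); have := sqr_ge0 (y ^+ 2 - y); nra.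
have p0 : 0 < expR u ^+ 2 by rewrite exprn_gt0 ?expR_gt0.
rewrite mulrAC (@le_trans _ _ ((1 + y) * (1 + x ^+ 2) * (expR u ^+ 2)^-1))//.
  rewrite ler_wpM2l ?mulr_ge0 ?addr_ge0//.
  by rewrite -eE gpdf_le_exp.
by rewrite ler_pdivrMr// (le_trans key)// ler_wpM2l.
Qed.

Lemma gpdf_continuous : continuous gpdf.
Proof.
move=> x; apply: cvgM; first exact: cvg_cst.
apply: continuous_comp; last exact: continuous_expR.
by apply: cvgM; [apply: cvgN; exact: exprn_continuous|exact: cvg_cst].
Qed.

Lemma measurable_gpdf : measurable_fun setT gpdf.
Proof. exact: continuous_measurable_fun gpdf_continuous. Qed.

Lemma gdecay_integrable (f : R -> R) : measurable_fun setT f ->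
  (forall x, `|f x| <= (1 + `|x|) * gpdf x) -> leb.-integrable setT (EFin \o f).
Proof.
move=> mf fb.
have ic := integrable_scaler measurableT 32 (cauchy_integrable (@ltr01 R)).
apply: le_integrable ic => //; first exact/measurable_EFinP.
move=> x _; rewrite /= lee_fin (le_trans (fb x))// (le_trans (gpdf_decay x))//.
exact: ler_norm.
Qed.

Lemma gpdf_integrable : leb.-integrable setT (EFin \o gpdf).
Proof.
apply: gdecay_integrable; first exact: measurable_gpdf.
by move=> x; rewrite ger0_norm ?gpdf_ge0// ler_peMl ?gpdf_ge0// lerDl.
Qed.

Lemma integral_gpdf : \int[leb]_x gpdf x = 1.
Proof.
have := integral_normal_pdf (0 : R) 1 => /(congr1 fine) /= <-.
by congr fine; apply: eq_integral => x _; rewrite normal_pdfE01.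
Qed.

Lemma normal_probE (A : set R) : measurable A ->
  (N01 A = \int[leb]_(x in A) (gpdf x)%:E)%E.
Proof. by move=> mA; apply: eq_integral => x _; rewrite normal_pdfE01. Qed.

Lemma gauss_cdfE t : gauss_cdf t = fine (N01 `]-oo, t]).
Proof.
rewrite normal_probE// /gauss_cdf -RintegralZl//.
have h : leb.-integrable `]-oo, t] (EFin \o (fun x => Num.sqrt (2 * pi) * gpdf x)).
  by apply: integrableS (integrable_scaler measurableT _ gpdf_integrable).
move: h; apply: eq_integrable => // x _ /=; rewrite /gpdf mulVKf// gt_eqF//.
exact: lt_le_trans sqrt2pi_ge1.
Qed.

Lemma bmeas_gpdf_integrable (f : R -> R) : bmeas f ->
  leb.-integrable setT (EFin \o (fun x => f x * gpdf x)).
Proof.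
move=> [mf [M fM]].
have ic := integrable_scaler measurableT M gpdf_integrable.
apply: le_integrable ic => //.
  by apply/measurable_EFinP; apply: measurable_funM => //; exact: measurable_gpdf.
move=> x _; rewrite /= lee_fin !normrM ler_wpM2r//.
by rewrite (le_trans (fM x))// ler_norm.
Qed.

(** The two sides agree on indicators by definition of the normal law, hence on bounded
    functions. *)
Lemma normal_Rintegral (f : R -> R) : bmeas f ->
  \int[N01]_x f x = \int[leb]_x (f x * gpdf x).
Proof.
move=> bf; apply/subr0_eq.
have PT : N01 setT = 1%E := @probability_setT _ _ _ N01.
pose L (f : R -> R) := \int[N01]_x f x - \int[leb]_x (f x * gpdf x).
apply: (@bounded_functional_eq0 _ (measurableTypeR R) _ L _ _ 2) => //.
- move=> f1 f2 b1 b2; rewrite /L bmeas_RintegralD//.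
  under [X in _ - X]eq_Rintegral do rewrite mulrDl.
  by rewrite RintegralD//; [ring|exact: bmeas_gpdf_integrable..].
- move=> c f1 b1; rewrite /L bmeas_RintegralZ//.
  under [X in _ - X]eq_Rintegral do rewrite -mulrA.
  by rewrite RintegralZl//; [ring|exact: bmeas_gpdf_integrable].
- move=> f1 e b1 f1e; rewrite /L (le_trans (ler_normB _ _))// mulrDl mul1r lerD//.
    exact: bmeas_Rintegral_norm_le.
  rewrite (le_trans (le_normr_Rintegral _ (bmeas_gpdf_integrable b1)))//.
  rewrite -[leRHS]mulr1 -integral_gpdf -RintegralZl//; last exact: gpdf_integrable.
  apply: le_Rintegral => //.
  + exact: integrable_norm (bmeas_gpdf_integrable b1).
  + exact: integrable_scaler gpdf_integrable.
  + by move=> x _; rewrite normrM (ger0_norm (gpdf_ge0 x)) ler_wpM2r ?gpdf_ge0.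
- move=> A mA; rewrite /L /Rintegral integral_indic// setIT.
  apply/eqP; rewrite subr_eq0; apply/eqP; congr fine.
  rewrite [LHS](normal_probE mA).
  rewrite [LHS]integral_mkcond; apply: eq_integral => x _; rewrite patchE indicE.
  by case: ifPn => _; rewrite ?mul1r ?mul0r.
Qed.

Lemma normal_id_integrable : N01.-integrable setT (EFin \o (fun x => x)).
Proof.
apply/integrableP; split; first exact/measurable_EFinP.
have ig : leb.-integrable setT (EFin \o (fun x => `|x| * gpdf x)).
  apply: gdecay_integrable.
    by apply: measurable_funM; [apply: continuous_measurable_fun; exact: norm_continuous|exact: measurable_gpdf].
  move=> x; rewrite normrM normr_id (ger0_norm (gpdf_ge0 x)).
  by rewrite ler_wpM2r ?gpdf_ge0// lerDr.
have iE : (\int[leb]_x (`|x| * gpdf x)%:E = (\int[leb]_x (`|x| * gpdf x))%:E)%E.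
  by rewrite /Rintegral fineK//; exact: integrable_fin_num.
apply: (@le_lt_trans _ _ (\int[leb]_x (`|x| * gpdf x))%:E%E); last by rewrite ltry.
(* The function |x| is unbounded, so [normal_Rintegral] is applied to the simple functions below
   it. *)
rewrite ge0_integralTE//; apply: ge_ereal_sup => _ [h hx <-].
rewrite -integralT_nnsfun.
have bh : bmeas (HBNNSimple.NonNegSimpleFun.sort h).
  split=> //; have [M [_ hM]] := simple_bounded h.
  by exists (M + 1) => x; apply: hM => //; rewrite ltrDl.
have PT : N01 setT = 1%E := @probability_setT _ _ _ N01.
have -> : (\int[N01]_x (h x)%:E = (\int[N01]_x h x)%:E)%E.
  by rewrite /Rintegral fineK//; exact: integrable_fin_num (bmeas_integrable PT bh).
rewrite lee_fin normal_Rintegral//; apply: le_Rintegral => //.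
  exact: bmeas_gpdf_integrable.
move=> x _; rewrite ler_wpM2r ?gpdf_ge0//.
by have := hx x; rewrite lee_fin.
Qed.

(** The integral over [-n, n] is f(n) - f(-n), which tends to 0, while dominated convergence gives
    the full integral. *)
Lemma total_derivative_Rintegral (f f' : R -> R) :
  (forall x, is_derive x 1 f (f' x)) -> continuous f' ->
  leb.-integrable setT (EFin \o f') ->
  (forall x, `|f x| <= 32 * (1 ^+ 2 + x ^+ 2)^-1) ->
  \int[leb]_x f' x = 0.
Proof.
move=> df cf' if' fb.
pose D (n : nat) : set R := `[- n%:R, n%:R]%classic.
pose a n := \int[leb]_(x in D n) f' x.
have mf' : measurable_fun setT f' by exact: continuous_measurable_fun.
have aE n : a n = f n%:R - f (- n%:R).
  case: n => [|n]; first by rewrite /a /D oppr0 set_itv1 Rintegral_set1 subrr.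
  have nn : - n.+1%:R < n.+1%:R :> R by rewrite -subr_gt0 opprK addr_gt0.
  have cf : continuous f.
    by move=> x; have := df x => ?; apply/differentiable_continuous/derivable1_diffP/ex_derive.
  rewrite /a /Rintegral (@continuous_FTC2 _ f' f)//.
  - exact: continuous_subspaceT.
  - split.
    + by move=> x _; have := df x => ?; exact: ex_derive.
    + by apply: cvg_at_right_filter; exact: cf.
    + by apply: cvg_at_left_filter; exact: cf.
  - by move=> x _; have := df x => ?; rewrite derive1E; exact: derive_val.
have a0 : a n @[n --> \oo] --> 0.
  apply: norm_cvg0; have h0 : (fun n => 64 * harmonic n) @ \oo --> (0 : R).
    rewrite -[X in _ --> X](mulr0 64); apply: cvgM; first exact: cvg_cst.
    exact: cvg_harmonic.
  apply: (squeeze_cvgr _ (cvg_cst 0) h0); apply: nearW => n.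
  rewrite normr_ge0/=; case: n => [|n].
    by rewrite aE oppr0 subrr normr0 mulr_ge0// /harmonic invr_ge0.
  rewrite aE (le_trans (ler_normB _ _))//.
  have h1 := fb n.+1%:R; have h2 := fb (- n.+1%:R); rewrite sqrrN in h2.
  have h3 : (1 ^+ 2 + n.+1%:R ^+ 2)^-1 <= n.+2%:R^-1 :> R.
    have n1 : (1 : R) <= n.+1%:R by rewrite ler1n.
    rewrite expr1n lef_pV2 ?posrE ?ltr0n//.
      rewrite -[n.+2%:R]natr1 addrC lerD2l expr2 ler_peMl//.
  rewrite -[X in _ <= X]/(64 * n.+2%:R^-1).
  by move: (n.+2%:R^-1) (_^-1) h1 h2 h3 => p q; lra.
have a1 : a n @[n --> \oo] --> \int[leb]_x f' x.
  pose fn n x := (f' x * \1_(D n) x)%:E.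
  have aI n : (\int[leb]_x fn n x = (a n)%:E)%E.
    rewrite /a /Rintegral fineK; last first.
      apply: integrable_fin_num; first exact: measurable_itv.
      by apply: integrableS if' => //; exact: measurable_itv.
    rewrite [RHS]integral_mkcond; apply: eq_integral => x _.
    by rewrite /fn patchE indicE; case: ifPn; rewrite ?mulr1 ?mulr0.
  have [] := @dominated_convergence _ _ _ leb setT measurableT fn (EFin \o f') (EFin \o (fun x => `|f' x|)).
  - by move=> n; apply/measurable_EFinP; apply: measurable_funM => //; apply: measurable_indic; exact: measurable_itv.
  - exact/measurable_EFinP.
  - apply: aeW => x _; apply: cvg_near_cst; near=> n.
    rewrite /fn indicE mem_set ?mulr1// /D/= in_itv/= -ler_norml.
    near: n; exact: nbhs_infty_ger.
  - exact: integrable_norm if'.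
  - apply: aeW => x n _; rewrite /fn lee_fin normrM ler_piMr// indicE.
    by case: (_ \in _); rewrite ?normr1 ?normr0.
  move=> _ _ cv; rewrite /Rintegral; apply: fine_cvg; rewrite fineK; last exact: integrable_fin_num.
  have -> : (fun n => \int[leb]_(x in D n) (f' x)%:E)%E = (fun n => \int[leb]_x fn n x)%E.
    apply/funext => n; rewrite aI /a /Rintegral fineK//.
    apply: integrable_fin_num; first exact: measurable_itv.
    by apply: integrableS if' => //; exact: measurable_itv.
  exact: cv.
exact: (cvg_unique _ a1 a0).
Unshelve. all: by end_near. Qed.

(** The phase [c] treats both transforms at once: c = 0 gives the cosine, c = - pi / 2 the sine. *)
Definition gchar c t : R := \int[leb]_x (cos (t * x + c) * gpdf x).

Lemma affine_measurable t c : measurable_fun setT (fun x : R => t * x + c).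
Proof. by apply: measurable_funD => //; apply: measurable_funM. Qed.

Lemma cos_affine_bmeas t c : bmeas (fun x : R => cos (t * x + c)).
Proof. exact: (cbm_expi (affine_measurable t c)).1. Qed.

Lemma sin_affine_bmeas t c : bmeas (fun x : R => sin (t * x + c)).
Proof. exact: (cbm_expi (affine_measurable t c)).2. Qed.

Lemma is_derive_gpdf x : is_derive x 1 gpdf (- x * gpdf x).
Proof.
have h1 : is_derive x 1 (fun x : R => - x ^+ 2 / 2) (- x).
  by apply: is_derive_eq; rewrite /GRing.scale/=; field.
have h2 : is_derive x 1 (fun x : R => expR (- x ^+ 2 / 2)) (expR (- x ^+ 2 / 2) * - x).
  exact: (@is_derive1_comp _ expR (fun x => - x ^+ 2 / 2) x _ _ (is_derive_expR _) h1).
by apply: is_derive_eq; rewrite /GRing.scale/= /gpdf; ring.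
Qed.

Lemma is_derive_affine t c x : is_derive x 1 (fun x : R => t * x + c) t.
Proof. by apply: is_derive_eq; rewrite /GRing.scale/=; ring. Qed.

Lemma x_sin_gpdf_integrable t c :
  leb.-integrable setT (EFin \o (fun x => x * sin (t * x + c) * gpdf x)).
Proof.
apply: gdecay_integrable.
  apply: measurable_funM; last exact: measurable_gpdf.
  by apply: measurable_funM => //; exact: (sin_affine_bmeas t c).1.
move=> x; rewrite normrM (ger0_norm (gpdf_ge0 x)) ler_wpM2r ?gpdf_ge0//.
rewrite normrM (@le_trans _ _ (`|x| * 1))//; last by rewrite mulr1 lerDr.
by rewrite ler_wpM2l// ler_norml sin_geN1 sin_le1.
Qed.

Lemma gchar_by_parts t c :
  \int[leb]_x (x * sin (t * x + c) * gpdf x) = t * gchar c t.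
Proof.
pose f x := sin (t * x + c) * gpdf x.
pose f' x := t * (cos (t * x + c) * gpdf x) - x * sin (t * x + c) * gpdf x.
have i1 := integrable_scaler measurableT t (bmeas_gpdf_integrable (cos_affine_bmeas t c)).
have i2 := x_sin_gpdf_integrable t c.
have cg := gpdf_continuous.
have ca : continuous (fun x : R => t * x + c).
  by move=> x; apply: cvgD; [apply: cvgM; [exact: cvg_cst|exact: cvg_id]|exact: cvg_cst].
suff : \int[leb]_x f' x = 0.
  by rewrite RintegralB// RintegralZl//; [move/subr0_eq => <-|exact: (bmeas_gpdf_integrable (cos_affine_bmeas t c))].
apply: (@total_derivative_Rintegral f f').
- move=> x; have h1 := is_derive_gpdf x.
  have h2 : is_derive x 1 (fun x : R => sin (t * x + c)) (cos (t * x + c) * t).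
    exact: (@is_derive1_comp _ sin (fun x => t * x + c) x _ _ (is_derive_sin _) (is_derive_affine t c x)).
  by apply: is_derive_eq; rewrite /GRing.scale/= /f'; ring.
- move=> x; apply: cvgB; apply: cvgM.
  + exact: cvg_cst.
  + apply: cvgM; last exact: cg.
    by apply: continuous_comp; [exact: ca|exact: continuous_cos].
  + apply: cvgM; first exact: cvg_id.
    by apply: continuous_comp; [exact: ca|exact: continuous_sin].
  + exact: cg.
- exact: integrable_subr.
- move=> x; rewrite (le_trans _ (gpdf_decay x))// normrM (ger0_norm (gpdf_ge0 x)).
  rewrite ler_wpM2r ?gpdf_ge0// (@le_trans _ _ 1)//; last by rewrite lerDl.
  by rewrite ler_norml sin_geN1 sin_le1.
Qed.

Lemma is_derive_gchar c t : is_derive t 1 (gchar c) (- t * gchar c t).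
Proof.
pose f (t x : R) := cos (t * x + c) * gpdf x.
have df (u x : R) : is_derive u (1 : R) (f ^~ x) (- (x * sin (u * x + c) * gpdf x)).
  have h1 : is_derive u 1 (fun u : R => u * x + c) x.
    by apply: is_derive_eq; rewrite /GRing.scale/=; ring.
  have h2 : is_derive u 1 (fun u : R => cos (u * x + c)) (- sin (u * x + c) * x).
    exact: (@is_derive1_comp _ cos (fun u => u * x + c) u _ _ (is_derive_cos _) h1).
  by rewrite /f; apply: is_derive_eq; rewrite /GRing.scale/=; ring.
have h1 (u : R) : `]t - 1, t + 1[%classic u -> leb.-integrable setT (EFin \o f u).
  by move=> _; exact: bmeas_gpdf_integrable (cos_affine_bmeas u c).
have h2 (u x : R) : `]t - 1, t + 1[%classic u -> setT x -> derivable (f ^~ x) u 1.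
  by move=> _ _; have := df u x => ?; exact: ex_derive.
have d1E (u x : R) : partial1of2 f u x = - (x * sin (u * x + c) * gpdf x).
  by rewrite partial1of2E; have := df u x => ?; exact: derive_val.
pose G x := (1 + `|x|) * gpdf x.
have mG : measurable_fun setT G.
  apply: measurable_funM; last exact: measurable_gpdf.
  by apply: measurable_funD => //; apply: continuous_measurable_fun; exact: norm_continuous.
have G0 x : 0 <= G x by rewrite mulr_ge0 ?gpdf_ge0// addr_ge0.
have iG : leb.-integrable setT (EFin \o G).
  by apply: gdecay_integrable => // x; rewrite ger0_norm.
have h3 (u x : R) : `]t - 1, t + 1[%classic u -> setT x -> `|partial1of2 f u x| <= G x.
  move=> _ _; rewrite d1E normrN normrM (ger0_norm (gpdf_ge0 x)) ler_wpM2r ?gpdf_ge0//.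
  rewrite normrM (@le_trans _ _ (`|x| * 1))//; last by rewrite mulr1 lerDr.
  by rewrite ler_wpM2l// ler_norml sin_geN1 sin_le1.
have it : `]t - 1, t + 1[%classic t by rewrite /= in_itv/=; apply/andP; split; lra.
have e1 := @derivable_under_integral R _ _ leb f setT measurableT t _ _ it h1 h2 G G0 iG h3.
have e2 := @differentiation_under_integral R _ _ leb f setT measurableT t _ _ it h1 h2 G G0 iG h3.
split; first exact: e1.
rewrite -derive1E [LHS]e2.
under eq_Rintegral do rewrite d1E -mulN1r.
rewrite RintegralZl//; last exact: x_sin_gpdf_integrable.
by rewrite gchar_by_parts; ring.
Qed.

(** Integration by parts yields the equation gchar' = - t gchar, so gchar times exp(t^2 / 2) is
    constant. *)
Lemma gcharE c t : gchar c t = cos c * expR (- t ^+ 2 / 2).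
Proof.
have d (u : R) : is_derive u (1 : R) (fun u : R => gchar c u * expR (u ^+ 2 / 2)) 0.
  have h1 : is_derive u (1 : R) (fun u : R => u ^+ 2 / 2) u.
    by apply: is_derive_eq; rewrite /GRing.scale/=; field.
  have h2 : is_derive u (1 : R) (fun u : R => expR (u ^+ 2 / 2)) (expR (u ^+ 2 / 2) * u).
    exact: (@is_derive1_comp _ expR (fun u => u ^+ 2 / 2) u _ _ (is_derive_expR _) h1).
  have h3 := is_derive_gchar c u.
  by apply: is_derive_eq; rewrite /GRing.scale/=; ring.
have := is_derive_0_is_cst t 0 d.
rewrite expr0n/= mul0r expR0 mulr1 => h.
have g0 : gchar c 0 = cos c.
  rewrite /gchar; under eq_Rintegral do rewrite mul0r add0r.
  by rewrite RintegralZl//; [rewrite integral_gpdf mulr1|exact: gpdf_integrable].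
rewrite -g0 -h -mulrA -expRD mulNr subrr expR0 mulr1//.
Qed.

Lemma normal_cos t : \int[N01]_x cos (t * x) = expR (- t ^+ 2 / 2).
Proof.
transitivity (gchar 0 t); last by rewrite gcharE cos0 mul1r.
rewrite /gchar -(normal_Rintegral (cos_affine_bmeas t 0)).
by apply: eq_Rintegral => x _; rewrite addr0.
Qed.

Lemma normal_sin t : \int[N01]_x sin (t * x) = 0.
Proof.
transitivity (gchar (- (pi / 2)) t); last by rewrite gcharE cosN cos_pihalf mul0r.
rewrite /gchar -(normal_Rintegral (cos_affine_bmeas t (- (pi / 2)))).
by apply: eq_Rintegral => x _; rewrite cosB cos_pihalf sin_pihalf mulr0 mulr1 add0r.
Qed.

Lemma normal_cdf_lipschitz x y : x <= y ->
  fine (N01 `]-oo, y]) - fine (N01 `]-oo, x]) <= y - x.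
Proof.
move=> xy; have cE z : fine (N01 `]-oo, z]) = \int[leb]_(x in `]-oo, z]) gpdf x.
  by rewrite normal_probE.
rewrite !cE.
have ii (z : R) : leb.-integrable `]-oo, z] (EFin \o gpdf).
  by apply: integrableS gpdf_integrable.
rewrite Rintegral_itvB//.
have lE : (leb `]x, y] = (y - x)%:E)%E.
  rewrite lebesgue_measure_itv/= lte_fin; case: ifPn => [_|]; first by rewrite -EFinB.
  by rewrite -leNgt => yx; rewrite (@le_anti _ _ x y) ?subrr// xy.
have -> : y - x = \int[leb]_(_ in `]x, y]) 1.
  by rewrite Rintegral_cst// mul1r [X in fine X]lE.
apply: le_Rintegral => //.
- by apply: integrableS gpdf_integrable.
- apply: measurable_bounded_integrable => //; first by rewrite [ltLHS]lE ltry.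
  exists 1; split; first exact: num_real.
  by move=> z z1 w _ /=; rewrite normr1 ltW.
- by move=> z _; exact: gpdf_le1.
Qed.

End gaussian.

(** * From characteristic functions to distribution functions *)

Section riemann_sum.
Context (R : realType).
Notation leb := (@lebesgue_measure R).

Lemma lipschitz_riemann_sum (f : R -> R) (C : R) (n : nat) : (0 < n)%N ->
  (forall u v : R, u \in `[0, 1] -> v \in `[0, 1] -> `|f u - f v| <= C * `|u - v|) ->
  `|\sum_(k < n) f (k.+1%:R / n%:R) - n%:R * \int[leb]_(u in `[0, 1]) f u| <= C.
Proof.
move=> n_gt0 flip; have nR : 0 < n%:R :> R by rewrite ltr0n.
have n_neq0 : n%:R != 0 :> R by rewrite gt_eqF.
have C0 : 0 <= C.
  have i0 : (0 : R) \in `[0, 1] by rewrite in_itv/= lexx ler01.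
  have i1 : (1 : R) \in `[0, 1] by rewrite in_itv/= ler01 lexx.
  have := flip 0 1 i0 i1; rewrite sub0r normrN1 mulr1.
  exact: le_trans.
have fint : leb.-integrable `[0, 1] (EFin \o f).
  apply: continuous_compact_integrable; first exact: segment_compact.
  apply/subspace_continuousP => x x01; apply/cvgrPdist_le => e e0.
  rewrite near_withinE; near=> y => y01.
  (* [C + 1] because [C] may vanish and is divided by. *)
  rewrite (le_trans (flip x y x01 y01))// (@le_trans _ _ ((C + 1) * `|x - y|))//.
    by rewrite ler_wpM2r// lerDl.
  rewrite mulrC -ler_pdivlMr; last by rewrite ltr_wpDl.
  near: y; apply: cvgr_dist_le; first exact: cvg_id.
  by rewrite divr_gt0// ltr_wpDl.
pose t (k : nat) : R := k%:R / n%:R.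
have t_le j k : (j <= k)%N -> t j <= t k by move=> jk; rewrite ler_wpM2r// ?invr_ge0// ler_nat.
have tn : t n = 1 by rewrite /t divff.
have t01 k : (k <= n)%N -> t k \in `[0, 1].
  by move=> kn; rewrite in_itv/= divr_ge0//= -tn t_le.
have sub k : (k <= n)%N -> [set` `[(0 : R), t k]] `<=` [set` `[0, 1]].
  by move=> kn; apply: subset_itvl; rewrite bnd_simp -tn t_le.
have tS k : t k.+1 - t k = n%:R^-1 by rewrite /t -mulrBl -natrB// subSnn mul1r.
(* The sum takes right endpoints. A cell of length 1 / n contributes C / n^2; over n cells and after
   multiplication by n this is [C]. *)
have step k : (k < n)%N -> `|n%:R^-1 * f (t k.+1) - \int[leb]_(u in `]t k, t k.+1]) f u| <= C / n%:R ^+ 2.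
  move=> kn; have tlt : t k < t k.+1 by rewrite -subr_gt0 tS invr_gt0.
  have lE : fine (leb `]t k, t k.+1]) = n%:R^-1.
    by rewrite lebesgue_measure_itv/= lte_fin tlt -EFinB tS.
  have sk : [set` `]t k, t k.+1]] `<=` [set` `[(0 : R), 1]].
    apply: subset_itv; rewrite bnd_simp; first by rewrite divr_ge0.
    by rewrite -tn t_le.
  have fk : leb.-integrable `]t k, t k.+1] (EFin \o f) by apply: integrableS fint.
  have ick (c : R) : leb.-integrable `]t k, t k.+1] (EFin \o (fun=> c)).
    apply: measurable_bounded_integrable => //.
      by rewrite [ltLHS]lebesgue_measure_itv/= lte_fin tlt -EFinB ltry.
    exists `|c|; split; first exact: num_real.
    by move=> z z1 w _ /=; rewrite ltW.
  have -> : n%:R^-1 * f (t k.+1) = \int[leb]_(u in `]t k, t k.+1]) f (t k.+1).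
    by rewrite Rintegral_cst// lE mulrC.
  rewrite -RintegralB//.
  have -> : C / n%:R ^+ 2 = \int[leb]_(u in `]t k, t k.+1]) (C / n%:R).
    by rewrite Rintegral_cst// lE expr2 invfM mulrA.
  have id : leb.-integrable `]t k, t k.+1] (EFin \o (fun u => f (t k.+1) - f u)).
    exact: integrable_subr.
  rewrite (le_trans (le_normr_Rintegral _ id))//; apply: le_Rintegral => //.
    exact: integrable_norm.
  move=> u uk; rewrite (le_trans (flip _ _ _ _))//.
  - exact: t01.
  - exact: sk.
  - rewrite ler_wpM2l//; move: uk; rewrite /= in_itv/= => /andP[u1 u2].
    by rewrite -(tS k) ger0_norm ?subr_ge0// lerD2l lerN2 ltW.
have acc k : (k <= n)%N ->
    `|n%:R^-1 * (\sum_(j < k) f (t j.+1)) - \int[leb]_(u in `[0, t k]) f u| <= k%:R * (C / n%:R ^+ 2).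
  elim: k => [|k IH] kn.
    by rewrite big_ord0 mulr0 /t mul0r set_itv1 Rintegral_set1 subrr normr0 mul0r.
  have h1 : \int[leb]_(u in `[0, t k.+1]) f u - \int[leb]_(u in `[0, t k]) f u =
      \int[leb]_(u in `]t k, t k.+1]) f u.
    apply: Rintegral_itvB; rewrite ?bnd_simp ?t_le//; last by rewrite divr_ge0.
    by apply: integrableS fint => //; exact: sub.
  have h2 := IH (ltnW kn); have h3 := step k kn.
  rewrite big_ord_recr/= mulrDr -[k.+1%:R]natr1 mulrDl mul1r.
  have -> : \int[leb]_(u in `[0, t k.+1]) f u =
    \int[leb]_(u in `[0, t k]) f u + \int[leb]_(u in `]t k, t k.+1]) f u.
    by rewrite -h1 addrC subrK.
  by rewrite opprD addrACA (le_trans (ler_normD _ _))// lerD.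
have := acc n (leqnn n); rewrite tn => h.
have -> : \sum_(k < n) f (k.+1%:R / n%:R) - n%:R * \int[leb]_(u in `[0, 1]) f u =
  n%:R * (n%:R^-1 * (\sum_(j < n) f (t j.+1)) - \int[leb]_(u in `[0, 1]) f u).
  by rewrite mulrBr mulVKf.
rewrite normrM ger0_norm// (le_trans (ler_wpM2l (ltW nR) h))//.
by rewrite le_eqVlt; apply/orP; left; apply/eqP; field.
Unshelve. all: by end_near. Qed.

End riemann_sum.

Lemma integral_expR_le (R : realType) (t : R) : 0 < t ->
  \int[lebesgue_measure]_(s in `]0, 1]) expR (- (t * s)) <= t^-1.
Proof.
move=> t0; pose F (s : R) := - (t^-1 * expR (- (t * s))).
have dF (s : R) : is_derive s (1 : R) F (expR (- (t * s))).
  have h1 : is_derive s (1 : R) (fun s : R => - (t * s)) (- t).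
    by apply: is_derive_eq; rewrite /GRing.scale/=; ring.
  have h2 : is_derive s (1 : R) (fun s : R => expR (- (t * s))) (expR (- (t * s)) * - t).
    exact: (@is_derive1_comp _ expR (fun s => - (t * s)) s _ _ (is_derive_expR _) h1).
  by rewrite /F; apply: is_derive_eq; rewrite /GRing.scale/=; field; rewrite gt_eqF.
have cF : continuous F.
  by move=> s; have := dF s => ?; apply/differentiable_continuous/derivable1_diffP/ex_derive.
have cf : continuous (fun s : R => expR (- (t * s))).
  move=> s; apply: continuous_comp; last exact: continuous_expR.
  by apply: cvgN; apply: cvgM; [exact: cvg_cst|exact: cvg_id].
have fi : (@lebesgue_measure R).-integrable `[0, 1] (EFin \o (fun s : R => expR (- (t * s)))).
  apply: continuous_compact_integrable; first exact: segment_compact.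
  exact: continuous_subspaceT.
rewrite Rintegral_itv_obnd_cbnd; last first.
  by apply: integrableS fi => //; exact: subset_itv_oc_cc.
rewrite /Rintegral (@continuous_FTC2 _ _ F)//.
- have F0 : F 0 = - t^-1 by rewrite /F mulr0 oppr0 expR0 mulr1.
  have F1 : F 1 <= 0 by rewrite /F oppr_le0 mulr_ge0 ?expR_ge0// invr_ge0 ltW.
  by rewrite -EFinB /= F0; lra.
- exact: continuous_subspaceT.
- split.
  + by move=> x _; have := dF x => ?; exact: ex_derive.
  + by apply: cvg_at_right_filter; exact: cF.
  + by apply: cvg_at_left_filter; exact: cF.
- by move=> x _; have := dF x => ?; rewrite derive1E; exact: derive_val.
Qed.

(** Gaussian decay is traded for exponential decay, which has an elementary integral: (y - 8)^2 >= 0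
    gives exp(-y^2 / 8) <= e^8 exp(-2 y), and one factor exp(-y) absorbs the power of y. *)
Lemma expR_sqr_decay (R : realType) (y : R) : 0 <= y ->
  y * expR (- (y ^+ 2 / 8)) <= expR 8 * expR (- y) /\
  y ^+ 2 * expR (- (y ^+ 2 / 8)) <= 4 * expR 8 * expR (- y).
Proof.
move=> y0; have e1 : expR (- (y ^+ 2 / 8)) <= expR 8 * expR (- y) * expR (- y).
  by rewrite -!expRD ler_expR; have := sqr_ge0 (y - 8); lra.
have ep := expR_gt0 y; have en := expR_gt0 (- y).
have y1 : y * expR (- y) <= 1.
  by rewrite expRN ler_pdivrMr// mul1r (le_trans _ (expR_ge1Dx y))// lerDr.
have y2 : y ^+ 2 * expR (- y) <= 4.
  have h : 1 + y / 2 <= expR (y / 2) := expR_ge1Dx _.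
  have h2 : (1 + y / 2) ^+ 2 <= expR (y / 2) ^+ 2.
    by rewrite lerXn2r ?nnegrE ?expR_ge0// addr_ge0// divr_ge0.
  rewrite -expRM_natl (_ : 2 * (y / 2) = y) in h2; last by field.
  rewrite expRN ler_pdivrMr//.
  have -> : y ^+ 2 = 4 * (1 + y / 2) ^+ 2 - 4 - 4 * y by field.
  lra.
have e8 := expR_gt0 (8 : R).
split.
  rewrite (le_trans (ler_wpM2l y0 e1))//.
  have -> : y * (expR 8 * expR (- y) * expR (- y)) = expR 8 * expR (- y) * (y * expR (- y)) by ring.
  by rewrite ler_piMr// mulr_ge0 ?ltW.
rewrite (le_trans (ler_wpM2l (sqr_ge0 y) e1))//.
have -> : y ^+ 2 * (expR 8 * expR (- y) * expR (- y)) = expR 8 * expR (- y) * (y ^+ 2 * expR (- y)) by ring.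
have -> : 4 * expR 8 * expR (- y) = expR 8 * expR (- y) * 4 by ring.
by rewrite ler_wpM2l// mulr_ge0 ?ltW.
Qed.

Lemma expR_lipschitz (R : realType) (x y m : R) : m <= x -> m <= y ->
  `|expR (- x) - expR (- y)| <= `|x - y| * expR (- m).
Proof.
wlog xy : x y / x <= y.
  move=> h mx my; have [xy|yx] := leP x y; first exact: h.
  by rewrite distrC [`|x - y|]distrC h// ltW.
move=> mx my; rewrite ger0_norm ?subr_ge0 ?ler_expR ?lerN2//.
rewrite distrC ger0_norm ?subr_ge0//.
have h : 1 + - (y - x) <= expR (- (y - x)) := expR_ge1Dx _.
have -> : expR (- y) = expR (- x) * expR (- (y - x)) by rewrite -expRD; congr expR; ring.
apply: (@le_trans _ _ ((y - x) * expR (- x))); last first.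
  by rewrite ler_wpM2l ?subr_ge0// ler_expR lerN2.
have := expR_gt0 (- x); nra.
Qed.

(** * The Berry-Esseen bound from an estimate of the characteristic function *)

Section berry_esseen_charfun.
Context d (Omega : measurableType d) (R : realType) (P : probability Omega R).
Variables (S : Omega -> R) (n : nat) (a delta H V C : R).
Notation leb := (@lebesgue_measure R).
Notation N01 := (@normal_prob R 0 1).
Hypothesis bS : bmeas S.
Hypothesis a_gt0 : 0 < a.
Hypothesis delta_gt0 : 0 < delta.
Hypothesis H_ge0 : 0 <= H.
Hypothesis n_gt0 : (0 < n)%N.
Hypothesis charS : forall t : R, `|t| <= delta ->
  cn (cint P (fun w => expi (t * S w)) - (expR (- (t ^+ 2 * V / 2)))%:C%C) <=
  expR (- (t ^+ 2 * V / 2)) * (n%:R * (H * `|t| ^+ 3) * expR (n%:R * (H * `|t| ^+ 3))).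
Hypothesis Va : `|V - n%:R * a ^+ 2| <= C.
Hypothesis V_large : 2 * C <= n%:R * a ^+ 2.
Hypothesis delta_small : 8 * (H * delta) <= a ^+ 2.
(** Multiplying [S] by [delta] maps the controlled band |t| <= delta to the unit band of
    [esseen_unit]; [T] is the standard deviation of the Gaussian on that scale. *)
Let T := a * delta * Num.sqrt n%:R.
Hypothesis T_ge1 : 1 <= T.

Let D := 2 * expR 8 * (4 * (H * delta) / a ^+ 2 + C * delta ^+ 2).
Let nR : 0 < n%:R :> R. Proof. by rewrite ltr0n. Qed.
Let C0 : 0 <= C. Proof. exact: le_trans Va. Qed.
Let T_gt0 : 0 < T. Proof. exact: lt_le_trans T_ge1. Qed.
Let T_sqr : T ^+ 2 = n%:R * a ^+ 2 * delta ^+ 2.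
Proof. by rewrite /T !exprMn sqr_sqrtr ?ltW//; ring. Qed.

(** [V_large] gives V >= n a^2 / 2, so the Gaussian factor is at most exp(-t^2 n a^2 / 4), and the
    error exponential takes at most half of that decay. The term C t^2 pays for replacing [V] by n
    a^2. *)
Let char_diff (t : R) : 0 <= t <= delta ->
  cn (cint P (fun w => expi (t * S w)) - (expR (- (t ^+ 2 * (n%:R * a ^+ 2) / 2)))%:C%C) <=
  (n%:R * (H * t ^+ 3) + C * t ^+ 2) * expR (- (t ^+ 2 * (n%:R * a ^+ 2) / 8)).
Proof.
move=> /andP[t0 td]; have := charS; move=> /(_ t); rewrite ger0_norm// => /(_ td) h.
have := Va; have := V_large; set na := n%:R * a ^+ 2 => Vl Va'; set E1 := expR (- (t ^+ 2 * V / 2)) in h *.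
have na0 : 0 <= na by rewrite mulr_ge0// ?sqr_ge0 ?ltW.
have t2 := sqr_ge0 t; have t3 : 0 <= t ^+ 3 by rewrite exprn_ge0.
have V1 : na / 2 <= V by move: Va'; rewrite ler_norml => /andP[? ?]; lra.
have V2 : t ^+ 2 * (na / 4) <= t ^+ 2 * V / 2 by rewrite -mulrA ler_wpM2l//; lra.
(* This is what [delta_small] is for: on the band the cubic exponent stays below a fraction of the
   Gaussian one. *)
have Ht : n%:R * (H * t ^+ 3) <= t ^+ 2 * (na / 8).
  have -> : n%:R * (H * t ^+ 3) = t ^+ 2 * n%:R * (H * t) by ring.
  have -> : t ^+ 2 * (na / 8) = t ^+ 2 * n%:R * (a ^+ 2 / 8) by rewrite /na; field.
  apply: ler_wpM2l; first by rewrite mulr_ge0// ltW.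
  have ds := delta_small; have : H * t <= H * delta by rewrite ler_wpM2l.
  by lra.
rewrite -[X in cn X](subrKA (E1%:C)%C) (le_trans (cnD _ _))// mulrDl lerD//.
  rewrite (le_trans h)// mulrCA ler_wpM2l//; first by rewrite mulr_ge0 ?mulr_ge0// ltW.
  rewrite -expRD ler_expR; lra.
rewrite -[X in cn X]rmorphB cn_real.
have tna := mulr_ge0 t2 na0.
have i1 : t ^+ 2 * na / 8 <= t ^+ 2 * V / 2 by lra.
have i2 : t ^+ 2 * na / 8 <= t ^+ 2 * na / 2 by lra.
apply: (le_trans (expR_lipschitz i1 i2)).
rewrite ler_wpM2r ?expR_ge0// -mulrBl -mulrBr normrM [`|2^-1|]ger0_norm// normrM ger0_norm//.
have := ler_wpM2l t2 Va'; have := mulr_ge0 t2 C0; lra.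
Qed.

Let W1 w := delta * S w.
Let W2 (x : R) := T * x.

Let mW1 : measurable_fun setT W1. Proof. exact: (bmeasZ delta bS).1. Qed.
Let mW2 : measurable_fun setT W2. Proof. exact: measurable_funM. Qed.

Let cdf2 (x : R) : @cdf_of _ _ _ N01 W2 x = gauss_cdf (x / T).
Proof.
rewrite gauss_cdfE /cdf_of; congr (fine (N01 _)); apply/seteqP; split => z /=;
  by rewrite in_itv/= ler_pdivlMr// mulrC.
Qed.

Lemma gauss_cdf_lipschitz (x y : R) : `|gauss_cdf x - gauss_cdf y| <= `|x - y|.
Proof.
wlog xy : x y / y <= x.
  move=> h; have [yx|/ltW xy] := leP y x; first exact: h.
  by rewrite distrC [leRHS]distrC h.
have h := normal_cdf_lipschitz xy; rewrite !gauss_cdfE.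
rewrite ger0_norm ?(ger0_norm (_ : 0 <= x - y)) ?subr_ge0//.
apply: fine_le; rewrite ?fin_num_measure//.
by apply: le_measure; rewrite ?inE//; exact: subset_itvl.
Qed.

Lemma berry_esseen_charfun (t : R) :
  `|fine (P [set w | S w <= a * Num.sqrt n%:R * t]) - gauss_cdf t| <= (512 + 8 * D) / T.
Proof.
have PT := @probability_setT _ _ _ P.
(* The rescaled Gaussian distribution function is 1 / T-Lipschitz, and h(s) = D exp(-T s) has
   integral at most D / T. *)
have := @esseen_unit R _ _ P W1 _ _ N01 W2 mW1 (bmeas_integrable PT (bmeasZ delta bS)) mW2
  (integrable_scaler measurableT T (@normal_id_integrable R)) T^-1 (D / T)
  (fun s => D * expR (- (T * s))).
have D0 : 0 <= D.
  rewrite /D mulr_ge0 ?mulr_ge0 ?expR_ge0// addr_ge0 ?divr_ge0 ?mulr_ge0 ?sqr_ge0//; exact: ltW.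
have fi : leb.-integrable `]0, 1] (EFin \o (fun s : R => expR (- (T * s)))).
  have : leb.-integrable `[0, 1] (EFin \o (fun s : R => expR (- (T * s)))); last first.
    by apply: integrableS => //; exact: subset_itv_oc_cc.
  apply: continuous_compact_integrable; first exact: segment_compact.
  apply: continuous_subspaceT => s; apply: continuous_comp; last exact: continuous_expR.
  by apply: cvgN; apply: cvgM; [exact: cvg_cst|exact: cvg_id].
move=> /(_ _ _ _ _ (T * t)) h.
have -> : fine (P [set w | S w <= a * Num.sqrt n%:R * t]) = cdf_of P W1 (T * t).
  rewrite (_ : T * t = delta * (a * Num.sqrt n%:R * t)); last by rewrite /T; ring.
  by congr (fine (P _)); apply/funext => w /=; rewrite /W1 ler_pM2l.
have -> : gauss_cdf t = cdf_of N01 W2 (T * t) by rewrite cdf2 mulrC mulKf// gt_eqF.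
have -> : (512 + 8 * D) / T = 512 * T^-1 + 8 * (D / T) by ring.
apply: h.
- move=> x y xy; rewrite !cdf2 (le_trans (ler_norm _))//.
  rewrite (le_trans (gauss_cdf_lipschitz _ _))// -mulrBl ger0_norm; last first.
    by rewrite divr_ge0 ?subr_ge0// ltW.
  by rewrite mulrC.
- move=> s; rewrite /= in_itv/= => /andP[s0 s1].
  pose u := delta * s.
  have u01 : 0 <= u <= delta
    by apply/andP; split; [rewrite mulr_ge0// ltW|rewrite ler_piMr// ltW].
  have := char_diff u01; set z := (X in cn X) => hz.
  have sTu : (s * T) ^+ 2 = u ^+ 2 * (n%:R * a ^+ 2) by rewrite exprMn T_sqr /u; ring.
  have e1 : \int[P]_w cos (s * W1 w) - \int[N01]_x cos (s * W2 x) = Re z.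
    rewrite /z /= ; congr (_ - _).
      by apply: eq_Rintegral => w _; rewrite /W1 /u mulrA [s * _]mulrC.
    under eq_Rintegral do rewrite /W2 mulrA.
    by rewrite normal_cos sTu mulNr.
  have e2 : \int[P]_w sin (s * W1 w) - \int[N01]_x sin (s * W2 x) = Im z.
    rewrite /z /= oppr0 addr0 -[RHS]subr0; congr (_ - _).
      by apply: eq_Rintegral => w _; rewrite /W1 /u mulrA [s * _]mulrC.
    by under eq_Rintegral do rewrite /W2 mulrA; exact: normal_sin.
  rewrite e1 e2; have c1 := cn_Re z; have c2 := cn_Im z.
  (* Real and imaginary parts each cost one modulus: the factor 2 in [D]. *)
  apply: (@le_trans _ _ (2 * cn z)); first by lra.
  have y0 : 0 <= T * s by rewrite mulr_ge0// ltW.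
  have [y1 y2] := expR_sqr_decay y0.
  have sy : s <= T * s by rewrite ler_peMl// ltW.
  move: hz; rewrite -sTu [s * T]mulrC; set e := expR (- ((T * s) ^+ 2 / 8)) in y1 y2 *.
  set f := expR (- (T * s)) in y1 y2 *; move=> hz.
  have e0 : 0 <= e := expR_ge0 _.
  have nE : n%:R * (H * u ^+ 3) = s * ((H * delta) / a ^+ 2 * (T * s) ^+ 2).
    by rewrite [T * s]mulrC sTu /u; field; rewrite gt_eqF.
  have p1 : (H * delta) / a ^+ 2 * ((T * s) ^+ 2 * e) <= (H * delta) / a ^+ 2 * (4 * expR 8 * f).
    by rewrite ler_wpM2l// divr_ge0 ?sqr_ge0// mulr_ge0// ltW.
  have p2 : C * delta ^+ 2 * (s * e) <= C * delta ^+ 2 * (expR 8 * f).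
    apply: ler_wpM2l; first by rewrite mulr_ge0// sqr_ge0.
    by rewrite (le_trans _ y1)// ler_wpM2r.
  have := ler_wpM2l (ltW s0) (lerD p1 p2).
  have -> : s * ((H * delta) / a ^+ 2 * ((T * s) ^+ 2 * e) + C * delta ^+ 2 * (s * e)) =
    (n%:R * (H * u ^+ 3) + C * u ^+ 2) * e by rewrite nE /u; ring.
  have -> : s * (D * f) = 2 * (s * ((H * delta) / a ^+ 2 * (4 * expR 8 * f) + C * delta ^+ 2 * (expR 8 * f))).
    by rewrite /D; ring.
  lra.
- exact: integrable_scaler.
- rewrite RintegralZl// ler_wpM2l//.
  exact: integral_expR_le.
Qed.

End berry_esseen_charfun.

(** * Covariances and mixing of inhomogeneous chains *)

Section real_oscillation.
Context d (T : measurableType d) (R : realType).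
Implicit Types (f g h : T -> R) (mu nu : probability T R).

Definition rosc_le f (c : R) := forall x y, `|f x - f y| <= c.

Lemma rosc_le_ge0 f c : rosc_le f c -> 0 <= c.
Proof. by move=> /(_ point point); rewrite subrr normr0. Qed.

Lemma osc_le_real f c : osc_le (fun x => (f x)%:C%C) c <-> rosc_le f c.
Proof.
split=> fc x y; have := fc x y; first by rewrite -[X in cn X]rmorphB cn_real.
by rewrite -[X in _ -> cn X <= _]rmorphB cn_real.
Qed.

Lemma rosc_le_norm f c : (forall x, `|f x| <= c) -> rosc_le f (2 * c).
Proof.
move=> fc x y; rewrite (le_trans (ler_normB _ _))//.
by have := fc x; have := fc y; lra.
Qed.

Lemma rosc_le_trans f c c' : c <= c' -> rosc_le f c -> rosc_le f c'.
Proof. by move=> cc' fc x y; rewrite (le_trans (fc x y)). Qed.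

Lemma rosc_leD f g c c' : rosc_le f c -> rosc_le g c' ->
  rosc_le (fun x => f x + g x) (c + c').
Proof.
move=> fc gc x y; rewrite opprD addrACA (le_trans (ler_normD _ _))//.
by rewrite lerD.
Qed.

Lemma rosc_leDc f c a : rosc_le f c -> rosc_le (fun x => f x + a) c.
Proof. by move=> fc x y; rewrite opprD addrACA subrr addr0. Qed.

Lemma rosc_leM f g cf cg x0 : rosc_le f cf -> rosc_le g cg ->
  rosc_le (fun x => (f x - f x0) * (g x - g x0)) (2 * (cf * cg)).
Proof.
move=> fc gc; apply: rosc_le_norm => x.
by rewrite normrM ler_pM.
Qed.

Lemma rosc_mean mu f c x : bmeas f -> rosc_le f c -> `|f x - \int[mu]_y f y| <= c.
Proof.
move=> bf fc; have pT := @probability_setT _ _ _ mu.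
rewrite -[f x](Rintegral1_cst pT) -bmeas_RintegralB//; last exact: bmeas_cst.
by apply: bmeas_Rintegral_norm_le => //; apply: bmeasB => //; exact: bmeas_cst.
Qed.

(** Closeness of laws tested directly on oscillations, the form in which it is transported by
    kernels. *)
Definition mclose mu nu (e : R) := forall f c, bmeas f -> rosc_le f c ->
  `|\int[mu]_x f x - \int[nu]_x f x| <= e * c.

Definition cov mu f g := \int[mu]_x (f x * g x) - (\int[mu]_x f x) * (\int[mu]_x g x).

Lemma covC mu f g : cov mu f g = cov mu g f.
Proof. by rewrite /cov mulrC; under eq_Rintegral do rewrite mulrC. Qed.

Lemma covBl mu f g h : bmeas f -> bmeas g -> bmeas h ->
  cov mu (fun x => f x - g x) h = cov mu f h - cov mu g h.
Proof.
move=> bf bg bh; have pT := @probability_setT _ _ _ mu.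
rewrite /cov; under eq_Rintegral do rewrite mulrBl.
by rewrite !bmeas_RintegralB//; [ring|exact: bmeasM..].
Qed.

Lemma covBr mu f g h : bmeas f -> bmeas g -> bmeas h ->
  cov mu h (fun x => f x - g x) = cov mu h f - cov mu h g.
Proof. by move=> bf bg bh; rewrite covC covBl// !(covC mu h). Qed.

Lemma cov_shift mu f g a b : bmeas f -> bmeas g ->
  cov mu f g = \int[mu]_x ((f x - a) * (g x - b)) -
    (\int[mu]_x f x - a) * (\int[mu]_x g x - b).
Proof.
move=> bf bg; have pT := @probability_setT _ _ _ mu.
have E x : (f x - a) * (g x - b) = f x * g x - (b * f x + a * g x - a * b) by ring.
under [in RHS]eq_Rintegral do rewrite E.
have [b1 b2 b3] : [/\ bmeas (fun x => f x * g x), bmeas (fun x => b * f x) & bmeas (fun x => a * g x)].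
  by split; [exact: bmeasM|exact: bmeasZ|exact: bmeasZ].
have b4 := bmeas_cst T (a * b).
rewrite bmeas_RintegralB//; last by apply: bmeasB => //; exact: bmeasD.
rewrite bmeas_RintegralB//; last exact: bmeasD.
by rewrite (Rintegral1_cst pT) bmeas_RintegralD// !bmeas_RintegralZ// /cov; ring.
Qed.

Lemma cov_le mu f g cf cg : bmeas f -> bmeas g -> rosc_le f cf -> rosc_le g cg ->
  `|cov mu f g| <= cf * cg.
Proof.
move=> bf bg fc gc; have pT := @probability_setT _ _ _ mu.
rewrite (cov_shift mu (\int[mu]_x f x) (\int[mu]_x g x) bf bg) subrr mul0r subr0.
apply: bmeas_Rintegral_norm_le => //.
  by apply: bmeasM; apply: bmeasB => //; exact: bmeas_cst.
by move=> x; rewrite normrM ler_pM// rosc_mean.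
Qed.

(** Recentred at a common point, the product has oscillation 2 cf cg; the product of the means
    changes by twice e cf cg. Together this gives 4. *)
Lemma cov_mclose mu nu e f g cf cg : 0 <= e -> mclose mu nu e ->
  bmeas f -> bmeas g -> rosc_le f cf -> rosc_le g cg ->
  `|cov mu f g - cov nu f g| <= 4 * e * (cf * cg).
Proof.
move=> e0 mn bf bg fc gc.
have cf0 := rosc_le_ge0 fc; have cg0 := rosc_le_ge0 gc.
have [x0 _] : exists x0 : T, True by exists point.
rewrite (cov_shift mu (f x0) (g x0) bf bg) (cov_shift nu (f x0) (g x0) bf bg).
have h1 := mn _ _ (bmeasM (bmeasB bf (bmeas_cst T (f x0))) (bmeasB bg (bmeas_cst T (g x0))))
  (rosc_leM x0 fc gc).
have h2 := mn _ _ bf fc; have h3 := mn _ _ bg gc.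
have h4 := rosc_mean nu x0 bf fc; have h5 := rosc_mean mu x0 bg gc.
set A := \int[mu]_x (_ * _) in h1 *; set B := \int[nu]_x (_ * _) in h1 *.
move: (\int[mu]_x f x) (\int[nu]_x f x) (\int[mu]_x g x) (\int[nu]_x g x) h2 h3 h4 h5.
move=> a a' b b' h2 h3 h4 h5.
have -> : A - (a - f x0) * (b - g x0) - (B - (a' - f x0) * (b' - g x0)) =
  (A - B) + ((a - a') * (g x0 - b) + (f x0 - a') * (b - b')) by ring.
have h6 : `|(a - a') * (g x0 - b)| <= e * cf * cg by rewrite normrM ler_pM.
have h7 : `|(f x0 - a') * (b - b')| <= cf * (e * cg) by rewrite normrM ler_pM.
have h8 := ler_normD (A - B) ((a - a') * (g x0 - b) + (f x0 - a') * (b - b')).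
have h9 := ler_normD ((a - a') * (g x0 - b)) ((f x0 - a') * (b - b')).
nra.
Qed.

(* If h solves the Poisson equation of a chain with invariant law mu, this is
   the asymptotic variance of the additive functional of f. *)
Definition gkvar mu f h := cov mu f f + 2 * cov mu f h.

(** The law is changed first, then the functions one at a time, using bilinearity of [cov]. *)
Lemma gkvar_close mu nu e f f' h h' c c' e1 e2 : 0 <= e -> mclose mu nu e ->
  bmeas f -> bmeas f' -> bmeas h -> bmeas h' ->
  rosc_le f c -> rosc_le f' c -> rosc_le h c' -> rosc_le h' c' ->
  rosc_le (fun x => f x - f' x) e1 -> rosc_le (fun x => h x - h' x) e2 ->
  `|gkvar mu f h - gkvar nu f' h'| <=
    4 * e * (c * c) + 2 * (c * e1) + 2 * (4 * e * (c * c') + (c * e2 + c' * e1)).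
Proof.
move=> e0 mn bf bf' bh bh' fc fc' hc hc' f1 h2.
have c1 := cov_mclose e0 mn bf bf fc fc; have c2 := cov_mclose e0 mn bf bh fc hc.
have bb := bmeasB bf bf'; have bb2 := bmeasB bh bh'.
have c3 := cov_le nu bb bf f1 fc; have c4 := cov_le nu bb bf' f1 fc'.
have c5 := cov_le nu bf' bb2 fc' h2; have c6 := cov_le nu bb bh f1 hc.
rewrite covBl// in c3; rewrite covBl// in c4.
rewrite covBr// in c5; rewrite covBl// in c6.
rewrite (covC nu f' f) in c3.
rewrite /gkvar.
move: c1 c2 c3 c4 c5 c6; rewrite !ler_norml.
move=> /andP[? ?] /andP[? ?] /andP[? ?] /andP[? ?] /andP[? ?] /andP[? ?].
by apply/andP; split; lra.
Qed.

End real_oscillation.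

(** * Evolution of real functions and stability of laws *)

Section real_evolution.
Context d (T : measurableType d) (R : realType).
Implicit Types (f g h : T -> R) (mu nu : probability T R).

Lemma ropD (P : R.-pker T ~> T) f g x : bmeas f -> bmeas g ->
  rop P (fun y => f y + g y) x = rop P f x + rop P g x.
Proof. by move=> bf bg; rewrite /rop bmeas_RintegralD//; exact: prob_kernel. Qed.

Lemma ropB (P : R.-pker T ~> T) f g x : bmeas f -> bmeas g ->
  rop P (fun y => f y - g y) x = rop P f x - rop P g x.
Proof. by move=> bf bg; rewrite /rop bmeas_RintegralB//; exact: prob_kernel. Qed.

Lemma rop_cst (P : R.-pker T ~> T) c x : rop P (fun=> c) x = c.
Proof. by rewrite /rop Rintegral1_cst//; exact: prob_kernel. Qed.

Lemma rosc_rop (P : R.-pker T ~> T) f c : bmeas f -> rosc_le f c -> rosc_le (rop P f) c.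
Proof.
move=> bf /osc_le_real fc; apply/osc_le_real.
have -> : (fun x => (rop P f x)%:C%C) = cop P (fun x => (f x)%:C%C).
  by apply/funext => x; rewrite cop_real.
by apply: osc_cop => //; exact: cbm_real.
Qed.

Section inhomogeneous.
Variable P : nat -> R.-pker T ~> T.

Fixpoint revol (k i : nat) f : T -> R :=
  if i is i'.+1 then rop (P k.+1) (revol k.+1 i' f) else f.

Lemma bmeas_revol k i f : bmeas f -> bmeas (revol k i f).
Proof. by move=> bf; elim: i k => //= i IH k; exact: bmeas_rop. Qed.

Lemma revol_evol k i f x : (revol k i f x)%:C%C = evol P k i (fun y => (f y)%:C%C) x.
Proof.
elim: i k x => //= i IH k x; rewrite -cop_real.
by congr (cop _ _ x); apply/funext => y; rewrite IH.
Qed.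

Lemma revolD k i j f x : revol k (i + j) f x = revol k i (revol (k + i) j f) x.
Proof.
elim: i k x => [|i IH] k x; first by rewrite addn0.
by rewrite /=; congr (rop _ _ x); apply/funext => y; rewrite IH addSnnS.
Qed.

Lemma rosc_revol0 k i f c : bmeas f -> rosc_le f c -> rosc_le (revol k i f) c.
Proof. by move=> bf fc; elim: i k => //= i IH k; apply: rosc_rop => //; exact: bmeas_revol. Qed.

Variables (n m : nat) (q : R).
Hypothesis q01 : 0 <= q < 1.
Hypothesis m_gt0 : (0 < m)%N.
Hypothesis contr : contracts P n m q.

Lemma rosc_revol k i f c : (k + i <= n)%N -> bmeas f -> rosc_le f c ->
  rosc_le (revol k i f) (q ^+ (i %/ m) * c).
Proof.
move=> kin bf fc; have [j ij] := ubnP i; elim: j i k ij kin => // j IH i k; rewrite ltnS => ij kin.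
have [im|mi] := ltnP i m; first by rewrite divn_small// expr0 mul1r; exact: rosc_revol0.
have iE : i = (m + (i - m))%N by rewrite subnKC.
rewrite iE; have -> : revol k (m + (i - m)) f = revol k m (revol (k + m) (i - m) f).
  by apply/funext => x; exact: revolD.
rewrite divnDl// divnn m_gt0 add1n exprS -mulrA; apply/osc_le_real.
have -> : (fun x => (revol k m (revol (k + m) (i - m) f) x)%:C%C) =
   evol P k m (fun x => (revol (k + m) (i - m) f x)%:C%C).
  by apply/funext => x; rewrite revol_evol.
apply: contr; first by rewrite (leq_trans _ kin)// leq_add2l.
  exact/cbm_real/bmeas_revol.
apply/osc_le_real; apply: IH; last by rewrite -addnA subnKC.
by rewrite (leq_trans _ ij)// iE addKn -[X in (X < _)%N]add0n ltn_add2r.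
Qed.

Lemma rosc_rec (f : nat -> T -> R) (e : R) :
  (forall k, (k <= n)%N -> bmeas (f k)) ->
  (forall x y, f n x = f n y) -> 0 <= e ->
  (forall k, (k < n)%N ->
    rosc_le (fun x => f k x - rop (P k.+1) (f k.+1) x) e) ->
  forall k, (k <= n)%N -> rosc_le (f k) (m%:R / (1 - q) * e).
Proof.
move=> bf fn e0 fe k kn; apply/osc_le_real.
apply: (osc_rec q01 contr m_gt0 (f := fun k x => (f k x)%:C%C)) => //.
- by move=> k' k'n; exact/cbm_real/bf.
- by move=> x y; rewrite (fn x y).
move=> k' k'n; rewrite (_ : (fun x => _) = (fun x => (f k' x - rop (P k'.+1) (f k'.+1) x)%:C%C)).
  by apply/osc_le_real; exact: fe.
by apply/funext => x; rewrite cop_real rmorphB.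
Qed.

End inhomogeneous.

(** The partial sums satisfy S(m + N) = m + q S(N), and S(N) <= S(m + N). *)
Lemma sum_decay_le (m N : nat) (q : R) : (0 < m)%N -> 0 <= q < 1 ->
  \sum_(i < N) q ^+ (i %/ m) <= m%:R / (1 - q).
Proof.
move=> m_gt0 /andP[q0 q1]; set S := fun N => \sum_(i < N) q ^+ (i %/ m).
have Sm M : S (m + M)%N = m%:R + q * S M.
  rewrite /S big_split_ord/=; congr (_ + _).
    rewrite (eq_bigr (fun=> 1)) ?sumr_const ?card_ord// => i _.
    by rewrite divn_small.
  rewrite mulr_sumr; apply: eq_bigr => i _.
  by rewrite divnDl// divnn m_gt0 add1n exprS.
have SS : S N <= S (m + N)%N.
  rewrite /S addnC big_split_ord/= lerDl sumr_ge0// => i _.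
  exact: exprn_ge0.
by rewrite -/(S N) ler_pdivlMr ?subr_gt0//; rewrite Sm in SS; lra.
Qed.

(* One-step errors do not accumulate: an error made at time j is tested against a
   function pulled back over k - j steps, whose oscillation has decayed. *)
Lemma mclose_chain (P : nat -> R.-pker T ~> T) n m q
    (mu nu : nat -> probability T R) (e e0 : R) :
  0 <= q < 1 -> (0 < m)%N -> contracts P n m q -> 0 <= e ->
  (forall k f, (k < n)%N -> bmeas f ->
     \int[mu k.+1]_x f x = \int[mu k]_x rop (P k.+1) f x) ->
  (forall k f c, (k < n)%N -> bmeas f -> rosc_le f c ->
     `|\int[nu k.+1]_x f x - \int[nu k]_x rop (P k.+1) f x| <= e * c) ->
  mclose (mu 0%N) (nu 0%N) e0 ->
  forall k, (k <= n)%N ->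
    mclose (mu k) (nu k) (e * (m%:R / (1 - q)) + e0 * q ^+ (k %/ m)).
Proof.
move=> q01 m_gt0 contr e_ge0 muP nuP mn0 k kn f c bf fc.
have c0 := rosc_le_ge0 fc.
have rec i j : (j + i <= n)%N ->
  `|\int[mu (j + i)%N]_x f x - \int[nu (j + i)%N]_x f x| <=
    e * c * (\sum_(l < i) q ^+ (l %/ m)) +
    `|\int[mu j]_x revol P j i f x - \int[nu j]_x revol P j i f x|.
  elim: i j => [|i IH] j ji; first by rewrite big_ord0 mulr0 add0r addn0.
  have jn : (j < n)%N by rewrite (leq_trans _ ji)// addnS ltnS leq_addr.
  have ji' : (j.+1 + i <= n)%N by rewrite addSnnS.
  rewrite -addSnnS (le_trans (IH _ ji'))// big_ord_recr/= mulrDr -addrA lerD2l.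
  have bh : bmeas (revol P j.+1 i f) by exact: bmeas_revol.
  have := nuP j _ _ jn bh (rosc_revol m_gt0 contr ji' bf fc).
  rewrite muP//; set A := \int[mu j]_x _; set B := \int[nu j.+1]_x _; set D := \int[nu j]_x _.
  move=> h; have -> : A - B = (A - D) - (B - D) by ring.
  by have := ler_normB (A - D) (B - D); lra.
have := rec k 0%N kn; rewrite add0n => /le_trans; apply.
have h := mn0 _ _ (bmeas_revol P 0 k bf) (rosc_revol m_gt0 contr (i := k) (k := 0%N) kn bf fc).
have h2 := ler_wpM2l (mulr_ge0 e_ge0 c0) (sum_decay_le k m_gt0 q01).
lra.
Qed.

End real_evolution.

(** * Kernel powers and contraction for slowly varying kernels *)

Section kernel_powers.
Context d (T : measurableType d) (R : realType).
Implicit Types (Q : R.-pker T ~> T) (f : T -> R).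

(** Serves both for invariance (nu = mu) and for composing kernels (mu, nu successive powers). *)
Lemma Rintegral_rop Q (mu nu : {measure set T -> \bar R}) f :
  mu setT = 1%E -> nu setT = 1%E ->
  (forall A, measurable A -> (\int[mu]_x Q x A = nu A)%E) ->
  bmeas f -> \int[nu]_x f x = \int[mu]_x rop Q f x.
Proof.
move=> mu1 nu1 muQ bf.
pose L (f : T -> R) := \int[nu]_x f x - \int[mu]_x rop Q f x.
apply/subr0_eq; rewrite -/(L f).
apply: (@bounded_functional_eq0 _ _ _ L _ _ 2) => //.
- move=> f1 f2 b1 b2; rewrite /L; under [X in _ - X]eq_Rintegral do rewrite ropD//.
  by rewrite !bmeas_RintegralD//; [ring|exact: bmeas_rop..].
- move=> c f1 b1; rewrite /L.
  under [X in _ - X]eq_Rintegral => x _ do rewrite /rop bmeas_RintegralZ ?prob_kernel//.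
  rewrite !bmeas_RintegralZ//; [rewrite /rop; ring|].
  exact: bmeas_rop.
- move=> f1 e b1 f1e; rewrite /L (le_trans (ler_normB _ _))// mulrDl mul1r lerD//.
    exact: bmeas_Rintegral_norm_le.
  apply: bmeas_Rintegral_norm_le => //; first exact: bmeas_rop.
  by move=> x; apply: bmeas_Rintegral_norm_le => //; exact: prob_kernel.
- move=> A mA; rewrite /L; apply/eqP; rewrite subr_eq0; apply/eqP.
  rewrite /Rintegral integral_indic// setIT -muQ//; congr fine.
  apply: eq_integral => x _; rewrite /rop /Rintegral integral_indic// setIT fineK//.
  rewrite ge0_fin_numE// (@le_lt_trans _ _ (Q x setT))//.
    by apply: le_measure; rewrite ?inE.
  by rewrite prob_kernel ltry.
Qed.

Lemma kpow_setT Q m x : kpow Q m x setT = 1%E.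
Proof.
elim: m x => [|m IH] x /=; first by rewrite /kdirac diracT.
transitivity (\int[kpow Q m x]_y 1)%E; last by rewrite integral_cst// mul1e.
by apply: eq_integral => y _; exact: prob_kernel.
Qed.

Lemma kpow_revol Q m k f x : bmeas f ->
  \int[kpow Q m x]_y f y = revol (fun=> Q) k m f x.
Proof.
elim: m f k => [|m IH] f k bf.
  rewrite /= /Rintegral integral_dirac//; last exact/measurable_EFinP/bf.1.
  by rewrite diracE mem_set// mul1e.
(* [kpow] adds its new step at the end and [revol] at the beginning, so the last step is split
   off. *)
rewrite -addn1 revolD/= addn1 -IH; last exact: bmeas_rop.
by apply: Rintegral_rop => //; exact: kpow_setT.
Qed.

Lemma kpow_evol Q m k (f : T -> R[i]) x : cbm f ->
  evol (fun=> Q) k m f x = cint (kpow Q m x) f.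
Proof.
move=> [bR bI]; have h : forall i k x, evol (fun=> Q) k i f x =
    (revol (fun=> Q) k i (fun y => Re (f y)) x +i*
     revol (fun=> Q) k i (fun y => Im (f y)) x)%C.
  elim=> [|i IH] k' y /=; first exact: complex_eta.
  by rewrite /cop /cint; congr (_ +i* _)%C; apply: eq_Rintegral => z _; rewrite IH.
by rewrite h /cint !(kpow_revol Q m k).
Qed.

Lemma contracts_homogeneous Q n m r :
  (forall x y, (tv_dist (kpow Q m x) (kpow Q m y) <= r%:E)%E) ->
  contracts (fun=> Q) n m r.
Proof.
move=> tv k f c _ bf fc x y; rewrite !kpow_evol//.
by apply: cn_cint_tv => //; exact: kpow_setT.
Qed.

Lemma evol_perturb (P P' : nat -> R.-pker T ~> T) e k i (f : T -> R[i]) c :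
  (forall j x, (k <= j < k + i)%N -> (tv_dist (P j.+1 x) (P' j.+1 x) <= e%:E)%E) ->
  cbm f -> osc_le f c ->
  forall x, cn (evol P k i f x - evol P' k i f x) <= i%:R * e * c.
Proof.
move=> tv bf fc; elim: i k tv => [|i IH] k tv x.
  by rewrite /= subrr cn0 !mul0r.
have bE (P0 : nat -> R.-pker T ~> T) : cbm (evol P0 k.+1 i f) by exact: cbm_evol.
have oE : osc_le (evol P k.+1 i f) c.
  by elim: (i) (k.+1) => //= i' IH' k'; apply: osc_cop => //; exact: cbm_evol.
pose A := cop (P k.+1) (evol P k.+1 i f) x; pose B := cop (P' k.+1) (evol P' k.+1 i f) x.
pose D := cop (P' k.+1) (evol P k.+1 i f) x.
rewrite -[X in cn X]/(A - B); have -> : A - B = (A - D) + (D - B) by ring.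
rewrite (le_trans (cnD _ _))// -natr1 mulrDl mul1r mulrDl addrC lerD//.
- rewrite /D /B -copB//; apply: cn_cop; first exact: cbmB.
  by apply: IH => j y /andP[kj ji]; apply: tv; rewrite ltnW//= -addSnnS.
- apply: cn_cint_tv => //; [exact: prob_kernel|exact: prob_kernel|].
  by apply: tv; rewrite leqnn/= addnS ltnS leq_addr.
Qed.

(** Over a window the kernels are frozen to a single [Q], which contracts at rate [r]; the swap
    costs m e c pointwise, twice that in oscillation. *)
Lemma contracts_perturb (P : nat -> R.-pker T ~> T) n m r e :
  (forall k, (k + m <= n)%N -> exists Q,
    (forall x y, (tv_dist (kpow Q m x) (kpow Q m y) <= r%:E)%E) /\
    forall j x, (k <= j < k + m)%N -> (tv_dist (P j.+1 x) (Q x) <= e%:E)%E) ->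
  contracts P n m (r + 2 * (m%:R * e)).
Proof.
move=> hP k f c kmn bf fc; have [Q [tvQ tvP]] := hP k kmn.
have -> : (r + 2 * (m%:R * e)) * c = 2 * (m%:R * e * c) + r * c by ring.
rewrite (_ : evol P k m f = (fun x => (evol P k m f x - evol (fun=> Q) k m f x) +
    evol (fun=> Q) k m f x)); last by apply/funext => x; rewrite subrK.
apply: osc_leD; last exact: (contracts_homogeneous (n := n) tvQ).
by apply: osc_le_norm; exact: evol_perturb.
Qed.

End kernel_powers.

(** * The asymptotic variance of a stationary chain *)

Lemma geometric_steps_limit (R : realType) (v : nat -> R) (m : nat) (q B : R) :
  (0 < m)%N -> 0 <= q < 1 -> 0 <= B ->
  (forall N, `|v N.+1 - v N| <= B * q ^+ (N.+1 %/ m)) ->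
  forall M, `|limn v - v M| <= B * (m%:R / (1 - q)) * q ^+ (M %/ m).
Proof.
move=> m_gt0 q01 B0 vd; move: (q01) => /andP[q0 q1].
have vM M j : `|v (M + j)%N - v M| <= B * (m%:R / (1 - q)) * q ^+ (M %/ m).
  have h1 : `|v (M + j)%N - v M| <= \sum_(i < j) `|v (M + i).+1 - v (M + i)%N|.
    elim: j => [|j IH]; first by rewrite addn0 subrr normr0 big_ord0.
    rewrite big_ord_recr/= addnS -[v (M + j).+1](subrK (v (M + j)%N)) -addrA addrC.
    by rewrite (le_trans (ler_normD _ _))// lerD// addrK.
  rewrite (le_trans h1)// mulrAC -mulrA.
  apply: (@le_trans _ _ (\sum_(i < j) B * q ^+ (M %/ m) * q ^+ (i %/ m))).
    apply: ler_sum => i _; rewrite (le_trans (vd _))// -mulrA ler_wpM2l// -exprD.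
    apply: ler_wiXn2l => //; first exact: ltW.
    (* The integer quotient is superadditive, so the decay from time M onwards splits into two
       factors. *)
    rewrite leq_divRL// mulnDl (@leq_trans (M + i))//.
    by rewrite leq_add// leq_divM.
  rewrite -mulr_sumr -!mulrA ler_wpM2l// mulrC [leRHS]mulrC ler_wpM2r ?exprn_ge0//.
  exact: sum_decay_le.
have cv : cvgn v.
  pose u i := v i.+1 - v i.
  have -> : v = (fun n => v 0%N + series u n).
    apply/funext => n; rewrite /series/= /u telescope_sumr// addrC subrK//.
  apply: is_cvgD; first exact: is_cvg_cst.
  apply: normed_cvg; apply: nondecreasing_is_cvgn.
    by apply/nondecreasing_seqP => n; rewrite /normed_series_of /series/= big_nat_recr//= lerDl.
  exists (B * (m%:R / (1 - q))) => _ [n _ <-]; rewrite /normed_series_of /series/= big_mkord.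
  apply: (@le_trans _ _ (\sum_(i < n) B * q ^+ (i %/ m))).
    apply: ler_sum => i _; rewrite (le_trans (vd _))// ler_wpM2l//.
    by apply: ler_wiXn2l => //; [exact: ltW|exact: leq_div2r].
  by rewrite -mulr_sumr ler_wpM2l// sum_decay_le.
move=> M; rewrite ler_norml; set b := B * _ * _.
have near_v : \forall n \near \oo, `|v n - v M| <= b.
  by exists M => // n /= Mn; rewrite -(subnKC Mn) vM.
rewrite lerBrDr lerBlDr; apply/andP; split.
- apply: limr_ge => //; apply: filterS near_v => n; rewrite ler_norml => /andP[h _].
  by move: h; rewrite lerBrDr.
- apply: limr_le => //; apply: filterS near_v => n; rewrite ler_norml => /andP[_ h].
  by move: h; rewrite lerBlDr.
Qed.

Section homogeneous_chain.
Context d (T : measurableType d) (R : realType).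
Variables (m : nat) (r c : R) (Q : R.-pker T ~> T) (mu : probability T R) (g : T -> R).
Hypothesis m_gt0 : (0 < m)%N.
Hypothesis r01 : 0 <= r < 1.
Hypothesis contr : forall n, contracts (fun=> Q) n m r.
Hypothesis bg : bmeas g.
Hypothesis gc : rosc_le g c.
Hypothesis muQ : forall f, bmeas f -> \int[mu]_x f x = \int[mu]_x rop Q f x.

Let G := m%:R / (1 - r).
Let r0 : 0 <= r. Proof. by case/andP: r01. Qed.
Let r1 : 0 < 1 - r. Proof. by case/andP: r01 => _; rewrite subr_gt0. Qed.
Let G0 : 0 <= G. Proof. by rewrite /G divr_ge0// ltW. Qed.
Let c0 : 0 <= c. Proof. exact: rosc_le_ge0 gc. Qed.
Let muT : mu setT = 1%E. Proof. exact: probability_setT. Qed.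

(* [pcorr N x] is the expectation of g(Y_1) + ... + g(Y_N) given Y_0 = x. *)
Definition pcorr N : T -> R := iter N (fun h => rop Q (fun y => g y + h y)) (fun=> 0).

Lemma bmeas_pcorr N : bmeas (pcorr N).
Proof. by elim: N => [|N IH] /=; [exact: bmeas_cst|exact/bmeas_rop/bmeasD]. Qed.

Lemma pcorrS N x : pcorr N.+1 x = rop Q g x + rop Q (pcorr N) x.
Proof. by rewrite /= ropD//; exact: bmeas_pcorr. Qed.

Lemma rosc_pcorr N : rosc_le (pcorr N) (G * c).
Proof.
have -> : pcorr N = pcorr (N - 0) by rewrite subn0.
apply: (@rosc_rec _ _ _ (fun=> Q) N m r r01 m_gt0 (@contr N) (fun k => pcorr (N - k))) => //.
- by move=> *; exact: bmeas_pcorr.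
- by move=> x y; rewrite subnn.
move=> k kN; rewrite (_ : (fun x => _) = rop Q g); first exact: rosc_rop.
by apply/funext => x; rewrite -[in X in X - _](subnSK kN) pcorrS addrK.
Qed.

Lemma pcorr_step N k : (fun x => pcorr N.+1 x - pcorr N x) = revol (fun=> Q) k N.+1 g.
Proof.
elim: N k => [|N IH] k; apply/funext => x.
  by rewrite pcorrS /= rop_cst addr0 subr0.
rewrite (pcorrS N.+1) (pcorrS N) opprD addrACA subrr add0r -ropB; try exact: bmeas_pcorr.
by rewrite (IH k.+1).
Qed.

(** The Green-Kubo sum truncated at lag N: the variance of [g] plus twice its covariances with
    g(Y_j), 1 <= j <= N. *)
Definition psvar N := gkvar mu g (pcorr N).

Lemma psvar_step N : `|psvar N.+1 - psvar N| <= 2 * (c * c) * r ^+ (N.+1 %/ m).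
Proof.
rewrite /psvar /gkvar opprD addrACA subrr add0r -mulrBr normrM ger0_norm//.
rewrite -mulrA ler_wpM2l// -covBr//; try exact: bmeas_pcorr.
rewrite (pcorr_step N 0) -mulrA [c * r ^+ _]mulrC.
apply: cov_le => //; first exact: bmeas_revol.
exact: (rosc_revol m_gt0 (@contr N.+1)).
Qed.

Definition avar := limn psvar.

Lemma avar_psvar N : `|avar - psvar N| <= 2 * (c * c) * G * r ^+ (N %/ m).
Proof. by apply: geometric_steps_limit => //; [rewrite !mulr_ge0|exact: psvar_step]. Qed.

(** Truncation errors are geometric in the remaining time, hence summable independently of n. *)
Lemma sum_avar_psvar n : `|\sum_(k < n) (psvar (n - k.+1) - avar)| <= 2 * (c * c) * G ^+ 2.
Proof.
rewrite (le_trans (ler_norm_sum _ _ _))//.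
rewrite (reindex_inj rev_ord_inj)/=.
apply: (@le_trans _ _ (\sum_(k < n) 2 * (c * c) * G * r ^+ (k %/ m))).
  apply: ler_sum => k _; rewrite distrC.
  by rewrite (_ : (n - (n - k.+1).+1 = k)%N) ?avar_psvar//; rewrite subnSK// subKn// ltnW.
have -> : 2 * (c * c) * G ^+ 2 = 2 * (c * c) * G * G by ring.
rewrite -mulr_sumr; apply: ler_wpM2l; last exact: sum_decay_le.
by rewrite mulr_ge0// !mulr_ge0.
Qed.

Section stationary_chain.
Context d' (Omega : measurableType d') (P : probability Omega R).
Variable Y : nat -> {RV P >-> T}.
Hypothesis chainY : forall N, markov_chain N mu (fun=> Q) Y.

Let PT : P setT = 1%E. Proof. exact: probability_setT. Qed.
Let gbar y := g y - \int[mu]_x g x.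
Let S k w := \sum_(j < k) gbar (Y j.+1 w).

Let bgbar : bmeas gbar. Proof. by apply: bmeasB => //; exact: bmeas_cst. Qed.

Let stationary k f : bmeas f -> \int[P]_w f (Y k w) = \int[mu]_x f x.
Proof.
elim: k f => [|k IH] f bf.
  by rewrite -(law_Rintegral Y 0 bf) (law0 (chainY 0) bf).
have kk : (k < k.+1)%N by [].
rewrite -(law_Rintegral Y k.+1 bf) (lawP (chainY k.+1) kk bf).
by rewrite (law_Rintegral Y k (bmeas_rop Q bf)) (IH _ (bmeas_rop Q bf)) -(muQ bf).
Qed.

Let pS N k : (k <= N)%N -> @pmeas _ _ _ _ _ P Y N (S k).
Proof.
rewrite /S; elim: k => [|k IH] kN.
  by under eq_fun do rewrite big_ord0; exact: bmeas_cst.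
under eq_fun do rewrite big_ord_recr/=.
apply: bmeasD; first by apply: IH; rewrite ltnW.
exact: (pmeas_comp Y kN bgbar).
Qed.

Let bS k : bmeas (S k). Proof. exact: pmeas_bmeas (pS (leqnn k)). Qed.

Let S_mean k : \int[P]_w S k w = 0.
Proof.
rewrite /S; elim: k => [|k IH].
  by under eq_Rintegral do rewrite big_ord0; rewrite Rintegral1_cst.
under eq_Rintegral do rewrite big_ord_recr/=.
rewrite bmeas_RintegralD//; [|exact: bS|exact: (bmeas_comp Y k.+1 bgbar)].
rewrite IH add0r (stationary k.+1 bgbar) /gbar bmeas_RintegralB//; last exact: bmeas_cst.
by rewrite Rintegral1_cst// subrr.
Qed.

(** The second moment grouped by the earlier index: each new summand brings its variance and twice
    its covariance with all later ones. At k = n no future is left. *)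
Let S_sqr n k : (k <= n)%N ->
  \int[P]_w (S k w * S k w) + 2 * \int[P]_w (S k w * pcorr (n - k) (Y k w)) =
  \sum_(j < k) psvar (n - j.+1).
Proof.
elim: k => [|k IH] kn.
  rewrite big_ord0; have S0 w : S 0 w = 0 by rewrite /S big_ord0.
  under eq_Rintegral do rewrite S0 mul0r.
  under [X in _ + 2 * X]eq_Rintegral do rewrite S0 mul0r.
  by rewrite Rintegral1_cst// mulr0 addr0.
rewrite big_ord_recr/= -IH; last exact: ltnW.
set N := (n - k.+1)%N; have -> : (n - k = N.+1)%N by rewrite /N subnSK.
have SE w : S k.+1 w = S k w + gbar (Y k.+1 w) by rewrite /S big_ord_recr.
have bYg : bmeas (fun w => gbar (Y k.+1 w)) by exact: (bmeas_comp Y k.+1 bgbar).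
have bp := bmeas_pcorr N; have bYp : bmeas (fun w => pcorr N (Y k.+1 w)).
  exact: (bmeas_comp Y k.+1 bp).
have bYp' : bmeas (fun w => pcorr N.+1 (Y k w)).
  exact: (bmeas_comp Y k (bmeas_pcorr N.+1)).
have bSk := bS k.
have e1 : \int[P]_w (S k.+1 w * S k.+1 w) = \int[P]_w (S k w * S k w) +
    2 * \int[P]_w (S k w * gbar (Y k.+1 w)) + \int[mu]_x (gbar x * gbar x).
  rewrite -(stationary k.+1 (bmeasM bgbar bgbar)) -bmeas_RintegralZ//; last exact: bmeasM.
  rewrite -bmeas_RintegralD//; [|exact: bmeasM|exact/bmeasZ/bmeasM].
  rewrite -bmeas_RintegralD//; [|apply: bmeasD; [exact: bmeasM|exact/bmeasZ/bmeasM]|exact: bmeasM].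
  by apply: eq_Rintegral => w _; rewrite SE; ring.
have e2 : \int[P]_w (S k.+1 w * pcorr N (Y k.+1 w)) =
    \int[P]_w (S k w * pcorr N (Y k.+1 w)) + \int[mu]_x (gbar x * pcorr N x).
  rewrite -(stationary k.+1 (bmeasM bgbar bp)) -bmeas_RintegralD//; try exact: bmeasM.
  by apply: eq_Rintegral => w _; rewrite SE; ring.
(* [S] uses the centred [gbar] and [pcorr] the raw [g]; the difference is a constant, killed because
   [S k] has mean 0. *)
have e3 : \int[P]_w (S k w * gbar (Y k.+1 w)) + \int[P]_w (S k w * pcorr N (Y k.+1 w)) =
    \int[P]_w (S k w * pcorr N.+1 (Y k w)).
  rewrite -bmeas_RintegralD//; try exact: bmeasM.
  under eq_Rintegral do rewrite -mulrDr.
  have kk : (k < k.+1)%N by [].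
  rewrite (markov_property (chainY k.+1) kk (bmeasD bgbar bp) (pS (leqnn k))).
  have rE x : rop Q (fun y => gbar y + pcorr N y) x = pcorr N.+1 x - \int[mu]_x g x.
    by rewrite ropD// /gbar ropB//; [rewrite rop_cst pcorrS; ring|exact: bmeas_cst].
  under eq_Rintegral do rewrite rE mulrBr [X in _ - X]mulrC.
  rewrite bmeas_RintegralB//; [|exact: bmeasM|exact: bmeasZ].
  by rewrite bmeas_RintegralZ// S_mean mulr0 subr0.
have e4 : psvar N = \int[mu]_x (gbar x * gbar x) + 2 * \int[mu]_x (gbar x * pcorr N x).
  rewrite /psvar /gkvar (cov_shift mu (\int[mu]_x g x) (\int[mu]_x g x) bg bg).
  rewrite (cov_shift mu (\int[mu]_x g x) 0 bg bp) subrr !mul0r !subr0.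
  by under [X in _ + 2 * X = _]eq_Rintegral do rewrite subr0.
by rewrite e1 e2 e4 -e3; ring.
Qed.

Lemma variance_sum n :
  fine 'V_P[fun w => \sum_(1 <= j < n.+1) g (Y j w)] = \sum_(k < n) psvar (n - k.+1).
Proof.
have sE w : \sum_(1 <= j < n.+1) g (Y j w) = S n w + n%:R * \int[mu]_x g x.
  rewrite big_add1/= big_mkord /S /gbar sumrB sumr_const card_ord mulr_natl.
  by rewrite subrK.
have mS : \int[P]_w (\sum_(1 <= j < n.+1) g (Y j w)) = n%:R * \int[mu]_x g x.
  under eq_Rintegral do rewrite sE.
  by rewrite bmeas_RintegralD//; [rewrite S_mean add0r Rintegral1_cst|exact: bmeas_cst].
rewrite -(S_sqr (leqnn n)) subnn.
under [X in _ + 2 * X]eq_Rintegral do rewrite mulr0.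
rewrite Rintegral1_cst// mulr0 addr0 /variance covariance.unlock !expectation.unlock.
congr fine; apply: eq_integral => w _; congr (_%:E).
pose Z w := \sum_(1 <= j < n.+1) g (Y j w).
change ((Z w - \int[P]_w Z w) * (Z w - \int[P]_w Z w) = S n w * S n w).
by rewrite mS /Z sE addrK.
Qed.

(** By [variance_sum] the normalised variance is a Cesaro mean of [psvar], within O(1/n) of [avar];
    in particular the limit exists. *)
Lemma asymptotic_varianceE : asymptotic_variance g Y = avar.
Proof.
rewrite /asymptotic_variance; apply: cvg_lim => //.
rewrite -cvg_shiftS; apply/subr_cvg0; apply: norm_cvg0.
have h0 : (fun n => 2 * (c * c) * G ^+ 2 * harmonic n) @ \oo --> (0 : R).
  rewrite -[X in _ --> X](mulr0 (2 * (c * c) * G ^+ 2)); apply: cvgM; first exact: cvg_cst.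
  exact: cvg_harmonic.
apply: (squeeze_cvgr _ (cvg_cst 0) h0); apply: nearW => n.
rewrite normr_ge0/= variance_sum.
have -> : n.+1%:R^-1 * (\sum_(k < n.+1) psvar (n.+1 - k.+1)) - avar =
    (\sum_(k < n.+1) (psvar (n.+1 - k.+1) - avar)) * n.+1%:R^-1.
  have x0 : n.+1%:R != 0 :> R by rewrite pnatr_eq0.
  by rewrite sumrB sumr_const card_ord -[avar *+ _]mulr_natl mulrBl mulrC [n.+1%:R * _]mulrC mulfK.
rewrite normrM [`|_^-1|]ger0_norm// ler_wpM2r//.
exact: sum_avar_psvar.
Qed.

End stationary_chain.
End homogeneous_chain.

(** * Lipschitz families of kernels *)

Lemma le_of_decay (R : realType) (q a b x : R) : 0 <= q < 1 ->
  (forall N, x <= a + b * q ^+ N) -> x <= a.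
Proof.
move=> /andP[q0 q1] h.
have cv : (fun N => a + b * q ^+ N) @ \oo --> a.
  rewrite -[X in _ --> X]addr0; apply: cvgD; first exact: cvg_cst.
  rewrite -[X in _ --> X](mulr0 b); apply: cvgM; first exact: cvg_cst.
  by apply: cvg_expr; rewrite ger0_norm.
rewrite -(cvg_lim _ cv)//; apply: limr_ge; first by apply: cvgP cv.
exact: nearW.
Qed.

Lemma sum3_le (R : realType) (x y z w : R) : 0 <= x -> 0 <= y -> 0 <= z ->
  x + y + z <= w -> [/\ x <= w, y <= w & z <= w].
Proof. by move=> *; split; lra. Qed.

Lemma norm_sub_le1 (R : realType) (x y : R) : 0 <= x <= 1 -> 0 <= y <= 1 -> `|x - y| <= 1.
Proof.
by move=> /andP[? ?] /andP[? ?]; rewrite ler_norml; apply/andP; split; lra.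
Qed.

Ltac nneg := repeat (first [done | exact: ltW | exact: sqr_ge0 | exact: expR_ge0
  | apply: divr_ge0 | apply: mulr_ge0 | apply: addr_ge0 | apply: exprn_ge0]).

Section kernel_family.
Context d (T : measurableType d) (R : realType).
Variables (Q : R -> R.-pker T ~> T) (mu : R -> probability T R) (g : R -> T -> R).
Variables (L r K Cg : R) (m : nat).
Hypothesis L_ge0 : 0 <= L.
Hypothesis tvL : forall (u v : R) x, u \in `[0, 1] -> v \in `[0, 1] ->
  (tv_dist (Q u x) (Q v x) <= (L * `|u - v|)%:E)%E.
Hypothesis m_gt0 : (0 < m)%N.
Hypothesis r01 : 0 <= r < 1.
Hypothesis tvm : forall (u : R) x y, u \in `[0, 1] ->
  (tv_dist (kpow (Q u) m x) (kpow (Q u) m y) <= r%:E)%E.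
Hypothesis bg : forall u : R, u \in `[0, 1] -> bmeas (g u).
Hypothesis gK : forall (u : R) x, u \in `[0, 1] -> `|g u x| <= K.
Hypothesis Cg_ge0 : 0 <= Cg.
Hypothesis g_lip : forall (u v : R) x, u \in `[0, 1] -> v \in `[0, 1] ->
  `|g u x - g v x| <= Cg * `|u - v|.
Hypothesis muQ : forall (u : R) f, u \in `[0, 1] -> bmeas f ->
  \int[mu u]_x f x = \int[mu u]_x rop (Q u) f x.

Let G := m%:R / (1 - r).
Let G0 : 0 <= G. Proof. by case/andP: r01 => _ r1; rewrite /G divr_ge0// subr_ge0 ltW. Qed.
Let I0 : (0 : R) \in `[0, 1]. Proof. by rewrite in_itv/= lexx ler01. Qed.
Let K0 : 0 <= K. Proof. exact: le_trans (gK point I0). Qed.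

Let contr u n : u \in `[0, 1] -> contracts (fun=> Q u) n m r.
Proof. by move=> u1; apply: contracts_homogeneous => x y; exact: tvm. Qed.

Let gc u : u \in `[0, 1] -> rosc_le (g u) (2 * K).
Proof. by move=> u1; apply: rosc_le_norm => x; exact: gK. Qed.

Let g_osc u v : u \in `[0, 1] -> v \in `[0, 1] ->
  rosc_le (fun x => g u x - g v x) (2 * (Cg * `|u - v|)).
Proof. by move=> u1 v1; apply: rosc_le_norm => x; exact: g_lip. Qed.

Lemma rop_lipschitz u v f c x : u \in `[0, 1] -> v \in `[0, 1] -> bmeas f ->
  rosc_le f c -> `|rop (Q u) f x - rop (Q v) f x| <= L * `|u - v| * c.
Proof.
move=> u1 v1 bf fc; apply: (@tv_dist_Rintegral _ _ _ (Q u x) (Q v x) _ _ _ _ f point) => //.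
- exact: prob_kernel.
- exact: prob_kernel.
- exact: tvL.
Qed.

(** Both laws are viewed as constant sequences along the chain of [Q u], which [mu v] follows up to
    L |u - v| per step. The initial error 2 is forgotten as time tends to infinity. *)
Lemma mclose_invariant u v : u \in `[0, 1] -> v \in `[0, 1] ->
  mclose (mu u) (mu v) (L * G * `|u - v|).
Proof.
move=> u1 v1 f c bf fc; apply: (@le_of_decay _ r _ (2 * c)) => // N.
have h k : mclose (mu u) (mu v) (L * `|u - v| * G + 2 * r ^+ (k %/ m)).
  have e0 : 0 <= L * `|u - v| by exact: mulr_ge0.
  have H := @mclose_chain _ _ _ (fun=> Q u) k m r (fun=> mu u) (fun=> mu v) _ (2 : R)
    r01 m_gt0 (@contr u k u1) e0.
  apply: (H _ _ _ k (leqnn k)).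
  - by move=> _ f' _ bf'; exact: muQ.
  - move=> _ f' c' _ bf' fc'; have pT := @probability_setT _ _ _ (mu v).
    rewrite (muQ v1 bf') -bmeas_RintegralB//; try exact: bmeas_rop.
    apply: bmeas_Rintegral_norm_le => //; first by apply: bmeasB; exact: bmeas_rop.
    by move=> x; rewrite [`|u - v|]distrC; exact: rop_lipschitz.
  - move=> f' c' bf' fc'.
    have h1 := rosc_mean (mu u) point bf' fc'; have h2 := rosc_mean (mu v) point bf' fc'.
    rewrite -(subrKA (f' point)) (le_trans (ler_normD _ _))// distrC; lra.
have := h (N * m)%N _ _ bf fc; rewrite mulnK// => /le_trans; apply.
by rewrite le_eqVlt; apply/orP; left; apply/eqP; ring.
Qed.

Let A u N := pcorr (Q u) (g u) N.

Let bA u N : u \in `[0, 1] -> bmeas (A u N).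
Proof. by move=> u1; apply: bmeas_pcorr; exact: bg. Qed.

Let oA u N : u \in `[0, 1] -> rosc_le (A u N) (G * (2 * K)).
Proof.
move=> u1; apply: rosc_pcorr => //; [|exact: bg|exact: gc].
by move=> n; exact: contr.
Qed.

(* Bounds the oscillation of (Q_u - Q_v) (g_v + A_v), divided by |u - v|. *)
Let D := 2 * (L * (2 * K + G * (2 * K))).
Let D0 : 0 <= D.
Proof. by rewrite /D; nneg. Qed.

Let swap_osc u v N : u \in `[0, 1] -> v \in `[0, 1] ->
  rosc_le (fun x => rop (Q u) (fun y => g v y + A v N y) x -
                    rop (Q v) (fun y => g v y + A v N y) x) (D * `|u - v|).
Proof.
move=> u1 v1; have -> : D * `|u - v| = 2 * (L * `|u - v| * (2 * K + G * (2 * K))) by rewrite /D; ring.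
apply: rosc_le_norm => x; apply: rop_lipschitz => //; first by apply: bmeasD; [exact: bg|exact: bA].
by apply: rosc_leD; [exact: gc|exact: oA].
Qed.

(** The difference solves the recursion of [Q u] with source Q_u (g_u - g_v) + (Q_u - Q_v) (g_v +
    A_v), of order |u - v|; [rosc_rec] makes the bound uniform in N. *)
Lemma rosc_pcorr_lipschitz u v N : u \in `[0, 1] -> v \in `[0, 1] ->
  rosc_le (fun x => A u N x - A v N x) (G * (2 * Cg + D) * `|u - v|).
Proof.
move=> u1 v1; rewrite -mulrA.
pose f k x := A u (N - k) x - A v (N - k) x.
have -> : (fun x => A u N x - A v N x) = f 0%N by apply/funext => x; rewrite /f subn0.
apply: (@rosc_rec _ _ _ (fun=> Q u) N m r r01 m_gt0 (@contr u N u1) f) => //.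
- by move=> k _; apply: bmeasB; exact: bA.
- by move=> x y; rewrite /f subnn /A /= !subrr.
- by nneg.
move=> k kN; rewrite mulrDl -[2 * Cg * _]mulrA.
rewrite (_ : (fun x => _) = (fun x => rop (Q u) (fun y => g u y - g v y) x +
   (rop (Q u) (fun y => g v y + A v (N - k.+1) y) x -
    rop (Q v) (fun y => g v y + A v (N - k.+1) y) x))).
  apply: rosc_leD; last exact: swap_osc.
  by apply: rosc_rop; [apply: bmeasB; exact: bg|exact: g_osc].
apply/funext => x; rewrite /f -(subnSK kN) /A !pcorrS; try exact: bg.
rewrite !ropB ?ropD//; try exact: bg; try exact: bA.
by rewrite -!/(A _ _); ring.
Qed.

Lemma psvar_lipschitz : exists2 C, 0 <= C & forall u v N, u \in `[0, 1] -> v \in `[0, 1] ->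
  `|psvar (Q u) (mu u) (g u) N - psvar (Q v) (mu v) (g v) N| <= C * `|u - v|.
Proof.
pose c := 2 * K; pose c' := G * (2 * K); pose E := G * (2 * Cg + D).
have c0 : 0 <= c by nneg.
have c'0 : 0 <= c' by nneg.
have E0 : 0 <= E by nneg.
exists (4 * (L * G) * (c * c) + 2 * (c * (2 * Cg)) +
  2 * (4 * (L * G) * (c * c') + (c * E + c' * (2 * Cg)))).
  by nneg.
move=> u v N u1 v1; have d0 := normr_ge0 (u - v).
have := @gkvar_close _ _ _ (mu u) (mu v) (L * G * `|u - v|) (g u) (g v) (A u N) (A v N)
  c c' (2 * (Cg * `|u - v|)) (E * `|u - v|).
move=> h; apply: (le_trans (h _ _ _ _ _ _ _ _ _ _ _ _)); last 1 first.
- by rewrite le_eqVlt; apply/orP; left; apply/eqP; ring.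
- by nneg.
- exact: mclose_invariant.
- exact: bg.
- exact: bg.
- exact: bA.
- exact: bA.
- exact: gc.
- exact: gc.
- exact: oA.
- exact: oA.
- exact: g_osc.
- exact: rosc_pcorr_lipschitz.
Qed.

Lemma avar_close : exists2 C, 0 <= C & forall u N, u \in `[0, 1] ->
  `|avar (Q u) (mu u) (g u) - psvar (Q u) (mu u) (g u) N| <= C * r ^+ (N %/ m).
Proof.
exists (2 * (2 * K * (2 * K)) * G); first by nneg.
move=> u N u1; apply: avar_psvar => //; [|exact: bg|exact: gc].
by move=> n; exact: contr.
Qed.

Lemma avar_lipschitz : exists2 C, 0 <= C & forall u v, u \in `[0, 1] -> v \in `[0, 1] ->
  `|avar (Q u) (mu u) (g u) - avar (Q v) (mu v) (g v)| <= C * `|u - v|.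
Proof.
have [C C0 hC] := psvar_lipschitz; have [B B0 hB] := avar_close.
exists C => // u v u1 v1; apply: (@le_of_decay _ r _ (2 * B)) => // N.
have h := hC u v (N * m)%N u1 v1.
have := hB u (N * m)%N u1; have := hB v (N * m)%N v1; rewrite mulnK//.
move: h; rewrite !ler_norml => /andP[? ?] /andP[? ?] /andP[? ?].
by apply/andP; split; lra.
Qed.

Lemma mean_lipschitz : exists2 C, 0 <= C & forall u v, u \in `[0, 1] -> v \in `[0, 1] ->
  `|\int[mu u]_x g u x - \int[mu v]_x g v x| <= C * `|u - v|.
Proof.
exists (L * G * (2 * K) + Cg); first by nneg.
move=> u v u1 v1; have pT := @probability_setT _ _ _ (mu v).
have h1 := mclose_invariant u1 v1 (bg u1) (gc u1).
have h2 : `|\int[mu v]_x g u x - \int[mu v]_x g v x| <= Cg * `|u - v|.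
  rewrite -bmeas_RintegralB//; try exact: bg.
  apply: bmeas_Rintegral_norm_le => //; first by apply: bmeasB; exact: bg.
  by move=> x; exact: g_lip.
rewrite -(subrKA (\int[mu v]_x g u x)) (le_trans (ler_normD _ _))//.
lra.
Qed.

(** * The triangular array against its frozen chains *)

Section array.
Variable n : nat.
Hypothesis n_gt0 : (0 < n)%N.
Hypothesis n_large : 4 * m%:R ^+ 2 * L <= (1 - r) * n%:R.
Variable nu : nat -> probability T R.
(* Kernels vary by O(1/n) over m steps, which degrades the rate r to q. *)
Let q := (1 + r) / 2.
Let Gq := m%:R / (1 - q).
Let node k : R := k%:R / n%:R.
Let P k := Q (node k).
Let xi k x := g (node k) x - \int[nu k]_y g (node k) y.
Hypothesis nuP : forall k f, (k < n)%N -> bmeas f ->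
  \int[nu k.+1]_x f x = \int[nu k]_x rop (P k.+1) f x.
Hypothesis nu0 : forall f, bmeas f -> \int[nu 0]_x f x = \int[mu 0]_x f x.

Let nR : 0 < n%:R :> R. Proof. by rewrite ltr0n. Qed.
Let n_neq0 : n%:R != 0 :> R. Proof. by rewrite gt_eqF. Qed.

Lemma array_rate : 0 <= q < 1.
Proof. by move: r01 => /andP[? ?]; rewrite /q; apply/andP; split; lra. Qed.

Let Gq0 : 0 <= Gq.
Proof. by have /andP[_ q1] := array_rate; rewrite /Gq divr_ge0// subr_ge0 ltW. Qed.

Let node01 k : (k <= n)%N -> node k \in `[0, 1].
Proof. by move=> kn; rewrite in_itv/= divr_ge0//= ler_pdivrMr// mul1r ler_nat. Qed.

Let node_dist i j : (i <= j)%N -> `|node j - node i| = (j - i)%:R / n%:R.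
Proof.
move=> ij; rewrite -mulrBl -natrB// ger0_norm// divr_ge0//.
Qed.

Let node_step k : `|node k.+1 - node k| = n%:R^-1.
Proof. by rewrite node_dist// subSnn mul1r. Qed.

Lemma array_contracts : contracts P n m q.
Proof.
have h : contracts P n m (r + 2 * (m%:R * (L * (m%:R / n%:R)))).
  apply: contracts_perturb => k kmn; exists (Q (node k)).
  have k1 : node k \in `[0, 1] by rewrite node01// (leq_trans _ kmn)// leq_addr.
  split=> [x y|j x /andP[kj jkm]]; first exact: tvm.
  apply: (le_trans (tvL _ _ k1)); first by rewrite node01// (leq_trans _ kmn).
  rewrite lee_fin ler_wpM2l// node_dist; last by rewrite (leq_trans kj).
  by rewrite ler_wpM2r// ler_nat leq_subLR.
move=> k f c kmn bf fc; have := h k f c kmn bf fc.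
move=> oc x y; rewrite (le_trans (oc x y))//.
have c0 : 0 <= c by rewrite (le_trans _ (fc point point))// subrr cn0.
rewrite ler_wpM2r//.
(* [n_large] makes the loss from freezing at most (1 - r) / 2, so the rate stays below [q]. *)
have -> : 2 * (m%:R * (L * (m%:R / n%:R))) = 4 * m%:R ^+ 2 * L / n%:R / 2 by field.
have : 4 * m%:R ^+ 2 * L / n%:R <= 1 - r by rewrite ler_pdivrMr.
by rewrite /q; lra.
Qed.

Lemma mclose_array k : (k <= n)%N ->
  mclose (nu k) (mu (node k)) (L * G * Gq / n%:R).
Proof.
move=> kn; have e0 : 0 <= L * G / n%:R by rewrite divr_ge0// mulr_ge0.
have H := @mclose_chain _ _ _ P n m q nu (fun k => mu (node k)) _ (0 : R)
  array_rate m_gt0 array_contracts e0 nuP.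
have -> : L * G * Gq / n%:R = L * G / n%:R * Gq + 0 * q ^+ (k %/ m) by rewrite mul0r addr0 mulrAC.
apply: H => // [j f c jn bf fc|f c bf fc].
  have j1 : node j \in `[0, 1] by rewrite node01// ltnW.
  have j2 : node j.+1 \in `[0, 1] by exact: node01.
  (* By invariance of the law at the new node, the one-step defect is the distance of two
     neighbouring invariant laws, tested on a function averaged once. *)
  rewrite (muQ j2 bf) -(node_step j).
  by apply: mclose_invariant => //; [exact: bmeas_rop|exact: rosc_rop].
by rewrite /node mul0r nu0// subrr normr0 mul0r.
Qed.

Lemma array_bmeas k : (k < n)%N -> bmeas (xi k.+1).
Proof. by move=> kn; apply: bmeasB; [apply: bg; exact: node01|exact: bmeas_cst]. Qed.
Let bxi := array_bmeas.

Lemma array_le k x : (k < n)%N -> `|xi k.+1 x| <= 2 * K.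
Proof.
by move=> kn; apply: rosc_mean; [apply: bg; exact: node01|apply: gc; exact: node01].
Qed.

Lemma array_centered k : (k < n)%N -> \int[nu k.+1]_x xi k.+1 x = 0.
Proof.
move=> kn; have pT := @probability_setT _ _ _ (nu k.+1).
rewrite bmeas_RintegralB//; [|by apply: bg; exact: node01|exact: bmeas_cst].
by rewrite Rintegral1_cst// subrr.
Qed.

Let E := D + 2 * Cg + G * (2 * Cg + D).

Let corr_pcorr k : (k <= n)%N ->
  rosc_le (fun x => corr n P xi k x - A (node k) (n - k) x) (Gq * (E / n%:R)).
Proof.
move=> kn; apply: (@rosc_rec _ _ _ P n m q array_rate m_gt0 array_contracts
   (fun k x => corr n P xi k x - A (node k) (n - k) x)) kn.
- move=> j jn; apply: bmeasB; last by apply: bA; exact: node01.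
  by apply: bmeas_corr => //; exact: bxi.
- by move=> x y; rewrite subnn /corr backseq_last /A.
- by rewrite divr_ge0// /E; nneg.
move=> j jn; have j1 : node j \in `[0, 1] by rewrite node01// ltnW.
have j2 : node j.+1 \in `[0, 1] by exact: node01.
pose N := (n - j.+1)%N; pose c := \int[nu j.+1]_y g (node j.+1) y.
have bc : bmeas (corr n P xi j.+1) by apply: bmeas_corr => //; exact: bxi.
have -> : E / n%:R = D * `|node j.+1 - node j| + 2 * (Cg * `|node j.+1 - node j|) +
    G * (2 * Cg + D) * `|node j.+1 - node j| by rewrite node_step /E; ring.
rewrite (_ : (fun x => _) = (fun x => (rop (P j.+1) (fun y => g (node j) y + A (node j) N y) x -
    rop (Q (node j)) (fun y => g (node j) y + A (node j) N y) x) +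
    (rop (P j.+1) (fun y => g (node j.+1) y - g (node j) y) x) +
    (rop (P j.+1) (fun y => A (node j.+1) N y - A (node j) N y) x) - c)).
  apply: rosc_leDc; apply: rosc_leD; first apply: rosc_leD; first exact: swap_osc.
  - by apply: rosc_rop; [apply: bmeasB; exact: bg|exact: g_osc].
  - by apply: rosc_rop; [apply: bmeasB; exact: bA|exact: rosc_pcorr_lipschitz].
have bg1 := bg j1; have bg2 := bg j2; have bA1 := bA N j1; have bA2 := bA N j2; have bx := bxi jn.
rewrite /A in bA1 bA2 *; apply/funext => x; rewrite corrE// -(subnSK jn) -/N pcorrS//.
rewrite !ropB ?ropD//; last exact: bmeas_cst.
by rewrite rop_cst -/c /P; ring.
Qed.

Definition tau_error := 4 * (L * G * Gq) * (2 * K * (2 * K)) +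
   2 * (4 * (L * G * Gq) * (2 * K * ((2 * Gq + G) * (2 * K))) + 2 * K * (Gq * E)).

Lemma tau_psvar k : (k < n)%N ->
  `|tau n P nu xi k.+1 - psvar (P k.+1) (mu (node k.+1)) (g (node k.+1)) (n - k.+1)| <=
  tau_error / n%:R.
Proof.
move=> kn; have k1 := node01 kn; have bgk := bg k1.
have bck : bmeas (corr n P xi k.+1) by apply: bmeas_corr => //; exact: bxi.
have bAk := bA (n - k.+1) k1.
have pT := @probability_setT _ _ _ (nu k.+1).
have tauE : tau n P nu xi k.+1 = gkvar (nu k.+1) (g (node k.+1)) (corr n P xi k.+1).
  rewrite /gkvar (cov_shift _ (\int[nu k.+1]_y g (node k.+1) y) (\int[nu k.+1]_y g (node k.+1) y) bgk bgk).
  rewrite (cov_shift _ (\int[nu k.+1]_y g (node k.+1) y) 0 bgk bck) subrr !mul0r !subr0 /tau.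
  by under [X in _ = _ + 2 * X]eq_Rintegral do rewrite subr0.
rewrite tauE.
pose c := 2 * K; pose c' := (2 * Gq + G) * (2 * K).
have oc : rosc_le (corr n P xi k.+1) c'.
  (* [c'] is the sum of the oscillation bounds of the two correctors, so that it serves for both. *)
  apply: (@rosc_le_trans _ _ _ _ (2 * (2 * K) * Gq)); last first.
    by move=> x y; apply: (osc_corr array_rate m_gt0 array_contracts bxi array_le).
  rewrite /c' mulrDl; have : 0 <= G * (2 * K) by nneg.
  lra.
have := @gkvar_close _ _ _ (nu k.+1) (mu (node k.+1)) (L * G * Gq / n%:R) (g (node k.+1)) (g (node k.+1))
  (corr n P xi k.+1) (A (node k.+1) (n - k.+1)) c c' 0 (Gq * (E / n%:R)).
move=> h; apply: (le_trans (h _ _ _ _ _ _ _ _ _ _ _ _)) => //; last 1 first.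
- by rewrite le_eqVlt; apply/orP; left; apply/eqP; rewrite /tau_error /c /c'; ring.
- by rewrite divr_ge0//; nneg.
- exact: mclose_array.
- exact: gc.
- exact: gc.
- apply: (@rosc_le_trans _ _ _ _ (G * (2 * K))); last exact: oA.
  by rewrite /c' [(_ + G) * _]mulrDl lerDr; nneg.
- by move=> x y; rewrite !subrr normr0.
- exact: corr_pcorr.
Qed.

(** The n errors of size 1 / n add up to [tau_error]; the truncation errors form a geometric
    series. *)
Lemma total_var_avar B : 0 <= B ->
  (forall (u : R) N, u \in `[0, 1] ->
    `|avar (Q u) (mu u) (g u) - psvar (Q u) (mu u) (g u) N| <= B * r ^+ (N %/ m)) ->
  `|total_var n P nu xi - \sum_(k < n) avar (Q (node k.+1)) (mu (node k.+1)) (g (node k.+1))| <=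
  tau_error + B * G.
Proof.
move=> B0 hB; rewrite /total_var -sumrB (le_trans (ler_norm_sum _ _ _))//.
apply: (@le_trans _ _ (\sum_(k < n) (tau_error / n%:R + B * r ^+ ((n - k.+1) %/ m)))).
  apply: ler_sum => k _; have kn := ltn_ord k.
  have h1 := tau_psvar kn; have h2 := hB _ (n - k.+1)%N (node01 kn).
  rewrite -(subrKA (psvar (P k.+1) (mu (node k.+1)) (g (node k.+1)) (n - k.+1))).
  by rewrite (le_trans (ler_normD _ _))// lerD// distrC.
rewrite big_split/= sumr_const card_ord -[_ *+ n]mulr_natr divfK// lerD2l.
rewrite -mulr_sumr ler_wpM2l//.
rewrite (reindex_inj rev_ord_inj)/=.
rewrite (eq_bigr (fun k : 'I_n => r ^+ (k %/ m))); first exact: sum_decay_le.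
by move=> k _; congr (_ ^+ (_ %/ _)); rewrite subnSK// subKn// ltnW.
Qed.

Lemma array_mean :
  `|\sum_(k < n) \int[nu k.+1]_x g (node k.+1) x -
    \sum_(k < n) \int[mu (node k.+1)]_x g (node k.+1) x| <= L * G * Gq * (2 * K).
Proof.
rewrite -sumrB (le_trans (ler_norm_sum _ _ _))//.
apply: (@le_trans _ _ (\sum_(k < n) (L * G * Gq / n%:R * (2 * K)))).
  apply: ler_sum => k _; have kn := ltn_ord k.
  by apply: mclose_array => //; [apply: bg; exact: node01|apply: gc; exact: node01].
rewrite sumr_const card_ord -[_ *+ n]mulr_natr.
have -> // : L * G * Gq / n%:R * (2 * K) * n%:R = L * G * Gq * (2 * K) by field.
Qed.

End array.

Lemma berry_esseen_family (a b : R) : 0 < a ->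
  a ^+ 2 = \int[lebesgue_measure]_(u in `[0, 1]) avar (Q u) (mu u) (g u) ->
  b = \int[lebesgue_measure]_(u in `[0, 1]) \int[mu u]_x g u x ->
  exists2 C, 0 < C & forall n d' (Omega : measurableType d') (Pr : probability Omega R)
    (X : nat -> {RV Pr >-> T}), (0 < n)%N ->
    markov_chain n (mu 0) (fun k => Q (k%:R / n%:R)) X -> forall t,
    `|fine (Pr [set w | \sum_(1 <= k < n.+1) g (k%:R / n%:R) (X k w) - b * n%:R
                  <= a * Num.sqrt n%:R * t]) - gauss_cdf t| <= C / Num.sqrt n%:R.
Proof.
move=> a0 a_def b_def; have /andP[r0 r1] := r01.
have [B B0 hB] := avar_close; have [Ca Ca0 hCa] := avar_lipschitz.
have [Cm Cm0 hCm] := mean_lipschitz.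
pose q := (1 + r) / 2; pose Gq := m%:R / (1 - q); pose kappa := 2 * K.
have q01 : 0 <= q < 1 by rewrite /q; apply/andP; split; lra.
have q1 : 0 < 1 - q by case/andP: q01 => _; rewrite subr_gt0.
have Gq0 : 0 <= Gq by rewrite divr_ge0// ltW.
have kappa0 : 0 <= kappa by rewrite mulr_ge0.
have [H HE] : exists H, H = 202 * (Gq ^+ 2 * kappa ^+ 3) by eexists.
have H0 : 0 <= H by rewrite HE; exact: mulr_ge0 (ler0n _ _) (mulr_ge0 (sqr_ge0 _) (exprn_ge0 _ kappa0)).
have a2 : 0 < a ^+ 2 by rewrite exprn_gt0.
have q2 : 0 < (1 - q) ^+ 2 by rewrite exprn_gt0.
have [delta delta0 [delta1 delta2]] : exists2 delta, 0 < delta &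
    64 * m%:R * (kappa * delta) <= (1 - q) ^+ 2 /\ 8 * (H * delta) <= a ^+ 2.
  (* [delta] is the inverse of a sum dominating both ratios; the 1 keeps it positive. *)
  pose z := 1 + 64 * m%:R * kappa / (1 - q) ^+ 2 + 8 * H / a ^+ 2.
  have z1 : 0 <= 64 * m%:R * kappa / (1 - q) ^+ 2 by nneg.
  have z2 : 0 <= 8 * H / a ^+ 2 by nneg.
  have z0 : 0 < z by rewrite /z; lra.
  have dz (y : R) : 0 <= y -> y <= z -> y * z^-1 <= 1.
    by move=> y0 yz; rewrite ler_pdivrMr// mul1r.
  exists z^-1; first by rewrite invr_gt0.
  split.
    have : 64 * m%:R * kappa / (1 - q) ^+ 2 * z^-1 <= 1 by apply: dz => //; rewrite /z; lra.
    by rewrite mulrAC ler_pdivrMr// mul1r mulrA.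
  have : 8 * H / a ^+ 2 * z^-1 <= 1 by apply: dz => //; rewrite /z; lra.
  by rewrite mulrAC ler_pdivrMr// mul1r mulrA.
have [C4 C4E] : exists C4, C4 = tau_error + B * G + Ca by eexists.
have [C6 C6E] : exists C6, C6 = L * G * Gq * (2 * K) + Cm by eexists.
have C60 : 0 <= C6 by rewrite C6E; nneg.
have C40 : 0 <= C4 by rewrite C4E /tau_error; nneg.
have [DB DBE] : exists DB, DB = 2 * expR 8 * (4 * (H * delta) / a ^+ 2 + C4 * delta ^+ 2).
  by eexists.
have DB0 : 0 <= DB by rewrite DBE; nneg.
(* Sum of the three thresholds on [n]: for [n_large], [V_large] and [T_ge1]. *)
have [X0 X0E] : exists X0, X0 = 4 * m%:R ^+ 2 * L / (1 - r) + 2 * C4 / a ^+ 2 +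
    ((a * delta) ^+ 2)^-1 by eexists.
have x1 : 0 <= 4 * m%:R ^+ 2 * L / (1 - r).
  by apply: divr_ge0; [nneg|rewrite subr_ge0 ltW].
have x2 : 0 <= 2 * C4 / a ^+ 2 by nneg.
have x3 : 0 <= ((a * delta) ^+ 2)^-1 by rewrite invr_ge0 sqr_ge0.
have X00 : 0 <= X0 by rewrite X0E addr_ge0// addr_ge0.
have [C1 C1E] : exists C1, C1 = (512 + 8 * DB) / (a * delta) + C6 / a by eexists.
have ad0 : 0 < a * delta by rewrite mulr_gt0.
have C10 : 0 <= C1.
  have p0 : 0 <= 512 + 8 * DB := addr_ge0 (ler0n _ _) (mulr_ge0 (ler0n _ _) DB0).
  by rewrite C1E; exact: (addr_ge0 (divr_ge0 p0 (ltW ad0)) (divr_ge0 C60 (ltW a0))).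
have s0 := sqrtr_ge0 X0.
have s1 : 0 < Num.sqrt X0 + 1 by rewrite ltr_wpDl.
(* The first term covers n < X0, where the claimed bound is at least 1; [C1] covers the remaining
   n. *)
exists (Num.sqrt X0 + 1 + C1); first exact: ltr_wpDr.
move=> n d' Omega Pr X n_gt0 chainX t.
have nR : 0 < n%:R :> R by rewrite ltr0n.
have sn : 0 < Num.sqrt n%:R :> R by rewrite sqrtr_gt0.
pose node k : R := k%:R / n%:R.
have node01 k : (k <= n)%N -> node k \in `[0, 1].
  by move=> kn; rewrite in_itv/= divr_ge0//= ler_pdivrMr// mul1r ler_nat.
pose nu := law X; pose xi k x := g (node k) x - \int[nu k]_y g (node k) y.
have PT := @probability_setT _ _ _ Pr.
have bxi := array_bmeas n_gt0 nu.
pose S w := \sum_(j < n) xi j.+1 (X j.+1 w).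
have bS : bmeas S.
  have h k : (k <= n)%N -> bmeas (fun w => \sum_(j < k) xi j.+1 (X j.+1 w)).
    elim: k => [|k IH] kn; first by under eq_fun do rewrite big_ord0; exact: bmeas_cst.
    under eq_fun do rewrite big_ord_recr/=.
    by apply: bmeasD; [apply: IH; exact: ltnW|exact: (bmeas_comp X k.+1 (bxi k kn))].
  exact: h.
pose M := \sum_(k < n) \int[nu k.+1]_x g (node k.+1) x.
have sumE w : \sum_(1 <= k < n.+1) g (k%:R / n%:R) (X k w) = S w + M.
  by rewrite big_add1/= big_mkord /S /M /xi sumrB subrK.
(* Centring at the true mean [M] instead of b n shifts [t] by O(1 / sqrt n), harmless since the
   Gaussian distribution function is Lipschitz. *)
pose t' := t + (b * n%:R - M) / (a * Num.sqrt n%:R).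
have asn : 0 < a * Num.sqrt n%:R by rewrite mulr_gt0.
have -> : [set w | \sum_(1 <= k < n.+1) g (k%:R / n%:R) (X k w) - b * n%:R
    <= a * Num.sqrt n%:R * t] = [set w | S w <= a * Num.sqrt n%:R * t'].
  apply/funext => w /=; rewrite sumE /t' mulrDr [X in _ = is_true (_ <= _ + X)]mulrC divfK ?gt_eqF//.
  by rewrite lerBlDr -lerBrDr addrA.
rewrite ler_pdivlMr//.
have [nX|Xn] := ltP n%:R X0.
  have gE : gauss_cdf t = @cdf_of _ _ _ (@normal_prob R 0 1) (fun x => x) t.
    by rewrite gauss_cdfE /cdf_of; congr (fine (_ _)); apply/funext => x /=; rewrite in_itv.
  have := cdf_of_bounds (@normal_prob R 0 1) t (@measurable_id _ R setT).
  rewrite gE; have := cdf_of_bounds Pr (a * Num.sqrt n%:R * t') bS.1.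
  rewrite /cdf_of => p1 p2.
  have h1 : Num.sqrt n%:R <= Num.sqrt X0 by rewrite ler_wsqrtr// ltW.
  rewrite -addrA (le_trans _ (ler_wpDr (addr_ge0 ler01 C10) h1))// ler_piMl ?(ltW sn)//.
  exact: norm_sub_le1.
have [X1 X2 X3] : [/\ 4 * m%:R ^+ 2 * L / (1 - r) <= n%:R, 2 * C4 / a ^+ 2 <= n%:R &
    ((a * delta) ^+ 2)^-1 <= n%:R :> R].
  by apply: sum3_le => //; rewrite -X0E.
have n_large : 4 * m%:R ^+ 2 * L <= (1 - r) * n%:R.
  by rewrite [(1 - r) * _]mulrC -ler_pdivrMr ?subr_gt0.
have nu0 f : bmeas f -> \int[nu 0%N]_x f x = \int[mu 0]_x f x := law0 chainX (f := f).
have nuP k f : (k < n)%N -> bmeas f ->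
    \int[nu k.+1]_x f x = \int[nu k]_x rop (Q (node k.+1)) f x.
  by move=> kn bf; exact: (lawP chainX kn bf).
have contrP := array_contracts n_gt0 n_large.
have V_close : `|total_var n (fun k => Q (node k)) nu xi - n%:R * a ^+ 2| <= C4.
  have h1 := total_var_avar n_gt0 n_large nuP nu0 B0 hB.
  have h2 := lipschitz_riemann_sum n_gt0 hCa; rewrite -a_def in h2.
  rewrite -(subrKA (\sum_(k < n) avar (Q (node k.+1)) (mu (node k.+1)) (g (node k.+1)))).
  by rewrite (le_trans (ler_normD _ _))// C4E lerD.
have M_close : `|b * n%:R - M| <= C6.
  have h1 := array_mean n_gt0 n_large nuP nu0.
  have h2 := lipschitz_riemann_sum n_gt0 hCm; rewrite -b_def in h2.
  rewrite distrC mulrC -(subrKA (\sum_(k < n) \int[mu (node k.+1)]_x g (node k.+1) x)).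
  by rewrite (le_trans (ler_normD _ _))// C6E lerD.
have charS (s : R) : `|s| <= delta ->
    cn (cint Pr (fun w => expi (s * S w)) -
      (expR (- (s ^+ 2 * total_var n (fun k => Q (node k)) nu xi / 2)))%:C%C) <=
    expR (- (s ^+ 2 * total_var n (fun k => Q (node k)) nu xi / 2)) *
      (n%:R * (H * `|s| ^+ 3) * expR (n%:R * (H * `|s| ^+ 3))).
  move=> sd; rewrite (charfun_chain chainX s bxi).
  have small : 64 * m%:R * (kappa * `|s|) <= (1 - q) ^+ 2.
    by apply: (le_trans _ delta1); apply: ler_wpM2l; [exact: mulr_ge0|exact: ler_wpM2l].
  have := charfun_expansion q01 m_gt0 contrP bxi (array_le n_gt0 nu) nuP (array_centered n_gt0 nu) small n_gt0 erefl.
  by rewrite -/Gq (_ : 202 * _ = H * `|s| ^+ 3)//; rewrite HE /kappa; ring.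
have V_large : 2 * C4 <= n%:R * a ^+ 2.
  by rewrite -ler_pdivrMr.
have T_ge1 : 1 <= a * delta * Num.sqrt n%:R.
  rewrite -(@ler_pXn2r _ 2)// ?nnegrE//; last by rewrite !mulr_ge0// ltW.
  rewrite expr1n exprMn (sqr_sqrtr (ltW nR)) [_ * n%:R]mulrC -ler_pdivrMr; last first.
    by rewrite exprn_gt0.
  by rewrite mul1r.
have BE := berry_esseen_charfun bS a0 delta0 H0 n_gt0 charS V_close V_large delta2 T_ge1 t'.
have GL := gauss_cdf_lipschitz t' t.
have tt : `|t' - t| <= C6 / a / Num.sqrt n%:R.
  rewrite /t' addrAC subrr add0r normrM normfV (ger0_norm (ltW asn)) -mulrA -invfM.
  by rewrite ler_wpM2r// invr_ge0 ltW.
have := lerD BE (le_trans GL tt).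
rewrite -DBE => /(le_trans (ler_normD _ _)); rewrite subrKA => h.
rewrite -ler_pdivlMr// (le_trans h)//.
have -> : (512 + 8 * DB) / (a * delta * Num.sqrt n%:R) + C6 / a / Num.sqrt n%:R = C1 / Num.sqrt n%:R.
  by rewrite C1E; field; rewrite !gt_eqF.
by apply: ler_wpM2r; [rewrite invr_ge0 ltW|rewrite lerDr ltW].
Qed.

End kernel_family.

(** * The theorem, from the estimate for kernel families *)

Theorem theorem4 (R : realType) (E : pointedMetricType R)
    (Q : R -> R.-pker (borel E) ~> (borel E))
    (g : R -> borel E -> R)
    (L r K Cg : R) (m : nat)
    (g_meas : measurable_fun (`[0 : R, 1] `*` [set: borel E])
                (fun p : R * borel E => g p.1 p.2))
    (L_gt0 : 0 < L)
    (Q_lip : forall u v : R, u \in `[0, 1] -> v \in `[0, 1] ->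
      (ereal_sup [set tv_dist (Q u x) (Q v x) | x in [set: borel E]]
        <= (L * `|u - v|)%:E)%E)
    (m_ge1 : (1 <= m)%N) (r_gt0 : 0 < r) (r_lt1 : r < 1)
    (Q_contr : forall u : R, u \in `[0, 1] ->
      (ereal_sup [set tv_dist (kpow (Q u) m z.1) (kpow (Q u) m z.2) |
          z in [set: borel E * borel E]] <= r%:E)%E)
    (g_bounded : forall (u : R) x, u \in `[0, 1] -> `|g u x| <= K)
    (Cg_ge0 : 0 <= Cg)
    (g_lip : forall (u v : R) x, u \in `[0, 1] -> v \in `[0, 1] ->
      `|g u x - g v x| <= Cg * `|u - v|)
    (* the invariant probability measures *)
    (mu : R -> probability (borel E) R)
    (mu_inv : forall u : R, u \in `[0, 1] -> invariant_measure (Q u) (mu u))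
    (* the inhomogeneous chains X_{n,0}, ..., X_{n,n} *)
    (dX : nat -> measure_display)
    (OmegaX : forall n, measurableType (dX n))
    (PX : forall n, probability (OmegaX n) R)
    (X : forall n, nat -> {RV (PX n) >-> borel E})
    (X_chain : forall n, (1 <= n)%N ->
      markov_chain n (mu 0) (fun k => Q (k%:R / n%:R)) (X n))
    (* the stationary chains (Y_{j,u})_{j >= 0} *)
    (dY : R -> measure_display)
    (OmegaY : forall u, measurableType (dY u))
    (PY : forall u, probability (OmegaY u) R)
    (Y : forall u, nat -> {RV (PY u) >-> borel E})
    (Y_chain : forall u : R, u \in `[0, 1] ->
      forall N, markov_chain N (mu u) (fun=> Q u) (Y u))
    (a b : R)
    (b_def : b = \int[lebesgue_measure]_(u in `[0, 1]) \int[mu u]_x g u x)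
    (a_ge0 : 0 <= a)
    (a_def : a ^+ 2 = \int[lebesgue_measure]_(u in `[0, 1])
                        asymptotic_variance (g u) (Y u))
    (a_gt0 : 0 < a) :
  exists C : R, 0 < C /\
    forall n : nat, (1 <= n)%N ->
      (ereal_sup
        [set `| fine (PX n [set w |
                  \sum_(1 <= k < n.+1) g (k%:R / n%:R) (X n k w) - b * n%:R
                    <= a * Num.sqrt n%:R * t])
                - gauss_cdf t |%:E | t in [set: R]]
       <= (C / Num.sqrt n%:R)%:E)%E.
Proof.
have r01 : 0 <= r < 1 by rewrite (ltW r_gt0).
have tvL (u v : R) x : u \in `[0, 1] -> v \in `[0, 1] ->
    (tv_dist (Q u x) (Q v x) <= (L * `|u - v|)%:E)%E.
  by move=> u1 v1; apply: le_trans (Q_lip u v u1 v1); apply: ereal_sup_ubound; exists x.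
have tvm (u : R) x y : u \in `[0, 1] ->
    (tv_dist (kpow (Q u) m x) (kpow (Q u) m y) <= r%:E)%E.
  by move=> u1; apply: le_trans (Q_contr u u1); apply: ereal_sup_ubound; exists (x, y).
have bg (u : R) : u \in `[0, 1] -> bmeas (g u).
  move=> u1; split; last by exists K => x; exact: g_bounded.
  (* Sections of a jointly measurable function are measurable; u in [0, 1] keeps the section inside
     the domain. *)
  apply: (measurable_comp (F := `[0 : R, 1] `*` [set: borel E]) _ _ g_meas (g := fun x => (u, x))).
  - by apply: measurableX.
  - by move=> _ [x _ <-].
  - exact: measurable_fun_pair.
have muQ (u : R) (f : borel E -> R) : u \in `[0, 1] -> bmeas f ->
    \int[mu u]_x f x = \int[mu u]_x rop (Q u) f x.
  move=> u1 bf; apply: Rintegral_rop => //; try exact: probability_setT.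
  exact: mu_inv.
have contr (u : R) : u \in `[0, 1] -> forall n, contracts (fun=> Q u) n m r.
  by move=> u1 n; apply: contracts_homogeneous => x y; exact: tvm.
have avarE : \int[lebesgue_measure]_(u in `[0, 1]) asymptotic_variance (g u) (Y u) =
    \int[lebesgue_measure]_(u in `[0, 1]) avar (Q u) (mu u) (g u).
  apply: eq_Rintegral => u; rewrite inE => u1.
  apply: (asymptotic_varianceE m_ge1 r01 (contr u u1) (bg u u1) (c := 2 * K)) => //.
  - by apply: rosc_le_norm => x; exact: g_bounded.
  - by move=> f; exact: muQ.
  - exact: Y_chain.
rewrite avarE in a_def.
have [C C0 hC] := berry_esseen_family (ltW L_gt0) tvL m_ge1 r01 tvm bg
  (fun u x => @g_bounded u x) Cg_ge0 g_lip muQ a_gt0 a_def b_def.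
exists C; split=> // n n1; apply: ge_ereal_sup => _ [t _ <-].
rewrite lee_fin; exact: (hC n _ _ _ _ n1 (X_chain n n1)).
Qed.
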